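(* Let $H$ be a separable complex Hilbert space, and let $(a_n,j_n)$ ($n\in\mathbb{N}$), $(a,j)$ and $(b,j)$ be such that $a_n$ is a symmetric $j_n$-elliptic form on $H$ and $a$ and $b$ are symmetric $j$-elliptic forms on $H$. Denote by $A_n$, $A$ and $B$ the self-adjoint operators on $H$ associated with $(a_n,j_n)$, $(a,j)$ and $(b,j)$, respectively. Assume that (i) $(b,j)\le(a_n,j_n)$ for all $n\in\mathbb{N}$, (ii) $-B$ generates a Gibbs semigroup, and (iii) $(A_n)$ converges to $A$ in the strong resolvent sense. Then $\lim_{n\to\infty}e^{-tA_n}=e^{-tA}$ in $\mathcal{L}_1(H)$ (trace norm) for every $t>0$.
   Context: Let $V$ be a Hilbert space and $j\colon V\to H$ bounded linear with dense range. A sesquilinear form $a\colon V\times V\to\mathbb{C}$ is called a $j$-elliptic form on $H$ with form domain $V$ if it is continuous and there exist $\omega\in\mathbb{R}$, $\mu>0$ with $\operatorname{Re} a(u,u)-\omega\|j(u)\|_H^2\ge\mu\|u\|_V^2$ for all $u\in V$; it is symmetric if $a(u,v)=\overline{a(v,u)}$. The operator $A$ on $H$ associated with $(a,j)$ is given by: $x\in D(A)$ and $Ax=f$ if and only if $x, f\in H$ and there exists $u\in V$ with $j(u)=x$ and $a(u,v)=(f\mid j(v))_H$ for all $v\in V$; for symmetric $a$ it is self-adjoint and bounded below. For symmetric $j_i$-elliptic forms $a_i$ on $H$ with form domains $V_i$ ($i=1,2$), $(a_1,j_1)\ge(a_2,j_2)$ (equivalently $(a_2,j_2)\le(a_1,j_1)$)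 means: $j_1(V_1)\subset j_2(V_2)$, and $a_1(u_1,u_1)\ge a_2(u_2,u_2)$ whenever $u_1\in V_1$, $u_2\in V_2$ satisfy $j_1(u_1)=j_2(u_2)$. A Gibbs semigroup is a $C_0$-semigroup $(T(t))_{t\ge0}$ on $H$ such that $T(t)$ is of trace class for every $t>0$. $\mathcal{L}_1(H)$ is the space of trace class operators on $H$ with the trace norm. *)

(* Defs.v *)
From HB Require Import structures.
From mathcomp Require Import all_boot all_order all_algebra.
From mathcomp Require Import sesquilinear complex.
From mathcomp Require Import all_classical all_reals all_analysis.
Set Implicit Arguments.
Unset Strict Implicit.
Unset Printing Implicit Defensive.
Import Order.TTheory GRing.Theory Num.Theory.
Import numFieldNormedType.Exports.
Local Open Scope classical_set_scope.
Local Open Scope complex_scope.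
Local Open Scope ring_scope.

(* Sesquilinear forms are linear in the first argument and antilinear in the
   second one. *)
Notation sesquilinear_form R V :=
  {bilinear V%type -> V%type -> R%type[i] | *%R & (@conjc R%type \; *%R)}.

HB.mixin Record isHilbert (R : realType) H of CompleteNormedModule R[i] H := {
  inner : {dot H for @conjc R} ;
  sqr_norm_inner : forall x : H, `|x| ^+ 2 = inner x x
}.

#[short(type="hilbertType")]
HB.structure Definition Hilbert (R : realType) :=
  {H of isHilbert R H & CompleteNormedModule R[i] H}.

Definition separable_space (T : topologicalType) : Prop :=
  exists2 D : set T, countable D & dense D.

Section Forms.
Variables (R : realType) (H : hilbertType R).

Definition symmetric_sesquilinear (V : hilbertType R)
    (a : sesquilinear_form R V) : Prop :=
  forall u v, a u v = (a v u)^*%C.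

(* The boundedness and dense range of j are part of this predicate. *)
Definition j_elliptic (V : hilbertType R) (j : {linear V -> H})
    (a : sesquilinear_form R V) : Prop :=
  [/\ continuous j, dense (range j),
      continuous (fun uv : V * V => a uv.1 uv.2 : R[i]^o) &
      exists omega mu : R, 0 < mu /\ forall u : V,
        mu%:C * `|u| ^+ 2 <= (complex.Re (a u u))%:C - omega%:C * `|j u| ^+ 2].

(* form_le a2 j2 a1 j1 is (a2, j2) <= (a1, j1); the order on R[i] compares real
   parts of numbers with the same imaginary part. *)
Definition form_le (V2 : hilbertType R) (a2 : sesquilinear_form R V2)
    (j2 : {linear V2 -> H}) (V1 : hilbertType R) (a1 : sesquilinear_form R V1)
    (j1 : {linear V1 -> H}) : Prop :=
  range j1 `<=` range j2 /\
  forall u1 u2, j1 u1 = j2 u2 -> a2 u2 u2 <= a1 u1 u1.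

End Forms.

Section Operators.
Variables (R : realType) (H : hilbertType R).

(* Unbounded operators are given by their graph: A x f means that x is in the
   domain of A and A x = f. *)
Definition graph := H -> H -> Prop.

Definition form_operator (V : hilbertType R) (a : sesquilinear_form R V)
    (j : {linear V -> H}) : graph :=
  fun x f => exists u : V, j u = x /\ forall v : V, a u v = inner f (j v).

Definition opp_graph (A : graph) : graph := fun x f => A x (- f).

(* (A - z)^{-1} x *)
Definition resolvent (A : graph) (z : R[i]) (x : H) : H :=
  xget 0 [set y | A y (x + z *: y)].

Definition strong_resolvent_cvg (A_ : nat -> graph) (A : graph) : Prop :=
  forall z : R[i], complex.Im z != 0 -> forall x : H,
    resolvent (A_ n) z x @[n --> \oo] --> resolvent A z x.

Definition bounded_operator (S : H -> H) : Prop := linear S /\ continuous S.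

(* Semigroups are indexed by all of R; their values at t < 0 are irrelevant. *)
Definition C0_semigroup (T : R -> H -> H) : Prop :=
  [/\ forall t, 0 <= t -> bounded_operator (T t),
      T 0 = id,
      forall s t, 0 <= s -> 0 <= t -> T (s + t) = T s \o T t &
      forall x, T h x @[h --> 0^'+] --> x].

Definition generator (T : R -> H -> H) : graph :=
  fun x f => (h^-1)%:C *: (T h x - x) @[h --> 0^'+] --> f.

Definition generates (G : graph) (T : R -> H -> H) : Prop :=
  C0_semigroup T /\ forall x f, generator T x f <-> G x f.

(* exp_opp A t is e^{-tA} for t >= 0, i.e. the C_0-semigroup generated by -A,
   which is unique on t >= 0. *)
Definition exp_opp (A : graph) : R -> H -> H :=
  xget ((fun=> id) : R -> H -> H) [set T | generates (opp_graph A) T].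

Definition orthonormal_basis (E : set H) : Prop :=
  [/\ forall e, E e -> inner e e = 1,
      forall e f, E e -> E f -> e <> f -> inner e f = 0 &
      forall x, (forall e, E e -> inner x e = 0) -> x = 0].

(* P is the positive square root of S^* S: the last clause says that
   P (P x) = S^* (S x). *)
Definition is_abs_operator (S P : H -> H) : Prop :=
  [/\ bounded_operator P, forall x, 0 <= inner (P x) x &
      forall x y, inner (P (P x)) y = inner (S x) (S y)].

Definition abs_operator (S : H -> H) : H -> H :=
  xget ((fun=> 0) : H -> H) [set P | is_abs_operator S P].

(* Trace of a positive operator; it does not depend on the chosen basis. *)
Definition pos_trace (P : H -> H) : \bar R :=
  \esum_(e in xget (set0 : set H) [set E | orthonormal_basis E])
    (complex.Re (inner (P e) e))%:E.

Definition trace_norm (S : H -> H) : \bar R := pos_trace (abs_operator S).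

Definition trace_class (S : H -> H) : Prop :=
  bounded_operator S /\ (trace_norm S < +oo)%E.

Definition gibbs_semigroup (T : R -> H -> H) : Prop :=
  C0_semigroup T /\ forall t, 0 < t -> trace_class (T t).

Definition cvg_trace_class (S_ : nat -> H -> H) (S : H -> H) : Prop :=
  [/\ forall n, trace_class (S_ n), trace_class S &
      trace_norm (S_ n \- S) @[n --> \oo] --> 0%E].

End Operators.

(* Main.v *)
(* Shift the forms so that [b >= 0], and write [T s = e^{-sB}].  From [b <= a_n] one gets
   [<(1 - T s) y, y> <= s <x, y>] for [y = A_n^-1 x], an inequality which involves [B]
   only through [T] and which passes to the strong limit [A].  Since [T s] is
   Hilbert-Schmidt, it makes the resolvents of [A_n] and [A] compact.  For a normalized
   eigenvector [f] of [A_n] with eigenvalue [mu] it reads [1 - <T s f, f> <= s mu].  By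
   Cauchy-Schwarz at dyadic times this gives [e^{-2 s mu} <= <T s f, f>], whose sum over
   [f] bounds the Hilbert-Schmidt norms of [e^{-tA_n}] uniformly in [n]; and
   [|(1 - T s) f|^2 <= s mu] makes [e^{-tA_n} (1 - T s)] small in Hilbert-Schmidt norm as
   [s] tends to 0, uniformly in [n].  Strong convergence of [X_n = e^{-tA_n/2}] to
   [X = e^{-tA/2}] then gives [(X_n - X) T s -> 0], hence [X_n - X -> 0], in
   Hilbert-Schmidt norm, and [2 (X_n^2 - X^2)] is
   [(X_n - X)(X_n + X) + (X_n + X)(X_n - X)]. *)

Require Import Defs.
From mathcomp Require Import all_boot all_order all_algebra.
From mathcomp Require Import sesquilinear complex finmap.
From mathcomp Require Import all_classical all_reals all_analysis.
From mathcomp Require Import ring lra.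
Import Order.TTheory GRing.Theory Num.Theory.
Import numFieldNormedType.Exports.
Local Open Scope classical_set_scope.
Local Open Scope ring_scope.
Set Implicit Arguments.
Unset Strict Implicit.
Unset Printing Implicit Defensive.

(** * Inner products *)

Section InnerProduct.
Context {R : realType} {H : hilbertType R}.
Implicit Types (x y z : H) (c : R[i]) (r : R).
Local Open Scope complex_scope.

(** The forms [a_n] live on different spaces, so [b <= a_n] is exploited only at vectors of [H]: a
    resolvent vector [y = A_n^-1 x] has a representative in each form domain, and [a_n] at its own
    equals [<x, y>]. The inequality [1 - e^{-s lambda} <= s lambda] then replaces the form [b] by
    the bounded operator [T s]. One shift serves all [n], because every [a_n] inherits the lower
    bound of [b].

    Compact resolvents turn functions of [A_n] and [A] into multipliers in eigenbases, whereas [B]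
    enters through an abstract [C_0]-semigroup whose symmetry and contractivity must be extracted
    from its generator. The eigenbases of different [A_n] are unrelated, so strong convergence of
    the exponentials cannot be read off from eigenvalues; it goes through [(1 + x / N)^-N], which
    approximates [e^{-x}] uniformly on [x >= 0].

    The time is halved because a product of two Hilbert-Schmidt operators has finite trace norm, and
    the difference of squares is symmetrized because [X_n] and [X] need not commute. *)

Definition rip x y : R := complex.Re (inner x y).
(** The norm of [H] is complex-valued and the order of [R[i]] is partial, so estimates are carried
    out with real squared norms; [c2] plays the same part for scalars. *)
Definition nsq x : R := rip x x.
(* The norm of [H], whose values are in [R[i]], as a real number. *)
Definition hn x : R := complex.Re `|x|.
Definition c2 c : R := complex.Re c ^+ 2 + complex.Im c ^+ 2.

Lemma innerDl x y z : inner (x + y) z = inner x z + inner y z.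
Proof. by rewrite linearDl. Qed.
Lemma innerDr x y z : inner z (x + y) = inner z x + inner z y.
Proof. by rewrite linearDr. Qed.
Lemma innerBl x y z : inner (x - y) z = inner x z - inner y z.
Proof. by rewrite linearBl. Qed.
Lemma innerBr x y z : inner z (x - y) = inner z x - inner z y.
Proof. by rewrite linearBr. Qed.
Lemma innerNl x z : inner (- x) z = - inner x z.
Proof. by rewrite linearNl. Qed.
Lemma innerNr x z : inner z (- x) = - inner z x.
Proof. by rewrite linearNr. Qed.
Lemma innerZl c x z : inner (c *: x) z = c * inner x z.
Proof. by rewrite linearZl_LR. Qed.
Lemma innerZr c x z : inner z (c *: x) = c^* * inner z x.
Proof. by rewrite linearZr_LR. Qed.
Lemma innerZrr r x z : inner z (r%:C *: x) = r%:C * inner z x.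
Proof. by rewrite innerZr; congr (_ * _); exact: conjc_real. Qed.
Lemma inner0l z : inner 0 z = 0.
Proof. by rewrite linear0l. Qed.
Lemma inner0r z : inner z 0 = 0.
Proof. by rewrite linear0r. Qed.
Lemma innerC x y : inner x y = (inner y x)^*.
Proof. by rewrite hermC expr0 mul1r. Qed.
Lemma inner_suml (I : Type) (s : seq I) (f : I -> H) z :
  inner (\sum_(i <- s) f i) z = \sum_(i <- s) inner (f i) z.
Proof. by rewrite linear_sumlz. Qed.
Lemma inner_sumr (I : Type) (s : seq I) (f : I -> H) z :
  inner z (\sum_(i <- s) f i) = \sum_(i <- s) inner z (f i).
Proof. by rewrite linear_sumr. Qed.

Lemma ReD (a b : R[i]) : complex.Re (a + b) = complex.Re a + complex.Re b.
Proof. by case: a b => ? ? []. Qed.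
Lemma ReN (a : R[i]) : complex.Re (- a) = - complex.Re a.
Proof. by case: a. Qed.
Lemma ReB (a b : R[i]) : complex.Re (a - b) = complex.Re a - complex.Re b.
Proof. by rewrite ReD ReN. Qed.
Lemma ReJ (a : R[i]) : complex.Re a^* = complex.Re a.
Proof. by case: a. Qed.
Lemma ReZ r (a : R[i]) : complex.Re (r%:C * a) = r * complex.Re a.
Proof. by case: a => a b /=; rewrite mul0r subr0. Qed.
Lemma Re_sum (I : Type) (s : seq I) (f : I -> R[i]) :
  complex.Re (\sum_(i <- s) f i) = \sum_(i <- s) complex.Re (f i).
Proof. by elim/big_rec2: _ => // i a b _ <-; rewrite ReD. Qed.

Lemma nsq_inner x : inner x x = (nsq x)%:C.
Proof. by rewrite /nsq /rip -sqr_norm_inner RRe_real// realX// normr_real. Qed.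

Lemma normhn x : `|x| = (hn x)%:C.
Proof. by rewrite /hn RRe_real// normr_real. Qed.

Lemma hn_ge0 x : 0 <= hn x.
Proof. by rewrite -ler0c -normhn. Qed.

Lemma nsq_hn x : nsq x = hn x ^+ 2.
Proof.
by apply/complexI; rewrite -nsq_inner -sqr_norm_inner normhn rmorphXn.
Qed.

Lemma nsq_ge0 x : 0 <= nsq x. Proof. by rewrite nsq_hn sqr_ge0. Qed.

Lemma hn_eq0 x : (hn x == 0) = (x == 0).
Proof. by rewrite -(inj_eq (@complexI R)) -normhn normr_eq0. Qed.

Lemma nsq_eq0 x : (nsq x == 0) = (x == 0).
Proof. by rewrite nsq_hn sqrf_eq0 hn_eq0. Qed.

Lemma nsq_gt0 x : (0 < nsq x) = (x != 0).
Proof. by rewrite lt_def nsq_ge0 andbT nsq_eq0. Qed.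

Lemma nsq_le0_eq0 x : nsq x <= 0 -> x = 0.
Proof. by move=> h; apply/eqP; rewrite -nsq_eq0 eq_le h nsq_ge0. Qed.

Lemma hnD x y : hn (x + y) <= hn x + hn y.
Proof. by have := ler_normD x y; rewrite !normhn -rmorphD lecR. Qed.

Lemma hnN x : hn (- x) = hn x. Proof. by rewrite /hn normrN. Qed.

Lemma hnB x y : hn (x - y) = hn (y - x). Proof. by rewrite -hnN opprB. Qed.

Lemma ripC x y : rip x y = rip y x.
Proof. by rewrite /rip innerC ReJ. Qed.
Lemma ripDl x y z : rip (x + y) z = rip x z + rip y z.
Proof. by rewrite /rip innerDl ReD. Qed.
Lemma ripDr x y z : rip z (x + y) = rip z x + rip z y.
Proof. by rewrite /rip innerDr ReD. Qed.
Lemma ripNl x z : rip (- x) z = - rip x z.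
Proof. by rewrite /rip innerNl ReN. Qed.
Lemma ripNr x z : rip z (- x) = - rip z x.
Proof. by rewrite /rip innerNr ReN. Qed.
Lemma ripBl x y z : rip (x - y) z = rip x z - rip y z.
Proof. by rewrite ripDl ripNl. Qed.
Lemma ripBr x y z : rip z (x - y) = rip z x - rip z y.
Proof. by rewrite ripDr ripNr. Qed.
Lemma ripZl r x z : rip (r%:C *: x) z = r * rip x z.
Proof. by rewrite /rip innerZl ReZ. Qed.
Lemma ripZr r x z : rip z (r%:C *: x) = r * rip z x.
Proof. by rewrite ripC ripZl ripC. Qed.
Definition ripE := (ripDl, ripDr, ripNl, ripNr, ripZl, ripZr).

Lemma nsq0 : nsq 0 = 0. Proof. by apply/eqP; rewrite nsq_eq0. Qed.
Lemma nsqN x : nsq (- x) = nsq x.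
Proof. by rewrite /nsq !ripE opprK. Qed.
Lemma nsqD x y : nsq (x + y) = nsq x + nsq y + 2 * rip x y.
Proof. by rewrite /nsq !ripE (ripC y x); ring. Qed.
Lemma nsqB x y : nsq (x - y) = nsq x + nsq y - 2 * rip x y.
Proof. by rewrite nsqD nsqN ripNr; ring. Qed.
Lemma nsqBC x y : nsq (x - y) = nsq (y - x).
Proof. by rewrite -nsqN opprB. Qed.
Lemma nsqD_le x y : nsq (x + y) <= 2 * nsq x + 2 * nsq y.
Proof. by have := nsq_ge0 (x - y); rewrite nsqB nsqD; lra. Qed.
Lemma nsqB_le x y : nsq (x - y) <= 2 * nsq x + 2 * nsq y.
Proof. by rewrite (le_trans (nsqD_le _ _))// nsqN. Qed.
Lemma nsq_tri x y z : nsq (x - z) <= 2 * nsq (x - y) + 2 * nsq (y - z).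
Proof. by rewrite (le_trans _ (nsqD_le _ _))// addrA subrK. Qed.
Lemma rip_le x y : 2 * rip x y <= nsq x + nsq y.
Proof. by have := nsq_ge0 (x - y); rewrite nsqB; lra. Qed.

Lemma c2_ge0 c : 0 <= c2 c. Proof. by rewrite addr_ge0 ?sqr_ge0. Qed.
Lemma c2M c c' : c2 (c * c') = c2 c * c2 c'.
Proof. by case: c c' => a b [d e]; rewrite /c2 /=; ring. Qed.
Lemma c2_real r : c2 r%:C = r ^+ 2.
Proof. by rewrite /c2 /= expr0n addr0. Qed.
Lemma c2J c : c2 c^* = c2 c.
Proof. by case: c => a b; rewrite /c2 /= sqrrN. Qed.
Lemma mulcJ c : c * c^* = (c2 c)%:C.
Proof. by case: c => a b; rewrite /c2; simpc; congr (_ +i* _); ring. Qed.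
Lemma c2_eq0 c : (c2 c == 0) = (c == 0).
Proof.
case: c => a b; rewrite /c2 /= paddr_eq0 ?sqr_ge0// !sqrf_eq0.
by rewrite eq_complex.
Qed.

Lemma nsqZ c x : nsq (c *: x) = c2 c * nsq x.
Proof.
rewrite /nsq /rip innerZl innerZr mulrA mulcJ nsq_inner -rmorphM/=.
by rewrite /nsq.
Qed.

Lemma nsqZr r x : nsq (r%:C *: x) = r ^+ 2 * nsq x.
Proof. by rewrite nsqZ c2_real. Qed.

Lemma hnZr r x : 0 <= r -> hn (r%:C *: x) = r * hn x.
Proof.
move=> r0; apply/eqP; rewrite -(eqrXn2 (n := 2))// ?hn_ge0 ?mulr_ge0 ?hn_ge0//.
by rewrite -nsq_hn nsqZr nsq_hn exprMn.
Qed.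

(** Cauchy-Schwarz: the squared norm of [|y|^2 x - <x, y> y] is
    [|y|^2 (|x|^2 |y|^2 - |<x, y>|^2)]. *)
Lemma inner_c2_le x y : c2 (inner x y) <= nsq x * nsq y.
Proof.
have [->|y0] := eqVneq y 0; first by rewrite inner0r nsq0 mulr0 c2_real expr0n.
have ygt0 : 0 < nsq y by rewrite nsq_gt0.
have := nsq_ge0 ((nsq y)%:C *: x - inner x y *: y).
rewrite nsqB nsqZr nsqZ /rip innerZl innerZr ReZ.
rewrite [_^* * _]mulrC mulcJ /=; set k := c2 _.
rewrite (_ : _ - _ = nsq y * (nsq x * nsq y - k)); last by ring.
by rewrite pmulr_rge0// subr_ge0.
Qed.

Lemma rip_c2_le x y : rip x y ^+ 2 <= nsq x * nsq y.
Proof.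
by rewrite (le_trans _ (inner_c2_le x y))// /c2 lerDl sqr_ge0.
Qed.

Lemma rip_hn_le x y : rip x y <= hn x * hn y.
Proof.
rewrite (le_trans (ler_norm _))// -(@ler_sqr _ `|rip x y|) ?nnegrE ?mulr_ge0 ?hn_ge0//.
by rewrite real_normK ?num_real// exprMn -!nsq_hn rip_c2_le.
Qed.

Lemma hn_le x r : 0 <= r -> (hn x <= r) = (nsq x <= r ^+ 2).
Proof. by move=> r0; rewrite nsq_hn ler_sqr// nnegrE ?hn_ge0. Qed.

Lemma inner_eq x y : (forall z, inner x z = inner y z) -> x = y.
Proof.
move=> h; apply/eqP; rewrite -subr_eq0 -nsq_eq0 /nsq /rip.
by rewrite innerBl h subrr.
Qed.

Lemma rip_eq x y : (forall z, rip x z = rip y z) -> x = y.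
Proof.
move=> h; apply/eqP; rewrite -subr_eq0 -nsq_eq0 /nsq.
by rewrite ripBl h subrr.
Qed.

Lemma cvgH (T : Type) (F : set_system T) {FF : Filter F} (u : T -> H) x :
  (u @ F --> x) <-> (forall e : R, 0 < e -> \forall t \near F, nsq (u t - x) < e).
Proof.
split=> [/cvgrPdist_lt ux e e0|ux].
  have se0 : 0 < (Num.sqrt e)%:C :> R[i] by rewrite ltcR sqrtr_gt0.
  near=> t; have : `|x - u t| < (Num.sqrt e)%:C by near: t; exact: ux.
  rewrite normhn ltcR hnB => ?.
  by rewrite nsq_hn -(sqr_sqrtr (ltW e0)) ltr_sqr ?nnegrE ?hn_ge0 ?sqrtr_ge0.
apply/cvgrPdist_lt => e e0.
have er : e = (complex.Re e)%:C by rewrite RRe_real// gtr0_real.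
have e'0 : 0 < complex.Re e by rewrite -ltcR -er.
near=> t; rewrite normhn er ltcR hnB.
rewrite -ltr_sqr ?nnegrE ?hn_ge0 ?ltW// -nsq_hn.
by near: t; apply: ux; rewrite exprn_gt0.
Unshelve. all: by end_near. Qed.

Lemma cvgH_seq (u : nat -> H) x :
  (u n @[n --> \oo] --> x) <->
  (forall e : R, 0 < e -> exists N, forall n, (N <= n)%N -> nsq (u n - x) < e).
Proof.
rewrite cvgH; split=> h e /h.
  by move=> [N _ hN]; exists N => n Nn; apply: hN.
by move=> [N hN]; exists N => // n /= Nn; apply: hN.
Qed.

(** Stated for filters because the eigenvector constructed below is the limit of an ultrafilter. *)
Lemma cauchyH (F : set_system H) : ProperFilter F ->
  (forall e : R, 0 < e -> exists x, F [set y | nsq (y - x) < e]) ->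
  exists x, F --> x.
Proof.
move=> FF h; apply/cvg_ex; apply: cauchy_cvg; apply: cauchy_exP => e e0.
have er : e = (complex.Re e)%:C by rewrite RRe_real// gtr0_real.
have e'0 : 0 < complex.Re e by rewrite -ltcR -er.
have [x Fx] := h _ (exprn_gt0 2 e'0).
exists x; apply: filterS Fx => y /= yx.
rewrite -ball_normE /= normhn hnB er ltcR.
by rewrite -ltr_sqr ?nnegrE ?hn_ge0 ?ltW// -nsq_hn.
Qed.

Lemma cauchyH_seq (u : nat -> H) :
  (forall e : R, 0 < e -> exists N, forall m n, (N <= m)%N -> (N <= n)%N ->
     nsq (u m - u n) < e) ->
  exists x, u n @[n --> \oo] --> x.
Proof.
move=> h; apply: cauchyH => e /h[N hN]; exists (u N).
by exists N => // n /= Nn; apply: hN.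
Qed.

End InnerProduct.

(** * Orthonormal bases *)

Section Orthonormal.
Context {R : realType} {H : hilbertType R}.
Implicit Types (x y z e f : H) (F : set H) (G : {fset H}) (S : H -> H).
Local Open Scope complex_scope.

Lemma harmonic_small (d : R) : 0 < d ->
  exists N, forall n, (N <= n)%N -> harmonic n < d.
Proof.
move=> d0; have [N _ hN] := near_infty_natSinv_lt (PosNum d0).
by exists N => n Nn; apply: hN.
Qed.

Lemma c2D_le (a b : R[i]) : c2 (a + b) <= 2 * c2 a + 2 * c2 b.
Proof.
case: a b => a a' [b b']; rewrite /c2 /=.
by have := sqr_ge0 (a - b); have := sqr_ge0 (a' - b'); lra.
Qed.

Lemma c2_small (a : R[i]) (C : R) :
  (forall e : R, 0 < e -> c2 a <= C * e) -> a = 0.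
Proof.
move=> h; apply/eqP; rewrite -c2_eq0 eq_le c2_ge0 andbT.
have [C0|C0] := leP C 0.
  by rewrite (le_trans (h 1 ltr01))// mulr1.
apply/ler_addgt0Pr => e e0; rewrite add0r (le_trans (h (e / C) _)) ?divr_gt0//.
by rewrite mulrCA divff ?gt_eqF// mulr1.
Qed.

Definition orthonormal_set F :=
  (forall e, F e -> inner e e = 1) /\
  (forall e f, F e -> F f -> e <> f -> inner e f = 0).

(** Bases are sets without an enumeration, so infinite sums are replaced by bounds on, or suprema
    over, finite subsets [G]. *)
Definition fin_in G F := forall e, e \in G -> F e.

Lemma basis_orthonormal F : orthonormal_basis F -> orthonormal_set F.
Proof. by case. Qed.
#[local] Hint Resolve basis_orthonormal : core.

Lemma fin_inU G G' F : fin_in G F -> fin_in G' F -> fin_in (G `|` G')%fset F.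
Proof. by move=> hG hG' e /fsetUP[/hG|/hG']. Qed.

Lemma fin_in1 f F : F f -> fin_in [fset f]%fset F.
Proof. by move=> Ff e /fset1P ->. Qed.

Lemma fin_in0 F : fin_in fset0 F.
Proof. by move=> e; rewrite in_fset0. Qed.
#[local] Hint Resolve fin_in0 : core.

Lemma fsumID (phi : H -> R) G G' : (G `<=` G')%fset ->
  \sum_(e <- G') phi e = \sum_(e <- G) phi e + \sum_(e <- G' | e \notin G) phi e.
Proof.
move=> GG'; rewrite (bigID (mem G))/= -[X in X + _ = _]big_filter; congr (_ + _).
apply: perm_big; apply: uniq_perm; rewrite ?filter_uniq ?fset_uniq// => e.
by rewrite mem_filter andb_idr// => /(fsubsetP GG').
Qed.

Lemma fsum_le (phi : H -> R) G G' : (forall e, 0 <= phi e) ->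
  (G `<=` G')%fset -> \sum_(e <- G) phi e <= \sum_(e <- G') phi e.
Proof. by move=> phi0 GG'; rewrite (fsumID phi GG') lerDl sumr_ge0. Qed.

Definition proj G x : H := \sum_(e <- G) inner x e *: e.

Lemma nsq1 F e : orthonormal_set F -> F e -> nsq e = 1.
Proof. by move=> [h _] /h e1; apply/complexI; rewrite -nsq_inner e1. Qed.

Lemma inner_lin_comb F G (a : H -> R[i]) f : orthonormal_set F -> fin_in G F ->
  F f -> inner (\sum_(e <- G) a e *: e) f = if f \in G then a f else 0.
Proof.
move=> [F1 F0] GF Ff; rewrite inner_suml; case: ifP => fG.
  rewrite (bigD1_seq f) ?fset_uniq//= innerZl F1// mulr1 big_seq_cond big1 ?addr0//.
  move=> e /andP[eG /eqP ef].
  by rewrite innerZl F0 ?mulr0//; exact: GF.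
rewrite big_seq big1// => e eG; rewrite innerZl F0 ?mulr0//; first exact: GF.
by move=> ef; rewrite -ef eG in fG.
Qed.

Lemma inner_proj F G x f : orthonormal_set F -> fin_in G F -> F f ->
  inner (proj G x) f = if f \in G then inner x f else 0.
Proof. exact: inner_lin_comb. Qed.

Lemma nsq_lin_comb F G (a : H -> R[i]) : orthonormal_set F -> fin_in G F ->
  nsq (\sum_(e <- G) a e *: e) = \sum_(e <- G) c2 (a e).
Proof.
move=> FO GF; rewrite /nsq /rip inner_sumr Re_sum big_seq [RHS]big_seq.
apply: eq_bigr => e eG; rewrite innerZr (inner_lin_comb a FO GF) ?eG; last exact: GF.
by rewrite mulrC mulcJ.
Qed.

Lemma nsq_proj F G x : orthonormal_set F -> fin_in G F ->
  nsq (proj G x) = \sum_(e <- G) c2 (inner x e).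
Proof. exact: nsq_lin_comb. Qed.

Lemma rip_proj G x : rip x (proj G x) = \sum_(e <- G) c2 (inner x e).
Proof.
rewrite /rip /proj inner_sumr Re_sum; apply: eq_bigr => e _.
by rewrite innerZr mulrC mulcJ.
Qed.

Lemma nsqB_proj F G x : orthonormal_set F -> fin_in G F ->
  nsq (x - proj G x) = nsq x - \sum_(e <- G) c2 (inner x e).
Proof.
by move=> FO GF; rewrite nsqB rip_proj (nsq_proj x FO GF); lra.
Qed.

Lemma bessel F G x : orthonormal_set F -> fin_in G F ->
  \sum_(e <- G) c2 (inner x e) <= nsq x.
Proof.
by move=> FO GF; rewrite -subr_ge0 -(nsqB_proj x FO GF) nsq_ge0.
Qed.

Lemma nsq_projB F G G' x : orthonormal_set F -> fin_in G' F ->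
  (G `<=` G')%fset ->
  nsq (proj G' x - proj G x) =
  \sum_(e <- G') c2 (inner x e) - \sum_(e <- G) c2 (inner x e).
Proof.
move=> FO GF' /fsubsetP GG'.
have GF : fin_in G F by move=> e /GG'/GF'.
rewrite nsqB !(nsq_proj x FO)//.
suff -> : rip (proj G' x) (proj G x) = \sum_(e <- G) c2 (inner x e) by lra.
rewrite -(rip_proj G x) /rip !inner_sumr !Re_sum big_seq [RHS]big_seq.
apply: eq_bigr => e eG.
by rewrite !innerZr (inner_proj x FO GF') ?GG' ?eG//; exact: GF.
Qed.

(** The sets [G_ n] bring the Bessel sums within [harmonic n] of their supremum. Enlarging [G_ n]
    then adds at most [harmonic n], which makes the projections Cauchy and leaves [x - p] orthogonal
    to the whole basis. *)
Lemma proj_cvg F x : orthonormal_basis F ->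
  forall d : R, 0 < d -> exists G, fin_in G F /\ nsq (x - proj G x) <= d.
Proof.
move=> FB; have FO := basis_orthonormal FB.
pose s G := \sum_(e <- G) c2 (inner x e).
pose A := [set s G | G in [set G | fin_in G F]].
have A0 : A !=set0 by exists (s fset0), fset0.
have Aub : ubound A (nsq x) by move=> _ [G GF <-]; exact: (bessel x FO GF).
have supA : has_sup A by split=> //; exists (nsq x).
have s_le G : fin_in G F -> s G <= sup A.
  by move=> GF; apply: sup_upper_bound => //; exists G.
have /choice[G_ hG] : forall n : nat, exists G, fin_in G F /\
    sup A - harmonic n < s G.
  by move=> n; have [_ [G GF <-] ?] := sup_adherent (harmonic_gt0 n) supA; exists G.
have GF n : fin_in (G_ n) F by case: (hG n).
have inc n G : fin_in G F -> (G_ n `<=` G)%fset ->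
    nsq (proj G x - proj (G_ n) x) <= harmonic n.
  move=> GF' sub; rewrite (nsq_projB x FO GF' sub) -/(s _) -/(s _).
  by have := s_le _ GF'; have [_] := hG n; lra.
have [p cvp] : exists p : H, proj (G_ n) x @[n --> \oo] --> p.
  apply: cauchyH_seq => d d0; have d40 : 0 < d / 4 by lra.
  have [N hN] := harmonic_small d40.
  exists N => m n Nm Nn.
  (* The sets [G_ m] and [G_ n] need not be nested; both are compared with their union. *)
  apply: le_lt_trans (nsq_tri _ (proj (G_ m `|` G_ n)%fset x) _) _.
  have := inc m _ (fin_inU (GF m) (GF n)) (fsubsetUl _ _).
  have := inc n _ (fin_inU (GF m) (GF n)) (fsubsetUr _ _).
  rewrite (nsqBC (proj (G_ m) x)).
  by have := hN m Nm; have := hN n Nn; lra.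
have px := (cvgH_seq _ _).1 cvp.
have xp : x = p.
  apply/eqP; rewrite -subr_eq0; apply/eqP; case: FB => _ _; apply => f Ff.
  apply: (c2_small (C := 4)) => d d0.
  have [N1 hN1] := px _ d0.
  have [N2 hN2] := harmonic_small d0.
  pose n := maxn N1 N2.
  rewrite -[x - p](subrKA (proj (G_ n) x)) innerDl (le_trans (c2D_le _ _))//.
  have : c2 (inner (proj (G_ n) x - p) f) <= d.
    rewrite (le_trans (inner_c2_le _ _))// (nsq1 FO Ff) mulr1 ltW// hN1//.
    exact: leq_maxl.
  suff : c2 (inner (x - proj (G_ n) x) f) <= d by lra.
  rewrite innerBl (inner_proj x FO (GF n) Ff); case: ifPn => fG.
    by rewrite subrr c2_real expr0n ltW.
  rewrite subr0; have := s_le _ (fin_inU (fin_in1 Ff) (GF n)).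
  rewrite /s big_fsetU1//=; have [_] := hG n; rewrite -/(s _).
  by have := hN2 n (leq_maxr _ _); lra.
move=> d d0; have [N hN] := px _ d0; exists (G_ N); split; first exact: GF.
by rewrite {1}xp nsqBC ltW// hN.
Qed.

Lemma parseval F x (d : R) : orthonormal_basis F -> 0 < d ->
  exists G, fin_in G F /\ nsq x <= \sum_(e <- G) c2 (inner x e) + d.
Proof.
move=> FB d0; have [G [GF]] := proj_cvg x FB d0.
by rewrite (nsqB_proj x (basis_orthonormal FB) GF) => ?; exists G; split=> //; lra.
Qed.

Lemma basis_eq F x y : orthonormal_basis F ->
  (forall f, F f -> inner x f = inner y f) -> x = y.
Proof.
move=> [_ _ h] xy; apply/eqP; rewrite -subr_eq0; apply/eqP/h => f Ff.
by rewrite innerBl xy// subrr.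
Qed.

(** Parseval for [y] and Bessel for [x]. All diagonal operators are estimated in this way. *)
Lemma coord_le F x y (C : R) : orthonormal_basis F -> 0 <= C ->
  (forall f, F f -> c2 (inner y f) <= C * c2 (inner x f)) ->
  nsq y <= C * nsq x.
Proof.
move=> FB C0 yx; apply/ler_addgt0Pr => d d0.
have [G [GF hG]] := parseval y FB d0.
rewrite (le_trans hG)// lerD2r.
apply: le_trans (ler_wpM2l C0 (bessel x (basis_orthonormal FB) GF)).
by rewrite mulr_sumr big_seq [leRHS]big_seq ler_sum// => e eG; apply/yx/GF.
Qed.

(** Density of the span of a basis, in the form of an induction principle for closed linear
    properties. *)
Lemma basis_ind F (P : set H) : orthonormal_basis F -> P 0 ->
  (forall f, F f -> P f) ->
  (forall (c : R[i]) x y, P x -> P y -> P (c *: x + y)) ->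
  (forall x, (forall d : R, 0 < d -> exists2 y, P y & nsq (x - y) <= d) -> P x) ->
  forall x, P x.
Proof.
move=> FB P0 PF Plin Pcl x; apply: Pcl => d d0.
have [G [GF hG]] := proj_cvg x FB d0; exists (proj G x) => //.
rewrite /proj big_seq; elim/big_ind : _ => //.
- by move=> a b Pa Pb; rewrite -[a]scale1r; exact: Plin.
- by move=> e eG; rewrite -[_ *: e]addr0; apply: Plin => //; exact/PF/GF.
Qed.

(** By [basis_ind] in [x]: when approximants converge to [x], their images are Cauchy by
    [coord_le]. *)
Lemma multiplier_ex F (phi : H -> R) (C : R) : orthonormal_basis F ->
  (forall f, F f -> phi f ^+ 2 <= C) -> forall x,
  exists y, forall f, F f -> inner y f = (phi f)%:C * inner x f.
Proof.
move=> FB phiC.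
(* A negative bound on squares forces [F] to be empty, and then any [y] will do. *)
have [C0|C0] := leP 0 C; last first.
  move=> x; exists 0 => f /phiC; rewrite leNgt (lt_le_trans C0)//.
  by rewrite sqr_ge0.
apply: (basis_ind (P := [set x | exists y, forall f, F f ->
   inner y f = (phi f)%:C * inner x f]) FB).
- by exists 0 => f _; rewrite !inner0l mulr0.
- move=> f Ff; exists ((phi f)%:C *: f) => g Fg; rewrite innerZl.
  have [->//|/eqP fg] := eqVneq f g.
  by case: FB => _ F0 _; rewrite F0// !mulr0.
- move=> c x y [x' hx] [y' hy]; exists (c *: x' + y') => f Ff.
  by rewrite !innerDl !innerZl hx// hy// mulrDr mulrCA.
- move=> x h.
  have /choice[x_ hx] : forall n : nat, exists z : H * H,
      (forall f, F f -> inner z.2 f = (phi f)%:C * inner z.1 f) /\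
      nsq (x - z.1) <= harmonic n.
    by move=> n; have [z [y hy] zx] := h _ (harmonic_gt0 n); exists (z, y).
  have dif m n : nsq ((x_ m).2 - (x_ n).2) <=
      C * (2 * harmonic m + 2 * harmonic n).
    apply: (le_trans (coord_le (x := (x_ m).1 - (x_ n).1) FB C0 _)).
      move=> f Ff; rewrite !innerBl (hx m).1// (hx n).1// -mulrBr c2M c2_real.
      by rewrite ler_wpM2r ?c2_ge0// phiC.
    apply: ler_wpM2l => //; apply: le_trans (nsq_tri _ x _) _.
    by rewrite nsqBC; have := (hx m).2; have := (hx n).2; lra.
  have [p cvp] : exists p : H, (x_ n).2 @[n --> \oo] --> p.
    apply: cauchyH_seq => d d0.
    have d40 : 0 < d / (4 * C + 1) by rewrite divr_gt0//; lra.
    have [N hN] := harmonic_small d40.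
    exists N => m n Nm Nn; apply: le_lt_trans (dif m n) _.
    have C40 : 0 < 4 * C + 1 by lra.
    have := hN m Nm; have := hN n Nn; rewrite !ltr_pdivlMr// => h1 h2.
    set a := harmonic m in h2 *; set b := harmonic n in h1 *.
    have a0 : 0 < a by apply: harmonic_gt0.
    have b0 : 0 < b by apply: harmonic_gt0.
    by lra.
  have hp := (cvgH_seq _ _).1 cvp.
  exists p => f Ff; apply/eqP; rewrite -subr_eq0; apply/eqP.
  apply: (c2_small (C := 2 + 2 * C)) => d d0.
  have [N1 hN1] := hp _ d0.
  have [N2 hN2] := harmonic_small d0.
  pose n := maxn N1 N2.
  have -> : inner p f - (phi f)%:C * inner x f =
      inner (p - (x_ n).2) f + (phi f)%:C * inner ((x_ n).1 - x) f.
    by rewrite !innerBl (hx n).1//; ring.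
  rewrite (le_trans (c2D_le _ _))//.
  have f1 := nsq1 (basis_orthonormal FB) Ff.
  have h1 : c2 (inner (p - (x_ n).2) f) <= d.
    rewrite (le_trans (inner_c2_le _ _))// f1 mulr1 nsqBC ltW// hN1//.
    exact: leq_maxl.
  have h2 : c2 (inner ((x_ n).1 - x) f) <= d.
    rewrite (le_trans (inner_c2_le _ _))// f1 mulr1 nsqBC.
    by rewrite (le_trans (hx n).2)// ltW// hN2//; exact: leq_maxr.
  rewrite c2M c2_real.
  have := ler_pM (sqr_ge0 (phi f)) (c2_ge0 _) (phiC f Ff) h2.
  by lra.
Qed.

End Orthonormal.

(** Applied with [u = q x] and [a = D (D x)]: a difference of near-eigenvectors is the difference of
    their images up to the two defects. *)
Lemma subr_split (V : zmodType) (u v a b : V) :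
  u - v = (a - b) + ((u - a) - (v - b)).
Proof.
have -> : (u - a) - (v - b) = (u - v) - (a - b).
  by rewrite !opprB addrACA [RHS]addrACA [- a - v]addrC.
by rewrite [RHS]addrC subrK.
Qed.

Section Linear.
Context {R : realType} {V H : hilbertType R}.
Variables (S : V -> H) (Slin : linear S).
Lemma linD x y : S (x + y) = S x + S y.
Proof. by have := Slin 1 x y; rewrite !scale1r. Qed.
Lemma lin0 : S 0 = 0.
Proof. by apply: (addrI (S 0)); rewrite -linD !addr0. Qed.
Lemma linZ c x : S (c *: x) = c *: S x.
Proof. by have := Slin c x 0; rewrite lin0 !addr0. Qed.
Lemma linN x : S (- x) = - S x.
Proof. by rewrite -scaleN1r linZ scaleN1r. Qed.
Lemma linB x y : S (x - y) = S x - S y.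
Proof. by rewrite linD linN. Qed.
End Linear.

(** * Compact symmetric operators *)

Section Operators.
Context {R : realType} {H : hilbertType R}.
Implicit Types (x y z e f : H) (F : set H) (S D : H -> H).
Local Open Scope complex_scope.

Definition symmetric_op S := forall x y, inner (S x) y = inner x (S y).

(** Inner products separate points, so linearity comes with symmetry and is not carried along
    separately. *)
Lemma symmetric_op_linear S : symmetric_op S -> linear S.
Proof.
move=> sS c x y; apply: inner_eq => z.
by rewrite sS !innerDl !innerZl !sS.
Qed.

Lemma symmetric_rip S x y : symmetric_op S -> rip (S x) y = rip x (S y).
Proof. by move=> sS; rewrite /rip sS. Qed.

Lemma symmetric_opB S D : symmetric_op S -> symmetric_op D ->
  symmetric_op (fun x => S x - D x).
Proof. by move=> sS sD x y; rewrite innerBl innerBr sS sD. Qed.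

Lemma bounded_operatorP S (C : R) : linear S ->
  (forall x, nsq (S x) <= C * nsq x) -> bounded_operator S.
Proof.
move=> Slin SC; split=> // x.
have Fx : Filter (nbhs x) by exact: nbhs_filter.
suff /(@cvgH _ _ _ (nbhs x) Fx S (S x)).2 : forall e : R, 0 < e ->
    \forall t \near x, nsq (S t - S x) < e by [].
move=> e e0.
have C0 : 0 < `|C| + 1 by rewrite ltr_pwDr.
have eC : 0 < e / (`|C| + 1) by rewrite divr_gt0.
have xC := (@cvgH _ _ _ (nbhs x) Fx id x).1 (fun A => id) _ eC.
apply: filterS xC => y; rewrite ltr_pdivlMr// -linB// => h.
apply: le_lt_trans (SC _) _; apply: le_lt_trans h; rewrite mulrC.
by apply: ler_wpM2l; rewrite ?nsq_ge0// (le_trans (ler_norm C))// lerDl.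
Qed.

Lemma continuous_linear_le (V : hilbertType R) (S : V -> H) :
  linear S -> continuous S ->
  exists2 C : R, 0 < C & forall x : V, nsq (S x) <= C * nsq x.
Proof.
move=> Slin Scont.
have /cvgrPdist_lt/(_ 1 ltr01) := Scont 0.
rewrite (lin0 Slin) => /nbhs_normP[d /= d0 hd].
have dr : d = (complex.Re d)%:C by rewrite RRe_real// gtr0_real.
set r := complex.Re d in dr; have r0 : 0 < r by rewrite -ltcR -dr.
exists ((2 / r) ^+ 2); first by rewrite exprn_gt0// divr_gt0.
move=> x; have [->|x0] := eqVneq x 0; first by rewrite (lin0 Slin) nsq0 nsq0 mulr0.
have hx0 : 0 < hn x by rewrite lt_def hn_ge0 hn_eq0 x0.
pose k := r / (2 * hn x); have k0 : 0 < k by rewrite divr_gt0 ?mulr_gt0.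
have /hd : ball_ Num.norm 0 d (k%:C *: x).
  rewrite /= sub0r normrN normhn (hnZr _ (ltW k0)) dr ltcR /k.
  by rewrite invfM mulrA mulfVK ?gt_eqF// ltr_pdivrMr// ltr_pMr// ltr1n.
rewrite /= sub0r normrN normhn (linZ Slin) (hnZr _ (ltW k0)).
rewrite -[1]/(1%:C) ltcR => h.
rewrite !nsq_hn -exprMn ler_sqr ?nnegrE ?hn_ge0 ?mulr_ge0 ?hn_ge0 ?divr_ge0 ?invr_ge0 ?ltW ?invr_gt0//.
move: h; rewrite mulrC -ltr_pdivlMr// mul1r /k invf_div.
by rewrite mulrAC.
Qed.

Lemma bounded_operator_le S : bounded_operator S ->
  exists2 C : R, 0 < C & forall x, nsq (S x) <= C * nsq x.
Proof. by move=> []; exact: continuous_linear_le. Qed.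

(** Compactness without sequences: up to [e], finitely many functionals control [D x]. Such an
    inequality is inherited under domination, and along an ultrafilter on the unit ball, where every
    functional converges, it makes [D x] Cauchy. *)
Definition compact_op D := forall e : R, 0 < e -> exists G : seq H, forall x,
  nsq (D x) <= e * nsq x + \sum_(g <- G) c2 (inner x g).

Lemma compact_op_bounded D : compact_op D ->
  exists2 C : R, 0 < C & forall x, nsq (D x) <= C * nsq x.
Proof.
move=> /(_ 1 ltr01)[G hG].
have h0 : 0 <= \sum_(g <- G) nsq g by apply: sumr_ge0 => g _; exact: nsq_ge0.
exists (1 + \sum_(g <- G) nsq g); first lra.
move=> x; rewrite (le_trans (hG x))// mulrDl lerD2l mulr_suml.
by apply: ler_sum => g _; rewrite mulrC inner_c2_le.
Qed.

Lemma ultra_real_cvg (U : set_system H) (phi : H -> R) (b : R) :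
  UltraFilter U -> U [set x | `|phi x| <= b] ->
  exists p, forall e : R, 0 < e -> U [set x | `|phi x - p| < e].
Proof.
move=> UU Ub; have [|p [_ clp]] := @segment_compact _ (- b) b (phi @ U) _.
  apply: filterS Ub => x /= h; rewrite in_itv/= -ler_norml; exact: h.
exists p => e e0.
have [//|UC] := in_ultra_setVsetC [set x | `|phi x - p| < e] UU.
have [r [/= h]] := clp [set r | ~ `|r - p| < e] (ball p e) UC (nbhsx_ballx p e e0).
by rewrite /ball/= distrC.
Qed.

(** Weak compactness of the unit ball, one functional at a time, from the compactness of real
    segments. *)
Lemma ultra_inner_cvg (U : set_system H) (g : H) :
  UltraFilter U -> U [set x | nsq x <= 1] ->
  exists z : R[i], forall e : R, 0 < e -> U [set x | c2 (inner x g - z) < e].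
Proof.
move=> UU U1.
have ub x : nsq x <= 1 -> c2 (inner x g) <= nsq g.
  move=> x1; rewrite (le_trans (inner_c2_le x g))//.
  by rewrite -[leRHS]mul1r ler_wpM2r ?nsq_ge0.
have b0 : 0 <= nsq g + 1 by rewrite addr_ge0 ?nsq_ge0.
have sq (r s : R) : r ^+ 2 <= s -> `|r| <= s + 1.
  move=> h; have := sqr_ge0 (r - 1); have := sqr_ge0 (r + 1).
  by rewrite !expr2 in h *; case: (ler0P r); nra.
have [a ha] : exists p, forall e : R, 0 < e ->
    U [set x | `|complex.Re (inner x g) - p| < e].
  apply: (ultra_real_cvg (b := nsq g + 1)).
  apply: filterS U1 => x /ub h; apply: sq; apply: le_trans h.
  by rewrite /c2 lerDl sqr_ge0.
have [b hb] : exists p, forall e : R, 0 < e ->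
    U [set x | `|complex.Im (inner x g) - p| < e].
  apply: (ultra_real_cvg (b := nsq g + 1)).
  apply: filterS U1 => x /ub h; apply: sq; apply: le_trans h.
  by rewrite /c2 lerDr sqr_ge0.
exists (a +i* b) => e e0.
have s0 : 0 < Num.sqrt (e / 2) by rewrite sqrtr_gt0 divr_gt0.
have key r : `|r| < Num.sqrt (e / 2) -> r ^+ 2 < e / 2.
  rewrite -(@ltr_sqr _ `|r|) ?nnegrE ?sqrtr_ge0// real_normK ?num_real//.
  by rewrite sqr_sqrtr// divr_ge0// ltW.
apply: filterS (filterI (ha _ s0) (hb _ s0)) => x [/key h1 /key h2].
by rewrite /= /c2; case: (inner x g) h1 h2 => r s /= h1 h2; lra.
Qed.

(** The supremum [q] of [|D x|^2] over the unit ball of [M] is the top of the spectrum of [D^2] on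
    [M], and [D^2] treats both signs of an extreme eigenvalue of [D] at once. Near-maximizers almost
    solve [D^2 x = q x], compactness provides a limit [p], and [p] or [D p + sqrt q p] is an
    eigenvector of [D]. *)
Lemma top_eigenvector D (M : set H) : symmetric_op D -> compact_op D ->
  (forall c x y, M x -> M y -> M (c *: x + y)) -> (forall x, M x -> M (D x)) ->
  (forall x, (forall d : R, 0 < d -> exists2 y, M y & nsq (x - y) <= d) -> M x) ->
  (exists2 x, M x & x != 0) ->
  exists2 x, M x & x != 0 /\ exists l : R, D x = l%:C *: x.
Proof.
move=> Dsym Dcpt Mlin MD Mcl [x0 Mx0 x00].
have Dlin := symmetric_op_linear Dsym.
have [C C0 DC] := compact_op_bounded Dcpt.
have M0 : M 0 by rewrite -(addNr x0) -scaleN1r; exact: Mlin.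
have MZ c x : M x -> M (c *: x) by move=> Mx; rewrite -[_ *: _]addr0; exact: Mlin.
pose A := [set nsq (D x) | x in [set x | M x /\ nsq x <= 1]].
have A0 : A !=set0 by exists (nsq (D 0)), 0 => //=; rewrite nsq0.
have supA : has_sup A.
  split=> //; exists C => _ [x [_ x1] <-]; rewrite (le_trans (DC x))//.
  by rewrite ger_pMr.
pose q := sup A.
have Dq x : M x -> nsq (D x) <= q * nsq x.
  move=> Mx; have [->|xn0] := eqVneq x 0; first by rewrite lin0// nsq0 mulr0.
  have hx0 : 0 < hn x by rewrite lt_def hn_ge0 hn_eq0 xn0.
  have : nsq (D ((hn x)^-1%:C *: x)) <= q.
    apply: sup_upper_bound => //; eexists; last reflexivity.
    split; first exact: MZ.
    by rewrite nsqZr nsq_hn -exprMn mulVf ?gt_eqF// expr1n.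
  rewrite linZ// nsqZr exprVn -nsq_hn mulrC ler_pdivrMr//.
  by rewrite nsq_gt0.
(* For [q <= 0] the operator vanishes on [M], and any nonzero vector has eigenvalue 0. *)
have [q0|q0] := leP q 0.
  exists x0 => //; split=> //; exists 0; rewrite scale0r.
  apply: nsq_le0_eq0; rewrite (le_trans (Dq _ Mx0))//.
  by rewrite mulr_le0_ge0// nsq_ge0.
pose B (d : R) := [set x | [/\ M x, nsq x <= 1 & q - d < nsq (D x)]].
have BF : ProperFilter (filter_from [set d : R | 0 < d] B).
  apply: filter_from_proper; last first.
    by move=> d /= d0; have [_ [x [Mx x1] <-] ?] := sup_adherent d0 supA; exists x.
  apply: filter_from_filter; first by exists 1 => /=.
  move=> d d' /= d0 d'0; exists (Num.min d d'); first by rewrite /= lt_min d0.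
  move=> x [Mx x1 xq]; split; split=> //; apply: le_lt_trans xq; rewrite lerB//.
    by rewrite ge_min lexx.
  by rewrite ge_min lexx orbT.
have [U [UU BU]] := ultraFilterLemma BF.
have UB d : 0 < d -> U (B d) by move=> d0; apply: BU; exists d.
have /choice[z hz] : forall g, exists z : R[i], forall e : R, 0 < e ->
    U [set x | c2 (inner x g - z) < e].
  move=> g; apply: ultra_inner_cvg.
  by apply: filterS (UB 1 ltr01) => x [].
have hzG (G : seq H) : forall e : R, 0 < e ->
    U [set x | \sum_(g <- G) c2 (inner x g - z g) < e].
  elim: G => [|g G IH] e e0.
    by apply: filterE => x /=; rewrite big_nil.
  have e2 : 0 < e / 2 by rewrite divr_gt0.
  apply: filterS (filterI (hz g _ e2) (IH _ e2)) => x [/= h1 h2].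
  by rewrite big_cons; lra.
(* Expanding the square and using [|D (D x)|^2 <= q |D x|^2] leaves [q^2 |x|^2 - q |D x|^2], which
   is at most [q d]. *)
have Bdif d x : B d x -> nsq (q%:C *: x - D (D x)) <= q * d.
  move=> [Mx x1 xq]; rewrite nsqB nsqZr ripZl -symmetric_rip// -/(nsq (D x)).
  have := Dq _ (MD _ Mx); have := Dq _ Mx.
  have := nsq_ge0 (D x) => h0 h1 h2.
  have := ler_wpM2l (ltW q0) x1; have := ler_wpM2l (ltW q0) (ltW xq).
  by have := ler_wpM2l (sqr_ge0 q) x1; rewrite !expr2; nra.
have [p Up] : exists p : H, U --> p.
  apply: cauchyH => e e0.
  (* With [d] and [e1], the image [D^2 (x - y)] and the two defects together each contribute at most
     [q^2 e / 4] to [|q (x - y)|^2]. *)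
  pose d := q * e / 32; have d0 : 0 < d by rewrite /d divr_gt0 ?mulr_gt0.
  pose e1 := q ^+ 2 * e / (64 * C).
  have e10 : 0 < e1 by rewrite /e1 divr_gt0 ?mulr_gt0// exprn_gt0.
  have [G hG] := Dcpt _ e10.
  have UV : U (B d `&` [set x | \sum_(g <- G) c2 (inner x g - z g) < e1]).
    by apply: filterI; [exact: UB|exact: hzG].
  have [y [By Gy]] := filter_ex UV; exists y; apply: filterS UV => x [Bx Gx] /=.
  have xy4 : nsq (x - y) <= 4.
    rewrite (le_trans (nsqB_le x y))//.
    by case: Bx By => _ ? _ [_ ? _]; lra.
  have h1 : nsq (D (x - y)) <= 8 * e1.
    rewrite (le_trans (hG _))//.
    have : \sum_(g <- G) c2 (inner (x - y) g) <= 4 * e1.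
      apply: (@le_trans _ _ (2 * \sum_(g <- G) c2 (inner x g - z g) +
                             2 * \sum_(g <- G) c2 (inner y g - z g))); last first.
        by move: Gx Gy => /=; lra.
      rewrite !mulr_sumr -big_split/=; apply: ler_sum => g _.
      rewrite innerBl (_ : _ - _ = (inner x g - z g) + - (inner y g - z g)).
        rewrite (le_trans (c2D_le _ _))// -[- (inner y g - z g)]mulN1r c2M.
        by rewrite -[-1](rmorphN1 (real_complex R)) c2_real sqrrN expr1n mul1r.
      by ring.
    by have := ler_wpM2l (ltW e10) xy4; lra.
  have h2 : nsq (D (D (x - y))) <= q ^+ 2 * e / 8.
    rewrite (le_trans (DC _))// (le_trans (ler_wpM2l (ltW C0) h1))// /e1.
    rewrite le_eqVlt; apply/orP; left; apply/eqP; field.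
    by rewrite gt_eqF.
  have h3 : nsq (q%:C *: (x - y)) <= q ^+ 2 * e / 2.
    rewrite (_ : _ *: _ = D (D (x - y)) +
      ((q%:C *: x - D (D x)) - (q%:C *: y - D (D y)))); last first.
      by rewrite !(linB Dlin) scalerBr; exact: subr_split.
    rewrite (le_trans (nsqD_le _ _))//.
    have := Bdif _ _ Bx; have := Bdif _ _ By; rewrite /d => h4 h5.
    have := nsqB_le (q%:C *: x - D (D x)) (q%:C *: y - D (D y)).
    by lra.
  move: h3; rewrite nsqZr -mulrA ler_pM2l ?exprn_gt0//.
  by lra.
have approx d : 0 < d -> exists x, B d x /\ nsq (x - p) < d.
  move=> d0; have Upd := (cvgH (F := U) id p).1 Up _ d0.
  have [|x [Bx xp]] := @filter_ex _ U _ (B d `&` [set x | nsq (x - p) < d]).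
    by apply: filterI; [exact: UB|exact: Upd].
  by exists x.
have Mp : M p.
  apply: Mcl => d d0; have [x [[Mx _ _] xp]] := approx _ d0.
  by exists x => //; rewrite nsqBC ltW.
have DDp : D (D p) = q%:C *: p.
  apply/eqP; rewrite eq_sym -subr_eq0; apply/eqP; apply: nsq_le0_eq0.
  apply/ler_addgt0Pr => d d0; rewrite add0r.
  pose K := 4 * q ^+ 2 + 4 * C * C + 2 * q.
  have K0 : 0 < K.
    by rewrite /K; have := exprn_gt0 2 q0; have := mulr_gt0 C0 C0; lra.
  have [x [Bx xp]] := approx (d / K) (divr_gt0 d0 K0).
  rewrite (_ : _ - _ = (q%:C *: (p - x) - D (D (p - x))) + (q%:C *: x - D (D x))).
    rewrite (le_trans (nsqD_le _ _))//.
    have := Bdif _ _ Bx; have := nsqB_le (q%:C *: (p - x)) (D (D (p - x))).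
    rewrite nsqZr nsqBC in xp *; have := DC (D (p - x)).
    have := ler_wpM2l (ltW C0) (DC (p - x)).
    set w := nsq (p - x) in xp *; move=> h1 h2 h3 h4.
    have h5 := ler_wpM2l (ltW (mulr_gt0 C0 C0)) (ltW xp).
    have h6 := ler_wpM2l (sqr_ge0 q) (ltW xp).
    have : K * (d / K) = d by rewrite mulrC mulfVK// gt_eqF.
    by rewrite {1}/K; lra.
  by rewrite scalerBr !(linB Dlin) [RHS]addrC; exact: subr_split.
have p0 : p != 0.
  apply/eqP => p0; pose d := q / (2 + C).
  have C20 : 0 < 2 + C by lra.
  have d0 : 0 < d by rewrite divr_gt0.
  have [x [[_ _ xq]]] := approx d d0; rewrite p0 subr0 => xp.
  have dq : d * (2 + C) = q by rewrite /d mulfVK// gt_eqF.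
  have := DC x; have := ler_wpM2l (ltW C0) (ltW xp); lra.
(* Since [(D - s) (D + s) p = 0], either [(D + s) p] vanishes and [p] is an eigenvector, or
   [(D + s) p] is one. *)
pose s := Num.sqrt q; have s2 : s * s = q by rewrite -expr2 sqr_sqrtr// ltW.
have [v0|v0] := eqVneq (D p + s%:C *: p) 0.
  exists p => //; split=> //; exists (- s).
  by apply/eqP; rewrite -subr_eq0 rmorphN scaleNr opprK v0.
exists (D p + s%:C *: p); first by rewrite addrC; apply: Mlin => //; exact: MD.
split=> //; exists s; rewrite (linD Dlin) (linZ Dlin) DDp scalerDr scalerA.
by rewrite -rmorphM/= s2 addrC.
Qed.

(** Zorn's lemma on orthonormal sets of eigenvectors: the orthogonal complement of a maximal one is
    closed and [D]-invariant, so if nonzero it would supply a further eigenvector. Applied to the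
    zero operator this also shows that orthonormal bases exist. *)
Lemma spectral_basis D : symmetric_op D -> compact_op D ->
  exists2 F, orthonormal_basis F & forall f, F f -> D f = (rip (D f) f)%:C *: f.
Proof.
move=> Dsym Dcpt; have Dlin := symmetric_op_linear Dsym.
pose P (F : set H) := orthonormal_set F /\
  forall f, F f -> exists l : R, D f = l%:C *: f.
have [FF FP tot|F [[[F1 F0] FD] Fmax]] := @Zorn_bigcup _ P.
  split; last by move=> f [X /FP[_ h]] Xf; exact: h.
  split; first by move=> e [X /FP[[h _] _]] /h.
  move=> e f [X FX Xe] [Y FY Yf].
  have [XY|YX] := tot _ _ FX FY.
    by have [[_ h] _] := FP _ FY; apply: h => //; exact: XY.
  by have [[_ h] _] := FP _ FX; apply: h => //; exact: YX.
exists F; last first.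
  move=> f Ff; have [l Dl] := FD _ Ff.
  by rewrite Dl ripZl -/(nsq f) (nsq1 (conj F1 F0) Ff) mulr1.
split=> // x xF; apply: contrapT => /eqP x0.
have [||||p Mp [p0 [l Dp]]] := @top_eigenvector D
    [set y | forall e, F e -> inner y e = 0] Dsym Dcpt.
- by move=> c y z My Mz e Fe; rewrite innerDl innerZl My// Mz// mulr0 addr0.
- move=> y My e Fe; rewrite Dsym; have [l ->] := FD _ Fe.
  by rewrite innerZr My// mulr0.
- move=> y My e Fe; apply: (c2_small (C := 1)) => d d0; rewrite mul1r.
  have [z Mz yz] := My _ d0; rewrite -(subr0 (inner y e)) -(Mz _ Fe) -innerBl.
  by rewrite (le_trans (inner_c2_le _ _))// (nsq1 (conj F1 F0) Fe) mulr1.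
- by exists x.
have hp0 : 0 < hn p by rewrite lt_def hn_ge0 hn_eq0 p0.
pose e := (hn p)^-1%:C *: p.
have e1 : inner e e = 1.
  rewrite nsq_inner /e nsqZr nsq_hn -exprMn mulVf ?expr1n//.
  by rewrite gt_eqF.
have eF f : F f -> inner e f = 0 by move=> Ff; rewrite innerZl Mp// mulr0.
apply: (Fmax (F `|` [set e])).
  split; first by move=> f Ff; left.
  move=> /(_ e (or_intror erefl)) Fe.
  by have := eF _ Fe; rewrite e1 => /eqP; rewrite oner_eq0.
split.
  split; first by move=> f [/F1//|->].
  move=> f g [Ff|->] [Fg|->] fg //; first exact: F0.
  - by rewrite innerC eF// conjc0.
  - exact: eF.
move=> f [/FD//|->]; exists l; rewrite /e (linZ Dlin) Dp !scalerA.
by rewrite mulrC.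
Qed.

End Operators.

(** * Bounded multipliers in an orthonormal basis *)

Section Multiplier.
Context {R : realType} {H : hilbertType R}.
Implicit Types (x y z e f : H).
Local Open Scope complex_scope.

Definition mult (F : set H) (phi : H -> R) x : H :=
  xget 0 [set y | forall f, F f -> inner y f = (phi f)%:C * inner x f].

Variables (F : set H) (FB : orthonormal_basis F).

(** The constant bounds the square of the symbol, so that it bounds [nsq] directly. *)
Definition bounded_on (phi : H -> R) (C : R) := forall f, F f -> phi f ^+ 2 <= C.

Lemma inner_mult phi C x f : bounded_on phi C -> F f ->
  inner (mult F phi x) f = (phi f)%:C * inner x f.
Proof.
move=> phiC; have [y hy] := multiplier_ex FB phiC x.
by rewrite /mult; case: xgetP => [_ -> h|/(_ y)//]; exact: h.
Qed.

Lemma mult_eq phi C x y : bounded_on phi C ->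
  (forall f, F f -> inner y f = (phi f)%:C * inner x f) -> mult F phi x = y.
Proof.
move=> phiC h; apply: (basis_eq FB) => f Ff.
by rewrite (inner_mult _ phiC Ff) h.
Qed.

Lemma mult_linear phi C : bounded_on phi C -> linear (mult F phi).
Proof.
move=> phiC c x y; apply: (mult_eq phiC) => f Ff.
by rewrite !innerDl !innerZl !(inner_mult _ phiC Ff); ring.
Qed.

Lemma mult_le phi C x : bounded_on phi C -> 0 <= C ->
  nsq (mult F phi x) <= C * nsq x.
Proof.
move=> phiC C0; apply: (coord_le FB C0) => f Ff.
by rewrite (inner_mult _ phiC Ff) c2M c2_real ler_wpM2r ?c2_ge0// phiC.
Qed.

Lemma mult_basis phi C f : bounded_on phi C -> F f ->
  mult F phi f = (phi f)%:C *: f.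
Proof.
move=> phiC Ff; apply: (mult_eq phiC) => g Fg; rewrite innerZl.
have [->//|/eqP fg] := eqVneq f g.
by case: FB => _ F0 _; rewrite F0// !mulr0.
Qed.

Lemma mult_sym phi C : bounded_on phi C -> 0 <= C -> symmetric_op (mult F phi).
Proof.
move=> phiC C0 x.
have mlin := mult_linear phiC.
apply: (basis_ind (P := [set y | inner (mult F phi x) y =
    inner x (mult F phi y)]) FB) => /=.
- by rewrite (lin0 mlin) !inner0r.
- by move=> f Ff; rewrite (inner_mult _ phiC Ff) (mult_basis phiC Ff) innerZrr.
- by move=> c y z hy hz; rewrite mlin !innerDr !innerZr hy hz.
- move=> y h; apply/eqP; rewrite -subr_eq0; apply/eqP.
  apply: (c2_small (C := 4 * C * nsq x)) => d /h[z hz yz].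
  have -> : inner (mult F phi x) y - inner x (mult F phi y) =
     inner (mult F phi x) (y - z) + - inner x (mult F phi (y - z)).
    by rewrite (linB mlin) !innerBr hz; ring.
  rewrite (le_trans (c2D_le _ _))// -[- inner _ _]mulN1r c2M.
  rewrite -[-1](rmorphN1 (real_complex R)) c2_real sqrrN expr1n mul1r.
  have h1 := inner_c2_le (mult F phi x) (y - z).
  have h2 := inner_c2_le x (mult F phi (y - z)).
  have h3 := ler_pM (nsq_ge0 _) (nsq_ge0 _) (mult_le x phiC C0) yz.
  have h4 := ler_wpM2l (nsq_ge0 x) (le_trans (mult_le (y - z) phiC C0) (ler_wpM2l C0 yz)).
  by lra.
Qed.

Lemma mult_bounded phi C : bounded_on phi C -> 0 <= C ->
  bounded_operator (mult F phi).
Proof.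
move=> phiC C0; apply: (bounded_operatorP (mult_linear phiC)) => x.
exact: (mult_le x phiC C0).
Qed.

(** Dominated convergence of symbols: on a basis vector it is convergence of one eigenvalue, and the
    common bound [C] carries it to limits of linear combinations. *)
Lemma mult_cvg (T : Type) (Fl : set_system T) {FF : Filter Fl}
    (phi : T -> H -> R) (psi : H -> R) C x : 0 <= C ->
  (\forall t \near Fl, bounded_on (phi t) C) -> bounded_on psi C ->
  (forall f, F f -> phi t f @[t --> Fl] --> psi f) ->
  mult F (phi t) x @[t --> Fl] --> mult F psi x.
Proof.
move=> C0 phiC psiC cv; apply/(cvgH _ _).2.
move: x; apply: (basis_ind (P := [set x | forall e : R, 0 < e ->
   \forall t \near Fl, nsq (mult F (phi t) x - mult F psi x) < e]) FB) => /=.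
- move=> e e0; apply: filterS phiC => t phiC.
  rewrite (lin0 (mult_linear phiC)) (lin0 (mult_linear psiC)) subr0.
  by rewrite nsq0.
- move=> f Ff e e0; have /cvgrPdist_lt h := cv f Ff.
  have s0 : 0 < Num.sqrt e by rewrite sqrtr_gt0.
  apply: filterS (filterI phiC (h _ s0)) => t [{}phiC ht].
  rewrite (mult_basis phiC Ff) (mult_basis psiC Ff) -scalerBl -rmorphB/=.
  rewrite nsqZr (nsq1 (basis_orthonormal FB) Ff) mulr1.
  rewrite -(real_normK (num_real _)) distrC -[ltRHS](sqr_sqrtr (ltW e0)).
  by rewrite ltr_sqr ?nnegrE.
- move=> c x y hx hy e e0.
  have e1 : 0 < e / (4 * (c2 c + 1)).
    by rewrite divr_gt0// mulr_gt0// ltr_wpDl ?c2_ge0.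
  have e2 : 0 < e / 4 by rewrite divr_gt0.
  apply: filterS (filterI phiC (filterI (hx _ e1) (hy _ e2))) => t [{}phiC [h1 h2]].
  rewrite (mult_linear phiC) (mult_linear psiC) opprD addrACA -scalerBr.
  rewrite (le_lt_trans (nsqD_le _ _))// nsqZ.
  have h3 : c2 c * nsq (mult F (phi t) x - mult F psi x) <= e / 4.
    have k0 : 0 < c2 c + 1 by rewrite ltr_wpDl ?c2_ge0.
    apply: (@le_trans _ _ ((c2 c + 1) * (e / (4 * (c2 c + 1))))).
      by rewrite ler_pM ?c2_ge0 ?nsq_ge0 ?(ltW h1)// lerDl.
    by rewrite le_eqVlt; apply/orP; left; apply/eqP; field; rewrite gt_eqF.
  by lra.
- move=> x h e e0.
  have K0 : 0 < 32 * (C + 1) by lra.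
  have [y hy xy] := h (e / (32 * (C + 1))) (divr_gt0 e0 K0).
  have e4 : 0 < e / 8 by rewrite divr_gt0.
  apply: filterS (filterI phiC (hy _ e4)) => t [{}phiC ht].
  have hC : C * nsq (x - y) <= e / 32.
    apply: (@le_trans _ _ ((C + 1) * (e / (32 * (C + 1))))).
      by rewrite ler_pM ?nsq_ge0// lerDl.
    rewrite le_eqVlt; apply/orP; left; apply/eqP; field.
    by rewrite gt_eqF// ltr_wpDl.
  have := nsq_tri (mult F (phi t) x) (mult F (phi t) y) (mult F psi x).
  have := nsq_tri (mult F (phi t) y) (mult F psi y) (mult F psi x).
  have := mult_le (x - y) phiC C0.
  have := mult_le (x - y) psiC C0.
  rewrite (linB (mult_linear phiC)) (linB (mult_linear psiC)).
  rewrite (nsqBC (mult F psi x) (mult F psi y)); lra.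
Qed.

End Multiplier.

(** * Operators associated with forms *)

Section RieszForm.
Context {R : realType} {V : hilbertType R}.
Local Open Scope complex_scope.

(* The solution is the minimizer of [s u u - 2 Re (l u)]. *)
Lemma riesz_form (s : V -> V -> R[i]) (l : V -> R[i]) (mu C L : R) :
  (forall c u v w, s (c *: u + v) w = c * s u w + s v w) ->
  (forall u v, s u v = (s v u)^*) ->
  0 < mu -> (forall u, mu * nsq u <= complex.Re (s u u)) ->
  (forall u, complex.Re (s u u) <= C * nsq u) ->
  (forall c u v, l (c *: u + v) = c^* * l u + l v) ->
  (forall v, c2 (l v) <= L * nsq v) ->
  exists u, forall v, s u v = l v.
Proof.
move=> slin sC mu0 smu sCb llin lL.
pose S u v := complex.Re (s u v); pose k v := complex.Re (l v).
have SC u v : S u v = S v u by rewrite /S sC ReJ.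
have SD u v w : S (u + v) w = S u w + S v w.
  by rewrite /S -[u]scale1r slin mul1r ReD scale1r.
have s0 w : s 0 w = 0.
  have := slin 0 0 0 w; rewrite scale0r addr0 mul0r add0r => h.
  have := slin 1 0 0 w; rewrite scale1r addr0 mul1r => h'.
  by apply: (addrI (s 0 w)); rewrite -h' addr0.
have sZ c u w : s (c *: u) w = c * s u w.
  by have := slin c u 0 w; rewrite s0 !addr0.
have SZ (r : R) u w : S (r%:C *: u) w = r * S u w by rewrite /S sZ ReZ.
have SDr u v w : S w (u + v) = S w u + S w v by rewrite SC SD !(SC w).
have SZr (r : R) u w : S w (r%:C *: u) = r * S w u by rewrite SC SZ (SC w).
have S0 u : 0 <= S u u by rewrite (le_trans _ (smu u))// mulr_ge0 ?nsq_ge0// ltW.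
have l0 : l 0 = 0.
  have h' := llin 1 0 0; rewrite scale1r addr0 in h'.
  have : 1^* * l 0 = l 0 by rewrite -[RHS]mul1r; congr (_ * _); exact: conjc1.
  by move=> e1; rewrite e1 in h'; apply: (addrI (l 0)); rewrite -h' addr0.
have lZ c u : l (c *: u) = c^* * l u by have := llin c u 0; rewrite l0 !addr0.
have kD u v : k (u + v) = k u + k v.
  rewrite /k -[u]scale1r llin (scale1r u) ReD; congr (complex.Re _ + _).
  by rewrite -[RHS]mul1r; congr (_ * _); exact: conjc1.
have kZ (r : R) u : k (r%:C *: u) = r * k u.
  by rewrite /k lZ -ReZ; congr (complex.Re (_ * _)); exact: conjc_real.
pose J u := S u u - 2 * k u.
have JD u v t : J (u + t%:C *: v) = J u + 2 * t * (S u v - k v) + t ^+ 2 * S v v.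
  by rewrite /J !SD !SDr !SZ !SZr kD kZ (SC v u); ring.
pose L1 := `|L| + 1; have L10 : 0 < L1 by rewrite ltr_wpDl.
have Jlow u : - (L1 / mu) <= J u.
  have k2 : k u ^+ 2 <= L1 * nsq u.
    apply: (@le_trans _ _ (c2 (l u))); first by rewrite /c2 lerDl sqr_ge0.
    rewrite (le_trans (lL u))// ler_wpM2r ?nsq_ge0//.
    by rewrite (le_trans (ler_norm L))// lerDl.
  have mk := ler_wpM2l (ltW mu0) k2.
  have h := sqr_ge0 (mu * k u - L1).
  have hL : mu * L1 * (L1 / mu) = L1 ^+ 2 by field; rewrite gt_eqF.
  have mL0 : 0 < mu * L1 by rewrite mulr_gt0.
  rewrite -(ler_pM2l mL0) mulrN hL /J.
  have hS := ler_wpM2l (ltW mL0) (smu u : _ <= S u u).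
  have : mu * (mu * (k u ^+ 2)) <= mu * L1 * (mu * nsq u).
    by have := ler_wpM2l (ltW mu0) mk; lra.
  by rewrite mulrBr; lra.
pose A := [set J u | u in setT].
have infA : has_inf A by split; [exists (J 0), 0|exists (- (L1 / mu)) => _ [u _ <-]].
pose m := inf A.
have mJ u : m <= J u by apply: inf_lbound; [case: infA|exists u].
have /choice[u hu] : forall n : nat, exists u, J u < m + harmonic n.
  by move=> n; have [_ [u _ <-] ?] := inf_adherent (harmonic_gt0 n) infA; exists u.
(* Strict convexity: [J] is at least [m] at the midpoint of two near-minimizers, so these are
   close. *)
have dif i n : mu * nsq (u i - u n) <= 2 * harmonic i + 2 * harmonic n.
  apply: (le_trans (smu _)); rewrite -/(S _ _).
  have h := mJ (u n + (2^-1)%:C *: (u i - u n)).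
  have eq1 : u i = u n + 1%:C *: (u i - u n) by rewrite scale1r addrC subrK.
  have := JD (u n) (u i - u n) 1; rewrite -eq1.
  rewrite JD in h; have := hu i; have := hu n.
  by rewrite expr1n !mul1r; lra.
have [p cvp] : exists p : V, u n @[n --> \oo] --> p.
  apply: cauchyH_seq => d d0; have d40 : 0 < mu * d / 4 by rewrite divr_gt0 ?mulr_gt0.
  have [N hN] := harmonic_small d40.
  exists N => i n Ni Nn; rewrite -(ltr_pM2l mu0); apply: le_lt_trans (dif _ _) _.
  by have := hN i Ni; have := hN n Nn; lra.
have pu := (cvgH_seq _ _).1 cvp.
have Spk v : S p v = k v.
  (* First variation in the direction [t v]. Near-minimality is known at [u n] and not at [p], so
     [S (u n - p) v] must be made small; [eta] is the weight in the Cauchy-Schwarz inequality for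
     [S]. *)
  have key (t e : R) : 0 < e -> - e <= 2 * t * (S p v - k v) + t ^+ 2 * S v v.
    move=> e0; pose b := 2 * `|t| + 1; have b0 : 0 < b by rewrite ltr_wpDl ?mulr_ge0.
    pose q := S v v + 1; have q0 : 0 < q by rewrite ltr_wpDl.
    pose eta := e / (2 * b * q).
    have eta0 : 0 < eta by rewrite divr_gt0 ?mulr_gt0.
    pose e1 := e / (2 * b) * eta; have e10 : 0 < e1 by rewrite mulr_gt0 ?divr_gt0 ?mulr_gt0.
    have C1 : 0 < `|C| + 1 by rewrite ltr_wpDl.
    have [N1 hN1] := pu _ (divr_gt0 e10 C1).
    have [N2 hN2] := harmonic_small (divr_gt0 e0 (ltr0n R 2)).
    pose n := maxn N1 N2.
    have := mJ (u n + t%:C *: v); rewrite JD.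
    have := hu n; have := hN2 n (leq_maxr _ _).
    have nn : nsq (u n - p) < e1 / (`|C| + 1) by apply: hN1; exact: leq_maxl.
    have Sx : S (u n - p) (u n - p) <= e1.
      apply: (le_trans (sCb _)); move: nn; rewrite ltr_pdivlMr// => nn.
      apply: le_trans (ltW nn); rewrite mulrC ler_wpM2l ?nsq_ge0//.
      by rewrite (le_trans (ler_norm C))// lerDl.
    set x := u n - p in Sx.
    have -> : S (u n) v = S p v + S x v by rewrite -SD /x [p + _]addrC subrK.
    clearbody x.
    have bb : 2 * t * S x v <= e / 2.
      have h1 := S0 (x + eta%:C *: v); have h2 := S0 (x + (- eta)%:C *: v).
      rewrite !SD !SDr !SZ !SZr (SC v x) in h1 h2.
      have hq : eta * q = e / (2 * b) by rewrite /eta; field; rewrite !gt_eqF.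
      have : 2 * `|S x v| <= e / b.
        rewrite -(ler_pM2l eta0).
        have Sv : eta * (eta * S v v) <= eta * (e / (2 * b)).
          by rewrite -hq ler_pM2l// ler_pM2l// /q lerDl.
        have -> : eta * (e / b) = e1 + eta * (e / (2 * b)).
          by rewrite /e1; field; rewrite !gt_eqF.
        by case: (ler0P (S x v)) => _; lra.
      rewrite ler_pdivlMr// => hb.
      have hn1 : t * S x v <= `|t| * `|S x v| by rewrite -normrM ler_norm.
      have := normr_ge0 (S x v); have := normr_ge0 t.
      by move: hb; rewrite /b; lra.
    by lra.
  pose w := S p v - k v; pose q := S v v + 1.
  have q0 : 0 < q by rewrite ltr_wpDl.
  apply/eqP; rewrite -subr_eq0 -sqrf_eq0 eq_le sqr_ge0 andbT.
  apply/ler_addgt0Pr => e e0; rewrite add0r -/w.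
  (* This [t] minimizes [2 t w + t^2 q], where [q = S v v + 1] is positive even if [S v v]
     vanishes. *)
  have := key (- (w / q)) (e / q) (divr_gt0 e0 q0); rewrite -/w.
  have -> : 2 * - (w / q) * w + (- (w / q)) ^+ 2 * S v v =
    - (w ^+ 2 / q) - (w / q) ^+ 2.
    by rewrite (_ : S v v = q - 1) /q ?addrK//; field; rewrite gt_eqF.
  move=> h; have : w ^+ 2 / q <= e / q by have := sqr_ge0 (w / q); lra.
  by rewrite ler_pM2r ?invr_gt0.
exists p => v; apply/eqP; rewrite eq_complex; apply/andP; split; apply/eqP.
  exact: Spk.
(* Replacing [v] by [i v] yields the imaginary parts. *)
have := Spk ('i%C *: v); rewrite /S /k sC sZ lZ -/(S _ _).
rewrite (sC p v).
case: (s v p) => a b; case: (l v) => a' b' /=; rewrite !mul0r !mul1r.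
by lra.
Qed.

End RieszForm.

Section FormOperator.
Context {R : realType} {H : hilbertType R}.
Local Open Scope complex_scope.

(* The fourth clause, solvability at real [c < om], makes the symmetric operator [A]
   self-adjoint. *)
Definition sa_below (om : R) (A : graph H) : Prop :=
  [/\ forall c x y f g, A x f -> A y g -> A (c *: x + y) (c *: f + g),
      forall x y f g, A x f -> A y g -> inner f y = inner x g,
      forall x f, A x f -> om * nsq x <= rip f x,
      forall (c : R) x, c < om -> exists y, A y (x + c%:C *: y) &
      forall x (d : R), 0 < d -> exists y, (exists f, A y f) /\ nsq (x - y) <= d].

Variables (V : hilbertType R) (a : sesquilinear_form R V) (j : {linear V -> H}).

(** Joint continuity at the origin bounds [a] on a small ball, and scaling [u] into that ball gives
    the quadratic bound. *)
Lemma form_bounded :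
  continuous (fun uv : V * V => a uv.1 uv.2 : R[i]^o) ->
  exists C : R, forall u, complex.Re (a u u) <= C * nsq u.
Proof.
move=> /(_ (0, 0)) /cvgrPdist_lt/(_ 1 ltr01) /=; rewrite linear0l.
move=> [[A B] /= [/nbhs_normP[d1 /= d10 hA] /nbhs_normP[d2 /= d20 hB]] hAB].
pose r := Num.min (complex.Re d1) (complex.Re d2).
have dr1 : d1 = (complex.Re d1)%:C by rewrite RRe_real// gtr0_real.
have dr2 : d2 = (complex.Re d2)%:C by rewrite RRe_real// gtr0_real.
have r0 : 0 < r by rewrite lt_min -!ltcR -dr1 -dr2 d10 d20.
exists ((2 / r) ^+ 2) => u; have [->|u0] := eqVneq u 0.
  by rewrite linear0l nsq0 mulr0.
have hu0 : 0 < hn u by rewrite lt_def hn_ge0 hn_eq0 u0.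
pose k := r / (2 * hn u); have k0 : 0 < k by rewrite divr_gt0 ?mulr_gt0.
have hk : hn (k%:C *: u) = r / 2.
  by rewrite (hnZr _ (ltW k0)) /k invfM mulrA mulfVK ?gt_eqF.
have rr : r / 2 < r by rewrite ltr_pdivrMr// ltr_pMr// ltr1n.
have /(hAB (_, _)) : (A `*` B) (k%:C *: u, k%:C *: u).
  split; [apply: hA|apply: hB].
    rewrite /= sub0r normrN normhn hk dr1 ltcR (lt_le_trans rr)//.
    by rewrite /r ge_min lexx.
  rewrite /= sub0r normrN normhn hk dr2 ltcR (lt_le_trans rr)//.
  by rewrite /r ge_min lexx orbT.
rewrite /= linearZl_LR linearZr_LR /= sub0r normrN => h.
have : complex.Re (k%:C * ((k%:C)^* * a u u)) < 1.
  rewrite -ltcR; apply: le_lt_trans h.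
  by rewrite (le_trans _ (normc_ge_Re _))// lecR ler_norm.
rewrite ReZ (_ : _ * a u u = k%:C * a u u); last first.
  by congr (_ * _); exact: conjc_real.
rewrite ReZ mulrA -expr2 -ltr_pdivlMl ?exprn_gt0// mulr1 => /ltW h'.
rewrite (le_trans h')// nsq_hn -exprMn -exprVn /k invf_div.
by rewrite mulrAC.
Qed.

Hypothesis a_elliptic : j_elliptic j a.
Hypothesis a_sym : symmetric_sesquilinear a.

Let jlin : linear (j : V -> H). Proof. by move=> c x y; rewrite linearP. Qed.

Lemma form_ell : exists om mu : R, 0 < mu /\ forall u,
  mu * nsq u + om * nsq (j u) <= complex.Re (a u u).
Proof.
case: a_elliptic => _ _ _ [om [mu [mu0 h]]]; exists om, mu; split=> // u.
have := h u; rewrite !sqr_norm_inner !nsq_inner -!rmorphM -rmorphB lecR.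
by lra.
Qed.

Variable om : R.
Hypothesis a_om : forall u, om * nsq (j u) <= complex.Re (a u u).

(** The form [a - c] is coercive by a convex combination of the ellipticity inequality, with weight
    [th], and the lower bound [om]. The weight keeps [th * om0 + (1 - th) * om] at or above [c] and
    leaves the coercivity constant [th * mu]; so every [c] below [om] is allowed, however small
    [om0] is. *)
Lemma form_solve (c : R) (x : H) : c < om ->
  exists u, forall v, a u v - c%:C * inner (j u) (j v) = inner x (j v).
Proof.
move=> com; case: a_elliptic => jcont jdense acont _.
have [om0 [mu [mu0 ell]]] := form_ell.
have [Cj Cj0 jC] := continuous_linear_le jlin jcont.
have [Ca aC] := form_bounded acont.
pose th := (om - c) / (om - c + `|om - om0|).
have den0 : 0 < om - c + `|om - om0| by rewrite ltr_wpDr ?subr_gt0.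
have th0 : 0 < th by rewrite divr_gt0 ?subr_gt0.
have th1 : th <= 1 by rewrite ler_pdivrMr// mul1r lerDl.
have thc : th * (om - om0) <= om - c.
  apply: (@le_trans _ _ (th * (om - c + `|om - om0|))).
    rewrite ler_pM2l// (le_trans (ler_norm _))// lerDr subr_ge0 ltW//.
  by rewrite /th mulfVK ?gt_eqF.
apply: (riesz_form (s := fun u v => a u v - c%:C * inner (j u) (j v))
  (l := fun v => inner x (j v)) (mu := th * mu) (C := Ca + `|c| * Cj)
  (L := nsq x * Cj)).
- move=> k u v w; rewrite linearDl linearZl_LR jlin innerDl innerZl /=; ring.
- move=> u v; rewrite a_sym rmorphB rmorphM /=; congr (_ - _ * _).
    by apply/esym; exact: conjc_real.
  exact: innerC.
- by rewrite mulr_gt0.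
- move=> u; rewrite ReB ReZ -/(rip (j u) (j u)) -/(nsq (j u)).
  have h1 := ler_wpM2l (ltW th0) (ell u).
  have th1' : 0 <= 1 - th by rewrite subr_ge0.
  have h2 := ler_wpM2l th1' (a_om u).
  have h3 := ler_wpM2r (nsq_ge0 (j u)) thc.
  by lra.
- move=> u; rewrite ReB ReZ -/(rip (j u) (j u)) -/(nsq (j u)).
  rewrite mulrDl lerD// -mulNr.
  apply: (@le_trans _ _ (`|c| * nsq (j u))).
    by rewrite ler_wpM2r ?nsq_ge0// -normrN ler_norm.
  by rewrite -mulrA ler_wpM2l.
- by move=> k u v; rewrite jlin innerDr innerZr.
- move=> v; rewrite (le_trans (inner_c2_le _ _))// -mulrA ler_wpM2l ?nsq_ge0//.
Qed.

(** The second clause is the energy identity that trades the form for an inner product of [H] in the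
    domination inequality. *)
Lemma form_resolvent (c : R) (x : H) : c < om ->
  exists u, form_operator a j (j u) (x + c%:C *: j u) /\
    complex.Re (a u u) - c * nsq (j u) = rip x (j u).
Proof.
move=> com; have [u hu] := form_solve x com; exists u; split.
  exists u; split=> // v; rewrite innerDl innerZl -(hu v).
  by rewrite subrK.
by rewrite -[RHS]/(complex.Re _) -hu ReB ReZ.
Qed.

Lemma form_ge_resolvent (nu : R) (w : V) : 0 < nu -> exists y f,
  [/\ form_operator a j y f, f = om%:C *: y + nu%:C *: (j w - y),
      0 <= rip (f - om%:C *: y) y &
      rip (f - om%:C *: y) y + 2 * nu * nsq (j w - y) <=
      complex.Re (a w w) - om * nsq (j w)].
Proof.
move=> nu0; have com : om - nu < om by rewrite ltrBlDr ltrDl.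
have [u hu] := form_solve (nu%:C *: j w) com.
pose y := j u; pose f := om%:C *: y + nu%:C *: (j w - y).
have fu v : a u v = inner f (j v).
  have := hu v; rewrite /f innerDl !innerZl innerBl -/y rmorphB => /(canRL (subrK _)) ->.
  by ring.
have fE : f - om%:C *: y = nu%:C *: (j w - y) by rewrite /f addrC addKr.
have pos v : 0 <= complex.Re (a v v) - om * nsq (j v) by rewrite subr_ge0.
have ruv v : complex.Re (a u v) = rip f (j v) by rewrite fu.
exists y, f; split=> //; first by exists u.
  by rewrite ripBl ripZl; have := pos u; rewrite ruv.
have h0 := pos (w - u).
rewrite linearBl !linearBr !ReB (a_sym w u) ReJ !ruv (linB jlin) -/y nsqB in h0.
have h1 : rip f (j w) - om * rip (j w) y =
    nu * nsq (j w - y) + rip (f - om%:C *: y) y.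
  by rewrite fE {1}/f !ripE /nsq !ripE (ripC y (j w)); ring.
have h2 : rip (f - om%:C *: y) y = rip f y - om * nsq y by rewrite ripBl ripZl.
by lra.
Qed.

Lemma form_operator_sa_below : sa_below om (form_operator a j).
Proof.
split.
- move=> c x y f g [u [<- hu]] [v [<- hv]]; exists (c *: u + v).
  rewrite jlin; split=> // w.
  by rewrite linearDl linearZl_LR hu hv innerDl innerZl.
- move=> x y f g [u [<- hu]] [v [<- hv]].
  by rewrite -hu a_sym hv [RHS]innerC.
- by move=> x f [u [<- hu]]; rewrite /rip -hu.
- move=> c x com; have [u [hu _]] := form_resolvent x com.
  by exists (j u).
- move=> x d d0; case: a_elliptic => _ jd _ _.
  have d80 : 0 < d / 8 by rewrite divr_gt0.
  pose r := Num.sqrt (d / 8); have r0 : 0 < r by rewrite sqrtr_gt0.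
  have [|z [zb [w _ wz]]] := jd (ball x r%:C) _ (ball_open _ _).
    by exists x; apply: ballxx; rewrite ltcR.
  move: zb; rewrite -wz -ball_normE /= normhn ltcR => xw.
  have {}xw : nsq (x - j w) <= d / 8.
    by rewrite -(sqr_sqrtr (ltW d80)) -hn_le ?ltW// ?sqrtr_ge0.
  pose b := complex.Re (a w w) - om * nsq (j w) + 1.
  have b0 : 0 < b by rewrite ltr_wpDl// subr_ge0.
  (* With [nu = 4 b / d], the bound [2 nu |j w - y|^2 <= b] becomes [|j w - y|^2 <= d / 8]. *)
  have nu0 : 0 < 4 * b / d by rewrite divr_gt0// mulr_gt0.
  have [y [f [yf _ h1 h2]]] := form_ge_resolvent w nu0.
  exists y; split; first by exists f.
  have h3 : 2 * (4 * b / d) * nsq (j w - y) <= b.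
    have hb : complex.Re (a w w) - om * nsq (j w) <= b by rewrite lerDl.
    by rewrite (le_trans _ hb)//; apply: le_trans h2; rewrite lerDr.
  have h4 : nsq (j w - y) <= d / 8.
    rewrite -(ler_pM2l (mulr_gt0 (ltr0n R 2) nu0)) (le_trans h3)//.
    by rewrite le_eqVlt; apply/orP; left; apply/eqP; field; rewrite gt_eqF.
  by have := nsq_tri x (j w) y; lra.
Qed.

End FormOperator.

(** * Semigroups *)

Section UniformBoundedness.
Context {R : realType} {H : hilbertType R}.
Implicit Types (x y z : H) (S : H -> H).
Local Open Scope complex_scope.

Lemma hn0 : hn (0 : H) = 0. Proof. by apply/eqP; rewrite hn_eq0. Qed.

Lemma hn_tri x y z : hn (x - z) <= hn (x - y) + hn (y - z).
Proof. by rewrite (le_trans _ (hnD _ _))// addrA subrK. Qed.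

Lemma operator_norm S : bounded_operator S -> exists2 q : R, 0 <= q &
  (forall x, hn (S x) <= q * hn x) /\
  (forall q', q' < q -> exists2 x, hn x <= 1 & q' < hn (S x)).
Proof.
move=> Sb; have [Slin _] := Sb; have [C C0 SC] := bounded_operator_le Sb.
pose A := [set hn (S x) | x in [set x | hn x <= 1]].
have A0 : A 0 by exists 0; rewrite /= ?(lin0 Slin) hn0.
have supA : has_sup A.
  split; first by exists 0.
  have C10 : 0 <= C + 1 by lra.
  exists (C + 1) => _ [x x1 <-]; rewrite hn_le//.
  rewrite (le_trans (SC x))// nsq_hn.
  have : hn x ^+ 2 <= 1 by rewrite expr_le1// hn_ge0.
  have := sqr_ge0 C; rewrite expr2 sqrrD; nra.
exists (sup A); first exact: sup_upper_bound.
split=> [x|q' q'q]; last first.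
  have e0 : 0 < sup A - q' by rewrite subr_gt0.
  have [_ [x x1 <-] h] := sup_adherent e0 supA.
  by exists x => //; move: h; rewrite subKr.
have [->|x0] := eqVneq x 0; first by rewrite (lin0 Slin) hn0 mulr0.
have hx0 : 0 < hn x by rewrite lt_def hn_ge0 hn_eq0 x0.
rewrite -ler_pdivrMr// mulrC -hnZr ?invr_ge0 ?hn_ge0// -(linZ Slin).
apply: sup_upper_bound => //; eexists; last reflexivity.
by rewrite /= hnZr ?invr_ge0 ?hn_ge0// mulVf// gt_eqF.
Qed.

(** By the parallelogram identity [|S (x + y)|^2 + |S (x - y)|^2 >= 2 |S y|^2]. *)
Lemma hn_max S x y : linear S ->
  hn (S y) <= hn (S (x + y)) \/ hn (S y) <= hn (S (x - y)).
Proof.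
move=> Slin; have [h|h] := leP (hn (S y)) (hn (S (x + y))); [by left|right].
rewrite -ler_sqr ?nnegrE ?hn_ge0// -!nsq_hn (linB Slin) nsqB.
move: h; rewrite -ltr_sqr ?nnegrE ?hn_ge0// -!nsq_hn (linD Slin) nsqD.
by have := nsq_ge0 (S x); lra.
Qed.

(* The gliding hump: each step moves by [3^-n] in a direction where [S_ n] is
   large, and the later steps are too short to undo it. *)
Lemma uniform_boundedness (S_ : nat -> H -> H) :
  (forall n, bounded_operator (S_ n)) ->
  (forall x, exists B : R, forall n, hn (S_ n x) <= B) ->
  exists n, forall x, hn (S_ n x) <= 4 ^+ n * hn x.
Proof.
move=> Sb Spt; apply: contrapT => /forallNP hN.
have Slin n : linear (S_ n) by case: (Sb n).
have /choice[q hq] : forall n, exists q : R,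
    [/\ 4 ^+ n < q, forall x, hn (S_ n x) <= q * hn x &
        exists2 x, hn x <= 1 & q * (3 / 4) < hn (S_ n x)].
  move=> n; have [q q0 [qle qsup]] := operator_norm (Sb n); exists q.
  have q4 : 4 ^+ n < q.
    rewrite ltNge; apply/negP => q4; apply: (hN n) => x.
    by rewrite (le_trans (qle x))// ler_wpM2r ?hn_ge0.
  split=> //; apply: qsup; rewrite gtr_pMr; first lra.
  by rewrite (lt_trans _ q4)// exprn_gt0.
have /choice[z hz] : forall n, exists x, hn x <= 1 /\ q n * (3 / 4) < hn (S_ n x).
  by move=> n; have [_ _ [x x1 xq]] := hq n; exists x.
have /choice[st hst] : forall p : nat * H, exists y, hn (y - p.2) <= 3^-1 ^+ p.1 /\
    3^-1 ^+ p.1 * (q p.1 * (3 / 4)) <= hn (S_ p.1 y).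
  move=> [n x] /=; have r0 : 0 < 3^-1 ^+ n :> R by rewrite exprn_gt0// invr_gt0.
  have hs : hn ((3^-1 ^+ n)%:C *: z n) <= 3^-1 ^+ n.
    by rewrite (hnZr _ (ltW r0)) ger_pMr// (hz n).1.
  have hS : 3^-1 ^+ n * (q n * (3 / 4)) <= hn (S_ n ((3^-1 ^+ n)%:C *: z n)).
    by rewrite (linZ (Slin n)) (hnZr _ (ltW r0)) ler_pM2l// ltW// (hz n).2.
  have [h|h] := hn_max x ((3^-1 ^+ n)%:C *: z n) (Slin n).
    by exists (x + (3^-1 ^+ n)%:C *: z n); rewrite addrC addKr; split=> //; exact: le_trans h.
  exists (x - (3^-1 ^+ n)%:C *: z n); split; last exact: le_trans h.
  by rewrite addrC addKr hnN.
pose fix u (n : nat) : H := if n is m.+1 then st (m.+1, u m) else 0.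
have step n : hn (u n.+1 - u n) <= 3^-1 ^+ n.+1 by have [] := hst (n.+1, u n).
have big n : 3^-1 ^+ n.+1 * (q n.+1 * (3 / 4)) <= hn (S_ n.+1 (u n.+1)).
  by have [] := hst (n.+1, u n).
have r3 n : 0 < 3^-1 ^+ n :> R by rewrite exprn_gt0// invr_gt0.
have tail n i : hn (u (n + i)%N - u n) <= 3^-1 ^+ n / 2 * (1 - 3^-1 ^+ i).
  elim: i => [|i IH]; first by rewrite addn0 subrr hn0 expr0 subrr mulr0.
  rewrite addnS; apply: le_trans (hn_tri _ (u (n + i)%N) _) _.
  have := step (n + i)%N; rewrite !exprS exprD.
  by move: IH; set a := 3^-1 ^+ n; set b := 3^-1 ^+ i; lra.
have {}tail n i : hn (u (n + i)%N - u n) <= 3^-1 ^+ n / 2.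
  rewrite (le_trans (tail n i))// (ger_pMr _ (divr_gt0 (r3 n) (ltr0n R 2))).
  by rewrite lerBlDr lerDl ltW.
have [p cvp] : exists p : H, u n @[n --> \oo] --> p.
  apply: cauchyH_seq => d d0.
  have sd0 : 0 < Num.sqrt d by rewrite sqrtr_gt0.
  have /cvgrPdist_lt/(_ _ sd0)[N _ hN'] : (3^-1 ^+ n : R) @[n --> \oo] --> (0 : R).
    by apply: cvg_expr; rewrite ger0_norm ?invr_ge0// invf_lt1// ltr1n.
  exists N => m n Nm Nn.
  rewrite nsq_hn -(sqr_sqrtr (ltW d0)) ltr_sqr ?nnegrE ?hn_ge0 ?ltW//.
  apply: le_lt_trans (hn_tri _ (u N) _) _; rewrite [X in _ + X]hnB.
  have := tail N (m - N)%N; have := tail N (n - N)%N; rewrite !subnKC//.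
  have := hN' N (leqnn N); rewrite /= sub0r normrN ger0_norm; last exact: ltW.
  by lra.
have pu := (cvgH_seq _ _).1 cvp.
have lim n : hn (p - u n) <= 3^-1 ^+ n / 2.
  apply/ler_addgt0Pr => e e0; have [N hN'] := pu _ (exprn_gt0 2 e0).
  pose m := maxn N n.
  apply: le_trans (hn_tri _ (u m) _) _; rewrite addrC lerD//.
    by have := tail n (m - n)%N; rewrite subnKC// leq_maxr.
  by rewrite hnB hn_le ?ltW// hN'// leq_maxl.
have [B hB] := Spt p.
(* With [k = n.+1], the hump has size [3/4 q_k 3^-k], later steps remove at most [1/2 q_k 3^-k], and
   the remaining quarter exceeds [(4/3)^k / 4] because [q_k > 4^k]. *)
have low n : 4^-1 * (4 / 3) ^+ n.+1 <= B.
  apply: le_trans (hB n.+1); have [q4 qle _] := hq n.+1.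
  have h1 := qle (p - u n.+1); have h2 := big n; have h3 := lim n.+1.
  have q0 : 0 < q n.+1 by apply: lt_trans q4; rewrite exprn_gt0.
  have h4 : hn (S_ n.+1 (u n.+1)) <= hn (S_ n.+1 p) + hn (S_ n.+1 (p - u n.+1)).
    rewrite (linB (Slin _)) [X in _ + X]hnB -[X in hn X <= _](subrK (S_ n.+1 p)).
    by rewrite addrC hnD.
  have h5 := ler_wpM2l (ltW q0) h3.
  have h6 : (4 / 3) ^+ n.+1 <= q n.+1 * 3^-1 ^+ n.+1.
    by rewrite exprMn ler_wpM2r ?ltW.
  by move: h5 h6 h2; set a := 3^-1 ^+ n.+1; lra.
have bern n : 1 + n%:R / 3 <= (4 / 3 : R) ^+ n.
  elim: n => [|n IH]; first by rewrite mul0r addr0.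
  rewrite exprS -natr1; have := ler0n R n; nra.
have := archi_boundP (normr_ge0 (12 * B)); set k := Num.bound _ => hk.
have := low k; have := bern k.+1; rewrite -natr1.
by have := ler_norm (12 * B); lra.
Qed.

End UniformBoundedness.

(** * Strongly continuous semigroups and their generators *)

Section Semigroup.
Context {R : realType} {H : hilbertType R}.
Implicit Types (x y z : H) (T S : R -> H -> H).
Local Open Scope complex_scope.

Lemma near_right0 (P : R -> Prop) :
  (\forall h \near 0^'+, P h) <->
  exists2 d : R, 0 < d & forall h, 0 < h -> h < d -> P h.
Proof.
split=> [/nbhs_ballP[d /= d0 hd]|[d d0 hd]].
  by exists d => // h h0 hhd; apply: hd => //; rewrite /ball/= sub0r normrN gtr0_norm.
apply/nbhs_ballP; exists d => //= h; rewrite /ball/= sub0r normrN => hd' h0.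
by apply: hd => //; rewrite -(gtr0_norm h0).
Qed.

Lemma generator_rem T x f : generator T x f -> forall e : R, 0 < e ->
  exists2 d : R, 0 < d & forall h, 0 < h -> h < d ->
    exists2 r, T h x - x = h%:C *: (f + r) & hn r < e.
Proof.
move=> /(cvgH _ _).1 gTx e e0.
have /near_right0[d d0 hd] := gTx _ (exprn_gt0 2 e0); exists d => // h h0 hhd.
exists (h^-1%:C *: (T h x - x) - f).
  by rewrite [f + _]addrC subrK scalerA -rmorphM/= divff ?gt_eqF// scale1r.
by rewrite -ltr_sqr ?nnegrE ?hn_ge0 ?(ltW e0)// -nsq_hn hd.
Qed.

Lemma generatorP T x f : (forall e : R, 0 < e ->
  exists2 d : R, 0 < d & forall h, 0 < h -> h < d ->
    nsq (h^-1%:C *: (T h x - x) - f) < e) -> generator T x f.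
Proof.
by move=> h; apply/(cvgH _ _).2 => e e0; apply/near_right0; exact: h.
Qed.

(** Otherwise there are times [t n <= harmonic n] at which [T (t n)] has norm above [4 ^+ n]. This
    contradicts [uniform_boundedness], since [T (t n) x] eventually stays within 1 of [x]. *)
Lemma semigroup_local_bound T : C0_semigroup T ->
  exists2 d : R, 0 < d & exists M : R, forall t, 0 <= t -> t <= d ->
    forall x, hn (T t x) <= M * hn x.
Proof.
move=> [Tb T0 _ Tc]; apply: contrapT => hN.
have /choice[t ht] : forall n : nat, exists t : R, [/\ 0 <= t, t <= harmonic n &
    exists x, 4 ^+ n * hn x < hn (T t x)].
  move=> n; apply: contrapT => hn'; apply: hN; exists (harmonic n).
    exact: harmonic_gt0.
  exists (4 ^+ n) => t t0 tn x; rewrite leNgt; apply/negP => hx.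
  by apply: hn'; exists t; split=> //; exists x.
have [||n hn'] := @uniform_boundedness R H (fun n => T (t n)).
- by move=> n; apply: Tb; case: (ht n).
- move=> x; have /(cvgH _ _).1/(_ 1 ltr01)/near_right0[d d0 hd] := Tc x.
  have [N hN'] := harmonic_small d0.
  exists (hn x + 1 + \sum_(i < N) hn (T (t i) x)) => n.
  have s0 : 0 <= \sum_(i < N) hn (T (t i) x) by apply: sumr_ge0 => i _; exact: hn_ge0.
  have [nN|Nn] := ltnP n N.
    rewrite (bigD1 (Ordinal nN))//= addrCA lerDl addr_ge0//.
      by rewrite addr_ge0 ?hn_ge0.
    by apply: sumr_ge0 => i _; exact: hn_ge0.
  have [tn0 tn _] := ht n.
  have : hn (T (t n) x) <= hn x + 1; last by lra.
  have [->|tn0'] := eqVneq (t n) 0; first by rewrite T0 lerDl.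
  have : nsq (T (t n) x - x) < 1.
    by apply: hd; [rewrite lt_def tn0' tn0|rewrite (le_lt_trans tn)// hN'].
  rewrite nsq_hn expr_lt1 ?hn_ge0// => h1.
  by rewrite -[T (t n) x](subrK x) addrC (le_trans (hnD _ _))// lerD2l ltW.
- have [_ _ [x hx]] := ht n.
  by have := hn' x; rewrite leNgt hx.
Qed.

Lemma semigroup_bound T (t : R) : C0_semigroup T ->
  exists2 M : R, 1 <= M & forall s, 0 <= s -> s <= t ->
    forall x, hn (T s x) <= M * hn x.
Proof.
move=> TC; have [d d0 [M0 hM0]] := semigroup_local_bound TC.
have [_ T0 TD _] := TC.
pose M := Num.max M0 1; have M1 : 1 <= M by rewrite le_max lexx orbT.
have hM s x : 0 <= s -> s <= d -> hn (T s x) <= M * hn x.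
  move=> s0 sd; rewrite (le_trans (hM0 s s0 sd x))// ler_wpM2r ?hn_ge0//.
  by rewrite le_max lexx.
have iterM n : forall s x, 0 <= s -> s <= d -> hn (T (n%:R * s) x) <= M ^+ n * hn x.
  elim: n => [|n IH] s x s0 sd; first by rewrite mul0r T0 expr0 mul1r.
  rewrite -natr1 mulrDl mul1r addrC TD ?mulr_ge0//= exprS -mulrA.
  apply: le_trans (hM _ _ s0 sd) _.
  by rewrite ler_wpM2l ?(le_trans ler01 M1)// IH.
pose n := (Num.bound (`|t| / d)).+1.
exists (M ^+ n); first by rewrite exprn_ege1.
move=> s s0 st x.
have n0 : 0 < n%:R :> R by rewrite ltr0n.
have -> : s = n%:R * (s / n%:R) by rewrite mulrC divfK// gt_eqF.
apply: iterM; first by rewrite divr_ge0.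
rewrite ler_pdivrMr//.
have td0 : 0 <= `|t| / d by rewrite divr_ge0// ltW.
have td : `|t| / d < n%:R by rewrite (lt_le_trans (archi_boundP td0))// ler_nat.
move: td; rewrite ltr_pdivrMr// mulrC => td.
by rewrite (le_trans st)// (le_trans (ler_norm t))// ltW.
Qed.

Lemma generator_invariant T x f (t : R) : C0_semigroup T -> 0 <= t ->
  generator T x f -> generator T (T t x) (T t f).
Proof.
move=> TC t0 gTx; have [Tb _ TD _] := TC.
have [Tlin _] := Tb t t0.
have [M M1 hM] := semigroup_bound t TC.
have M0 : 0 < M by apply: lt_le_trans M1.
apply: generatorP => e e0.
have se0 : 0 < Num.sqrt e by rewrite sqrtr_gt0.
have [d d0 hd] := generator_rem gTx (divr_gt0 se0 M0).
exists d => // h h0 hhd; have [r hr rs] := hd h h0 hhd.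
have -> : T h (T t x) = T t (T h x).
  have h0' := ltW h0.
  have := TD _ _ t0 h0'; have := TD _ _ h0' t0; rewrite addrC => -> hT.
  exact: (congr1 (fun S : H -> H => S x) hT).
rewrite -(linB Tlin) hr (linZ Tlin) scalerA -rmorphM/= mulVf ?gt_eqF// scale1r.
rewrite (linD Tlin) addrAC subrr add0r nsq_hn -(sqr_sqrtr (ltW e0)).
rewrite ltr_sqr ?nnegrE ?hn_ge0 ?(ltW se0)// (le_lt_trans (hM _ t0 (lexx _) _))//.
by move: rs; rewrite ltr_pdivlMr// mulrC.
Qed.

Lemma rip_norm x y : `|rip x y| <= hn x * hn y.
Proof.
rewrite ler_norml rip_hn_le andbT -[leRHS]opprK lerN2 -ripNl.
by rewrite (le_trans (rip_hn_le _ _))// hnN.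
Qed.

(* [s |-> <T(s)x, S(t - s)y>] has derivative zero. *)
Lemma semigroup_duality T S (t : R) x f y g : C0_semigroup T -> C0_semigroup S ->
  (forall x' f' y' g', generator T x' f' -> generator S y' g' ->
    rip f' y' = rip x' g') ->
  generator T x f -> generator S y g -> 0 <= t -> rip (T t x) y = rip x (S t y).
Proof.
move=> TC SC dual gx gy t0.
have [M M1 hM] := semigroup_bound t TC.
have [N N1 hN] := semigroup_bound t SC.
have M0 : 0 < M by apply: lt_le_trans M1.
have N0 : 0 < N by apply: lt_le_trans N1.
have [Tb T0 TD _] := TC; have [Sb S0 SD _] := SC.
apply/eqP; rewrite -subr_eq0 -normr_eq0 eq_le normr_ge0 andbT.
apply/ler_addgt0Pr => e e0; rewrite add0r.
pose K := (t + 1) * (M * N) * (hn x + hn y + 1).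
have K0 : 0 < K.
  by rewrite !mulr_gt0// ?ltr_wpDl// addr_ge0 ?hn_ge0.
pose eps := e / K; have eps0 : 0 < eps by rewrite divr_gt0.
have [d1 d10 hd1] := generator_rem gx eps0.
have [d2 d20 hd2] := generator_rem gy eps0.
pose m := (Num.bound (t / Num.min d1 d2)).+1.
have d0 : 0 < Num.min d1 d2 by rewrite lt_min d10 d20.
have [->|tn0] := eqVneq t 0; first by rewrite T0 S0 /= subrr normr0 ltW.
have tgt0 : 0 < t by rewrite lt_def tn0 t0.
have m0 : 0 < m%:R :> R by rewrite ltr0n.
pose h := t / m%:R; have h0 : 0 < h by rewrite divr_gt0.
have hd : h < Num.min d1 d2.
  rewrite ltr_pdivrMr// mulrC -ltr_pdivrMr//.
  have td0 : 0 <= t / Num.min d1 d2 by rewrite divr_ge0// ltW.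
  by rewrite (lt_le_trans (archi_boundP td0))// ler_nat.
move: hd; rewrite lt_min => /andP[hhd1 hhd2].
have [r hr rs] := hd1 h h0 hhd1; have [r' hr' rs'] := hd2 h h0 hhd2.
have tm : t = m%:R * h by rewrite mulrC divfK// gt_eqF.
have ih0 (i : nat) : 0 <= i%:R * h by rewrite mulr_ge0// ltW.
have iht (i : nat) : (i <= m)%N -> i%:R * h <= t.
  by move=> im; rewrite tm ler_pM2r// ler_nat.
(* The derivative is replaced by a telescoping sum over [m] steps of length [h]: the first-order
   terms of each increment cancel by [dual], what is left is [h] times a multiple of [eps], and the
   total is a multiple of [t eps]. *)
pose F i := rip (T (i%:R * h) x) (S ((m - i)%:R * h) y).
have -> : rip (T t x) y - rip x (S t y) = \sum_(0 <= i < m) (F i.+1 - F i).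
  by rewrite telescope_sumr// /F subnn subn0 mul0r T0 S0 -tm.
have step i : (i < m)%N -> `|F i.+1 - F i| <= h * (M * N * (eps * (hn x + hn y))).
  move=> im; rewrite /F; set k := (m - i.+1)%N.
  have -> : (m - i)%N = k.+1 by rewrite /k subnSK.
  have km : (k <= m)%N by rewrite leq_subr.
  have [Tilin _] := Tb _ (ih0 i); have [Sklin _] := Sb _ (ih0 k).
  have -> : T (i.+1%:R * h) x = T (i%:R * h) x + h%:C *: T (i%:R * h) (f + r).
    rewrite -natr1 mulrDl mul1r (TD _ _ (ih0 i) (ltW h0)) /=.
    by rewrite -(linZ Tilin) -hr -(linD Tilin) addrC subrK.
  have -> : S (k.+1%:R * h) y = S (k%:R * h) y + h%:C *: S (k%:R * h) (g + r').
    rewrite -natr1 mulrDl mul1r (SD _ _ (ih0 k) (ltW h0)) /=.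
    by rewrite -(linZ Sklin) -hr' -(linD Sklin) addrC subrK.
  rewrite ripDl ripDr ripZl ripZr (linD Tilin) (linD Sklin) ripDl ripDr.
  have -> : rip (T (i%:R * h) f) (S (k%:R * h) y) = rip (T (i%:R * h) x) (S (k%:R * h) g).
    by apply: dual; exact: generator_invariant.
  rewrite [X in `|X|](_ : _ = h * (rip (T (i%:R * h) r) (S (k%:R * h) y) -
    rip (T (i%:R * h) x) (S (k%:R * h) r'))); last by ring.
  rewrite normrM gtr0_norm// ler_pM2l// (le_trans (ler_normB _ _))//.
  have b1 : hn (T (i%:R * h) r) * hn (S (k%:R * h) y) <= (M * eps) * (N * hn y).
    apply: ler_pM; rewrite ?hn_ge0//; last exact: hN (ih0 k) (iht _ km) _.
    by rewrite (le_trans (hM _ (ih0 i) (iht _ (ltnW im)) _))// ler_pM2l// ltW.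
  have b2 : hn (T (i%:R * h) x) * hn (S (k%:R * h) r') <= (M * hn x) * (N * eps).
    apply: ler_pM; rewrite ?hn_ge0//; first exact: hM (ih0 i) (iht _ (ltnW im)) _.
    by rewrite (le_trans (hN _ (ih0 k) (iht _ km) _))// ler_pM2l// ltW.
  have := rip_norm (T (i%:R * h) r) (S (k%:R * h) y).
  by have := rip_norm (T (i%:R * h) x) (S (k%:R * h) r'); lra.
apply: le_trans (ler_norm_sum _ _ _) _.
rewrite big_nat; apply: (@le_trans _ _ (\sum_(0 <= i < m) h * (M * N * (eps * (hn x + hn y))))).
  by rewrite [leRHS]big_nat; apply: ler_sum => i /andP[_ im]; exact: step.
rewrite sumr_const_nat subn0 -mulr_natl mulrA -tm.
have -> : e = K * eps by rewrite mulrC divfK// gt_eqF.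
rewrite /K.
have := ltW eps0; have := hn_ge0 x; have := hn_ge0 y; have := mulr_gt0 M0 N0.
set P := M * N; set X := hn x; set Y := hn y => P0 Y0 X0 ee0.
have h1 : P * (eps * (X + Y)) <= P * (eps * (X + Y + 1)).
  by rewrite ler_pM2l// ler_pM2l// lerDl.
have h2 : 0 <= P * (eps * (X + Y + 1)).
  by apply: mulr_ge0; [exact: ltW|apply: mulr_ge0 => //; rewrite !addr_ge0].
have := ler_wpM2l t0 h1; lra.
Qed.

End Semigroup.

(** * Difference quotients of the exponential *)

Section ExpQuotient.
Context {R : realType}.
Implicit Types (c h u : R).

Lemma expR_quadratic u : `|u| <= 2^-1 -> `|expR u - 1 - u| <= 2 * u ^+ 2.
Proof.
move=> u2; have [ul ur] : - 2^-1 <= u /\ u <= 2^-1 by apply/andP; rewrite -ler_norml.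
have h1 := expR_ge1Dx u; have h2 := expR_ge1Dx (- u).
rewrite ger0_norm; last lra.
have : expR u * (1 - u) <= 1.
  by rewrite -[leRHS](expRxMexpNx_1 u) ler_pM2l ?expR_gt0.
move=> h3; have := sqr_ge0 u; rewrite expr2; nra.
Qed.

Lemma exp_quotient_cvg c : (expR (c * h) - 1) / h @[h --> 0^'+] --> c.
Proof.
apply/cvgrPdist_lt => e e0; apply/near_right0.
have C0 : 0 < 2 * c ^+ 2 + 1 by rewrite ltr_wpDl// mulr_ge0// sqr_ge0.
have c0 : 0 < 2 * `|c| + 1 by rewrite ltr_wpDl// mulr_ge0.
exists (Num.min (2 * `|c| + 1)^-1 (e / (2 * c ^+ 2 + 1))).
  by rewrite lt_min invr_gt0 c0 divr_gt0.
move=> h h0; rewrite lt_min -[X in h < X]div1r !ltr_pdivlMr// => /andP[h1 h2].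
have ch : `|c * h| <= 2^-1 by rewrite normrM (gtr0_norm h0); lra.
rewrite distrC -(ltr_pM2l h0) -{1}(gtr0_norm h0) -normrM.
have -> : h * ((expR (c * h) - 1) / h - c) = expR (c * h) - 1 - c * h.
  by field; rewrite gt_eqF.
apply: le_lt_trans (expR_quadratic ch) _.
rewrite exprMn (_ : _ * (_ * _) = h * (2 * c ^+ 2 * h)); last by ring.
by rewrite ltr_pM2l//; apply: le_lt_trans h2; rewrite [leRHS]mulrDr mulr1 mulrC lerDl ltW.
Qed.

Lemma expR_cvg1 c : expR (c * h) @[h --> 0^'+] --> (1 : R).
Proof.
have h (x : R) : {for x, continuous (fun h : R => expR (c * h))}.
  apply: continuous_comp; [exact: mulrl_continuous|exact: continuous_expR].
by have := cvg_at_right_filter (h 0); rewrite mulr0 expR0.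
Qed.

Lemma cvg_real_complex (T : Type) (F : set_system T) {FF : Filter F}
    (g : T -> R) (l : R) :
  g t @[t --> F] --> l -> ((g t)%:C%C : R[i]^o) @[t --> F] --> (l%:C%C : R[i]^o).
Proof.
move=> /cvgrPdist_lt gl; apply/cvgrPdist_lt => e e0.
have er : e = (complex.Re e)%:C%C by rewrite RRe_real// gtr0_real.
have e'0 : 0 < complex.Re e by rewrite -ltcR -er.
apply: filterS (gl _ e'0) => t ht.
by rewrite -rmorphB er normc_def /= expr0n addr0 sqrtr_sqr ltcR.
Qed.

End ExpQuotient.

(** * Semigroups with symmetric generators *)

Section SelfAdjointSemigroup.
Context {R : realType} {H : hilbertType R}.
Implicit Types (x y z : H) (T S : R -> H -> H).
Local Open Scope complex_scope.

(** The imaginary part of [<a, b>] is the real part of [<a, i b>], and [S] commutes with [i]. *)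
Lemma rip_symmetric_op (S : H -> H) : linear S ->
  (forall x y, rip (S x) y = rip x (S y)) -> symmetric_op S.
Proof.
move=> Slin h x y.
have ImE a b : complex.Im (inner a b) = rip a ('i%C *: b).
  by rewrite /rip innerZr; case: (inner a b) => u v /=; rewrite !mul0r; ring.
have ReE a b : complex.Re (inner a b) = rip a b by [].
apply/eqP; rewrite eq_complex !ReE !ImE; apply/andP; split; apply/eqP => //.
by rewrite h (linZ Slin).
Qed.

Definition dense_dom (G : graph H) := forall x (d : R), 0 < d ->
  exists y, (exists f, G y f) /\ nsq (x - y) <= d.

Definition symmetric_graph (G : graph H) := forall x f y g, G x f -> G y g ->
  rip f y = rip x g.

Lemma rip_closed (S : H -> H) (M : R) x (z : H) (D : set H) : linear S -> 0 <= M ->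
  (forall y, hn (S y) <= M * hn y) ->
  (forall x (d : R), 0 < d -> exists2 y, D y & nsq (x - y) <= d) ->
  (forall y, D y -> rip z y = rip x (S y)) -> forall y, rip z y = rip x (S y).
Proof.
move=> Slin M0 SM dD h y; apply/eqP; rewrite -subr_eq0 -normr_eq0 eq_le normr_ge0 andbT.
apply/ler_addgt0Pr => e e0; rewrite add0r.
pose K := hn z + hn x * M + 1.
have K0 : 0 < K by rewrite ltr_wpDl// addr_ge0 ?mulr_ge0 ?hn_ge0.
have [y' Dy' yy'] := dD y _ (exprn_gt0 2 (divr_gt0 e0 K0)).
rewrite -hn_le in yy'; last by rewrite divr_ge0 ?ltW.
have -> : rip z y - rip x (S y) = rip z (y - y') - rip x (S (y - y')).
  by rewrite (linB Slin) !ripBr (h y' Dy'); ring.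
rewrite (le_trans (ler_normB _ _))//.
have h1 := rip_norm z (y - y'); have h2 := rip_norm x (S (y - y')).
have h3 := ler_wpM2l (hn_ge0 x) (SM (y - y')).
have h4 : K * hn (y - y') <= e.
  by move: yy'; rewrite ler_pdivlMr// mulrC.
by move: h4; rewrite /K; have := hn_ge0 (y - y'); lra.
Qed.

Lemma semigroup_adjoint T S (t : R) : C0_semigroup T -> C0_semigroup S ->
  (forall x' f' y' g', generator T x' f' -> generator S y' g' ->
    rip f' y' = rip x' g') ->
  dense_dom (generator T) -> dense_dom (generator S) -> 0 <= t ->
  forall x y, rip (T t x) y = rip x (S t y).
Proof.
move=> TC SC dual dT dS t0.
have [M M1 hM] := semigroup_bound t TC; have [N N1 hN] := semigroup_bound t SC.
have M0 : 0 <= M by apply: le_trans M1.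
have N0 : 0 <= N by apply: le_trans N1.
have [Tlin _] : bounded_operator (T t) by case: TC => + _ _ _; apply.
have [Slin _] : bounded_operator (S t) by case: SC => + _ _ _; apply.
have h x y : (exists f, generator T x f) -> rip (T t x) y = rip x (S t y).
  move=> [f xf].
  apply: (@rip_closed _ N x (T t x) [set y | exists g, generator S y g]) => //.
  - by move=> z; exact: hN.
  - by move=> z d /(dS z)[z' [h1 h2]]; exists z'.
  - by move=> z [g zg]; exact: (semigroup_duality TC SC dual xf zg t0).
move=> x y; rewrite ripC [RHS]ripC; apply: esym.
apply: (@rip_closed _ M y (S t y) [set x | exists f, generator T x f]) => //.
- by move=> z; exact: hM.
- by move=> z d /(dT z)[z' [h1 h2]]; exists z'.
- by move=> z Dz; rewrite ripC [RHS]ripC h.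
Qed.

Section Symmetric.
Variables (T : R -> H -> H) (TC : C0_semigroup T).
Hypotheses (Tsym : symmetric_graph (generator T)) (Tdense : dense_dom (generator T)).

Lemma semigroup_sym t : 0 <= t -> symmetric_op (T t).
Proof.
move=> t0; apply: rip_symmetric_op; first by case: TC => /(_ _ t0)[].
exact: semigroup_adjoint.
Qed.

(** Duality applies to the pair [T], [S] as well as to [S] alone:
    [<T t x, y> = <x, S t y> = <S t x, y>]. *)
Lemma semigroup_unique S : C0_semigroup S ->
  (forall x f, generator T x f <-> generator S x f) ->
  forall t, 0 <= t -> T t = S t.
Proof.
move=> SC TS t t0.
have dS : dense_dom (generator S).
  by move=> x d /(Tdense x)[y [[f /TS yf] xy]]; exists y; split=> //; exists f.
have sS : symmetric_graph (generator S) by move=> x f y g /TS xf /TS yg; exact: Tsym.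
apply/funext => x; apply: rip_eq => y.
have -> : rip (T t x) y = rip x (S t y).
  by apply: semigroup_adjoint => // x' f' y' g' h1 /TS h2; exact: Tsym.
by symmetry; apply: semigroup_adjoint.
Qed.

Lemma semigroup_half t x : 0 <= t -> rip (T t x) x = nsq (T (t / 2) x).
Proof.
move=> t0; have t20 : 0 <= t / 2 by rewrite divr_ge0.
have [_ _ TD _] := TC.
rewrite {1}(splitr t) TD//= /nsq symmetric_rip//.
exact: semigroup_sym.
Qed.

(* [1 - T(2t) = 2 (1 - T(t)) - (1 - T(t))^2], iterated towards [t = 0]. *)
Lemma semigroup_generator_ge t x f : 0 <= t -> generator T x f ->
  nsq x - rip (T t x) x <= t * - rip f x.
Proof.
move=> t0 xf; have [Tb T0 TD _] := TC.
pose phi s := nsq x - rip (T s x) x.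
have dbl s : 0 <= s -> phi s <= 2 * phi (s / 2).
  move=> s0; have s20 : 0 <= s / 2 by rewrite divr_ge0.
  have := nsq_ge0 (x - T (s / 2) x).
  by rewrite /phi nsqB -(semigroup_half x s0) (ripC x); lra.
have pw k : forall s, 0 <= s -> phi s <= 2 ^+ k * phi (s / 2 ^+ k).
  elim: k => [|k IH] s s0; first by rewrite expr0 divr1 mul1r.
  have s20 : 0 <= s / 2 by rewrite divr_ge0.
  apply: le_trans (dbl s s0) _; rewrite exprS -mulrA ler_pM2l//.
  by apply: le_trans (IH _ s20) _; rewrite invfM mulrA.
have [->|tn0] := eqVneq t 0; first by rewrite T0 /nsq subrr mul0r.
have tgt0 : 0 < t by rewrite lt_def tn0 t0.
apply/ler_addgt0Pr => e e0.
have K0 : 0 < t * hn x + 1 by rewrite ltr_wpDl// mulr_ge0// hn_ge0.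
have [d d0 hd] := generator_rem xf (divr_gt0 e0 K0).
pose k := Num.bound (t / d).
have td0 : 0 <= t / d by rewrite divr_ge0// ltW.
have k2 : 0 < 2 ^+ k :> R by rewrite exprn_gt0.
have kd : t / 2 ^+ k < d.
  rewrite ltr_pdivrMr// mulrC -ltr_pdivrMr// (lt_trans (archi_boundP td0))//.
  by rewrite -natrX ltr_nat ltn_expl.
have [r hr rs] := hd _ (divr_gt0 tgt0 k2) kd.
apply: le_trans (pw k t t0) _.
have -> : phi (t / 2 ^+ k) = - rip (T (t / 2 ^+ k) x - x) x by rewrite ripBl opprB.
rewrite hr ripZl mulrN mulrA [2 ^+ k * _]mulrC divfK ?gt_eqF// ripDl.
have := rip_norm r x; rewrite ler_norml => /andP[h1 _].
have h2 : hn r * (t * hn x + 1) <= e by move: rs; rewrite ltr_pdivlMr// => /ltW.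
have := ler_wpM2l t0 h1; have := hn_ge0 r; rewrite mulrN mulrDr; lra.
Qed.

Hypothesis Tneg : forall x f, generator T x f -> rip f x <= 0.

(** Another telescoping sum. Splitting [T (i h)] into two halves [T s], an increment is
    [h <T s f, T s x>] up to a remainder, and this is at most 0 by [Tneg], as [T s x] is in the
    domain with image [T s f]. *)
Let quad_le t x f : 0 <= t -> generator T x f -> rip (T t x) x <= nsq x.
Proof.
move=> t0 xf; have [Tb T0 TD _] := TC.
have [M M1 hM] := semigroup_bound t TC.
have M0 : 0 < M by apply: lt_le_trans M1.
have [->|tn0] := eqVneq t 0; first by rewrite T0.
have tgt0 : 0 < t by rewrite lt_def tn0 t0.
apply/ler_addgt0Pr => e e0.
have K0 : 0 < t * (M * M * hn x) + 1.
  by rewrite ltr_wpDl// !mulr_ge0 ?hn_ge0// ltW.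
have [d d0 hd] := generator_rem xf (divr_gt0 e0 K0).
pose m := (Num.bound (t / d)).+1.
have m0 : 0 < m%:R :> R by rewrite ltr0n.
pose h := t / m%:R; have h0 : 0 < h by rewrite divr_gt0.
have td0 : 0 <= t / d by rewrite divr_ge0// ltW.
have hhd : h < d.
  rewrite ltr_pdivrMr// mulrC -ltr_pdivrMr//.
  by rewrite (lt_le_trans (archi_boundP td0))// ler_nat.
have [r hr rs] := hd h h0 hhd.
have tm : t = m%:R * h by rewrite mulrC divfK// gt_eqF.
pose F i := rip (T (i%:R * h) x) x.
have -> : rip (T t x) x = \sum_(0 <= i < m) (F i.+1 - F i) + nsq x.
  by rewrite telescope_sumr// /F mul0r T0 -tm subrK.
rewrite addrC lerD2l.
have step i : (i < m)%N -> F i.+1 - F i <= h * (M * M * hn x * hn r).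
  move=> im; pose s := i%:R * h / 2; pose p := T s x.
  have s0 : 0 <= s by rewrite divr_ge0// mulr_ge0// ltW.
  have st : s <= t.
    rewrite tm /s ler_pdivrMr// mulrAC ler_pM2r// -natrM ler_nat.
    by rewrite (leq_trans (ltnW im))// leq_pmulr.
  have [Tslin _] := Tb _ s0.
  have Tss u : T (i%:R * h) u = T s (T s u).
    by rewrite (splitr (i%:R * h)) TD.
  have TsC u : T (i.+1%:R * h) u = T s (T s (T h u)).
    rewrite -natr1 mulrDl mul1r TD ?(ltW h0) ?mulr_ge0 ?(ltW h0)//= Tss//.
  rewrite /F TsC Tss -ripBl -!(linB Tslin) hr !(linZ Tslin) ripZl ler_pM2l//.
  rewrite (symmetric_rip _ _ (semigroup_sym s0)) (linD Tslin) ripDl.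
  have h1 := Tneg (generator_invariant TC s0 xf).
  have := rip_norm (T s r) (T s x); rewrite ler_norml => /andP[_ h2].
  have := ler_pM (hn_ge0 _) (hn_ge0 _) (hM s s0 st r) (hM s s0 st x).
  by lra.
apply: (@le_trans _ _ (\sum_(0 <= i < m) h * (M * M * hn x * hn r))).
  by rewrite big_nat [leRHS]big_nat; apply: ler_sum => i /andP[_ im]; exact: step.
rewrite sumr_const_nat subn0 -mulr_natl mulrA -tm.
move: rs; rewrite ltr_pdivlMr// => /ltW; have := hn_ge0 r; lra.
Qed.

Lemma semigroup_contraction t x : 0 <= t -> nsq (T t x) <= nsq x.
Proof.
move=> t0; have [Tb T0 TD _] := TC.
have [M M1 hM] := semigroup_bound t TC.
have M0 : 0 <= M by apply: le_trans M1.
have [Tlin _] := Tb _ t0.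
have onD y f : generator T y f -> nsq (T t y) <= nsq y.
  move=> yf; have tt0 : 0 <= t * 2 by rewrite mulr_ge0.
  have := quad_le tt0 yf; rewrite semigroup_half//.
  by rewrite mulfK.
have onDh y f : generator T y f -> hn (T t y) <= hn y.
  by move=> /onD; rewrite !nsq_hn ler_sqr ?nnegrE ?hn_ge0.
suff : hn (T t x) <= hn x by rewrite !nsq_hn ler_sqr ?nnegrE ?hn_ge0.
apply/ler_addgt0Pr => e e0.
have M10 : 0 < M + 1 by rewrite ltr_wpDl.
have [y [[f yf] xy]] := Tdense x (exprn_gt0 2 (divr_gt0 e0 M10)).
rewrite -hn_le in xy; last by rewrite divr_ge0 ?ltW.
have h1 := onDh _ _ yf.
have h2 := hM t t0 (lexx _) (x - y).
have h3 : hn (T t x) <= hn (T t (x - y)) + hn (T t y).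
  by apply: le_trans (hnD _ _); rewrite -(linD Tlin) subrK.
have h4 : hn y <= hn x + hn (x - y) by rewrite hnB; apply: le_trans (hnD _ _); rewrite addrC subrK.
move: xy; rewrite ler_pdivlMr// => xy.
by have := hn_ge0 (x - y); lra.
Qed.

End Symmetric.

Definition rescale (c : R) T : R -> H -> H := fun t x => (expR (c * t))%:C *: T t x.

Lemma rescale_generator c T x f : generator T x f ->
  C0_semigroup T -> generator (rescale c T) x (f + c%:C *: x).
Proof.
move=> xf [_ _ _ Tc].
have e1 : ((expR (c * h))%:C : R[i]^o) @[h --> 0^'+] --> (1%:C : R[i]^o).
  by apply: cvg_real_complex; exact: expR_cvg1.
have e2 : (((expR (c * h) - 1) / h)%:C : R[i]^o) @[h --> 0^'+] --> (c%:C : R[i]^o).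
  by apply: cvg_real_complex; exact: exp_quotient_cvg.
have -> : f + c%:C *: x = 1%:C *: f + c%:C *: x by rewrite scale1r.
rewrite /generator.
rewrite (_ : (fun h => _) = (fun h => (expR (c * h))%:C *: (h^-1%:C *: (T h x - x)) +
    ((expR (c * h) - 1) / h)%:C *: x)).
  apply: cvgD; apply: cvgZ; [exact: e1|exact: xf|exact: e2|exact: cvg_cst].
apply/funext => h; rewrite /rescale !scalerBr !scalerA -!rmorphM /= -addrA.
congr (_ *: _ + _); first by congr (_%:C); rewrite mulrC.
rewrite -scaleNr -scaleNr -scalerDl -!rmorphN -rmorphD /=.
by congr (_%:C *: _); ring.
Qed.

Lemma rescale_C0 c T : C0_semigroup T -> C0_semigroup (rescale c T).
Proof.
move=> [Tb T0 TD Tc]; split.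
- move=> t t0; have [Tlin _] := Tb t t0; have [C C0 hC] := bounded_operator_le (Tb t t0).
  apply: (@bounded_operatorP _ _ _ (expR (c * t) ^+ 2 * C)).
    move=> k x y; rewrite /rescale Tlin scalerDr !scalerA; congr (_ *: _ + _).
    exact: mulrC.
  by move=> x; rewrite /rescale nsqZr -mulrA ler_wpM2l ?sqr_ge0.
- by apply/funext => x; rewrite /rescale mulr0 expR0 scale1r T0.
- move=> s t s0 t0; apply/funext => x; rewrite /rescale /= (TD s t)//=.
  have [Tlin _] := Tb s s0.
  by rewrite (linZ Tlin) scalerA mulrDr expRD rmorphM.
- move=> x.
  have e1 : ((expR (c * h))%:C : R[i]^o) @[h --> 0^'+] --> (1%:C : R[i]^o).
    by apply: cvg_real_complex; exact: expR_cvg1.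
  have x1 : x = 1%:C *: x by rewrite scale1r.
  rewrite [X in _ --> X]x1; apply: cvgZ; [exact: e1|exact: Tc].
Qed.

End SelfAdjointSemigroup.

(** * Resolvents and diagonalization *)

Section Resolvent.
Context {R : realType} {H : hilbertType R}.
Local Open Scope complex_scope.
Variables (om : R) (A : graph H) (Asa : sa_below om A).
Implicit Types (x y z f g : H) (c : R).

Let Alin (c : R[i]) x y f g : A x f -> A y g -> A (c *: x + y) (c *: f + g).
Proof. by case: Asa => h _ _ _ _; exact: h. Qed.

Lemma graphB x y f g : A x f -> A y g -> A (x - y) (f - g).
Proof. by move=> xf yg; have := Alin (-1) yg xf; rewrite !scaleN1r [- y + x]addrC [- g + f]addrC. Qed.

Lemma graph_eq c x y f g : c < om -> A x f -> A y g ->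
  f - c%:C *: x = g - c%:C *: y -> x = y.
Proof.
move=> com xf yg e; apply/eqP; rewrite -subr_eq0; apply/eqP.
have fg : f - g = c%:C *: (x - y).
  have -> : f = g - c%:C *: y + c%:C *: x by rewrite -e subrK.
  by rewrite scalerBr addrAC [g - _ - _]addrAC subrr add0r addrC.
case: Asa => _ _ low _ _; have := low _ _ (graphB xf yg); rewrite fg ripZl.
move=> h; apply: nsq_le0_eq0; have : (om - c) * nsq (x - y) <= 0 by rewrite mulrBl /nsq in h *; lra.
by rewrite pmulr_rle0// subr_gt0.
Qed.

Lemma resolvent_spec c x : c < om ->
  A (resolvent A c%:C x) (x + c%:C *: resolvent A c%:C x).
Proof.
move=> com; case: Asa => _ _ _ ex _; have [y hy] := ex c x com.
by rewrite /resolvent; case: xgetP => [z _//|/(_ y)].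
Qed.

Lemma resolvent_eq c x y : c < om -> A y (x + c%:C *: y) ->
  resolvent A c%:C x = y.
Proof.
move=> com hy; apply: (graph_eq com (resolvent_spec x com) hy).
by rewrite !addrK.
Qed.

Lemma resolvent_sym c : c < om -> symmetric_op (resolvent A c%:C).
Proof.
move=> com x y; case: Asa => _ sym _ _ _.
have := sym _ _ _ _ (resolvent_spec x com) (resolvent_spec y com).
by rewrite innerDl innerDr innerZl innerZrr => /addIr.
Qed.

Lemma resolvent_ge c x : c < om ->
  (om - c) * nsq (resolvent A c%:C x) <= rip x (resolvent A c%:C x).
Proof.
move=> com; case: Asa => _ _ low _ _; have := low _ _ (resolvent_spec x com).
by rewrite ripDl ripZl -/(nsq _); lra.
Qed.

Lemma resolvent_le c x : c < om ->
  (om - c) ^+ 2 * nsq (resolvent A c%:C x) <= nsq x.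
Proof.
move=> com; have := resolvent_ge x com; set y := resolvent _ _ _.
have d0 : 0 < om - c by rewrite subr_gt0.
have := rip_le x ((om - c)%:C *: y); rewrite ripZr nsqZr.
move=> h1 h2; have := ler_wpM2l (ltW d0) h2; rewrite expr2 in h1 *; lra.
Qed.

(** Then [A 0 x] holds, and symmetry makes [x] orthogonal to the dense domain. *)
Lemma resolvent_inj c x : c < om -> resolvent A c%:C x = 0 -> x = 0.
Proof.
move=> com K0; have := resolvent_spec x com; rewrite K0 scaler0 addr0 => A0x.
case: Asa => _ sym _ _ dom; apply: nsq_le0_eq0; apply/ler_addgt0Pr => e e0.
have [y [[g yg] xy]] := dom x e e0; rewrite add0r.
have xy0 : rip x y = 0 by rewrite /rip (sym _ _ _ _ A0x yg) inner0l.
by move: xy; rewrite nsqB xy0; have := nsq_ge0 y; lra.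
Qed.

(** The equivalence makes the domain maximal, so that the exponential built from [mu] is generated
    by [-A] itself and not by an extension of it. *)
Definition diagonal (F : set H) (mu : H -> R) := forall y g,
  A y g <-> forall f, F f -> inner g f = (mu f)%:C * inner y f.

Lemma resolvent_diagonal c (F : set H) : c < om -> orthonormal_basis F ->
  (forall f, F f -> resolvent A c%:C f = (rip (resolvent A c%:C f) f)%:C *: f) ->
  exists2 m : H -> R,
    (forall f, F f -> om - c <= m f /\ resolvent A c%:C f = (m f)^-1%:C *: f) &
    diagonal F (fun f => m f + c).
Proof.
move=> com FB FK; pose k f := rip (resolvent A c%:C f) f.
have d0 : 0 < om - c by rewrite subr_gt0.
have hk f : F f -> 0 < k f /\ (om - c) * k f <= 1.
  move=> Ff; have f1 := nsq1 (basis_orthonormal FB) Ff.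
  have := resolvent_ge f com; rewrite FK// nsqZr ripZr -/(nsq f) f1 !mulr1 -/(k f).
  have k0 : k f != 0.
    apply/eqP => k0; have /(resolvent_inj com) : resolvent A c%:C f = 0.
      by rewrite FK// -/(k f) k0 scale0r.
    by move=> f0; move: f1; rewrite f0 nsq0 => /eqP; rewrite eq_sym oner_eq0.
  move=> h; have kpos : 0 < k f.
    have : 0 < (om - c) * k f ^+ 2 by rewrite mulr_gt0// lt_def sqrf_eq0 k0 sqr_ge0.
    by move=> h'; exact: lt_le_trans h.
  by split=> //; move: h; rewrite expr2 mulrA ger_pMl.
exists (fun f => (k f)^-1).
  move=> f Ff; have [k0 k1] := hk f Ff; split; last by rewrite invrK FK.
  by rewrite -[leRHS]mul1r ler_pdivlMr.
have coord x f : F f -> inner (resolvent A c%:C x) f = (k f)%:C * inner x f.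
  by move=> Ff; rewrite (resolvent_sym com) FK// innerZrr.
move=> y g; split=> [yg f Ff|h].
  have [k0 _] := hk f Ff; have kn0 : (k f)%:C != 0 :> R[i].
    by rewrite (inj_eq (@complexI R) _ 0) gt_eqF.
  have Ky : resolvent A c%:C (g - c%:C *: y) = y.
    by apply: resolvent_eq => //; rewrite subrK.
  have := coord (g - c%:C *: y) f Ff; rewrite Ky innerBl innerZl => e.
  have e2 : inner g f - c%:C * inner y f = (k f)^-1%:C * inner y f.
    by apply: (mulfI kn0); rewrite -e mulrA -rmorphM/= divff ?gt_eqF// mul1r.
  by rewrite rmorphD mulrDl -e2 subrK.
pose y' := resolvent A c%:C (g - c%:C *: y); have := resolvent_spec (g - c%:C *: y) com.
rewrite -/y' (_ : y = y') ?subrK//.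
apply: (basis_eq FB) => f Ff; have [k0 _] := hk f Ff.
rewrite /y' coord// innerBl innerZl h// rmorphD mulrDl addrK mulrA -rmorphM/=.
by rewrite divff ?gt_eqF// mul1r.
Qed.

End Resolvent.

(** * The semigroup of a diagonal operator *)

Section DiagonalSemigroup.
Context {R : realType} {H : hilbertType R}.
Local Open Scope complex_scope.
Variables (om : R) (A : graph H) (Asa : sa_below om A).
Variables (F : set H) (FB : orthonormal_basis F) (mu : H -> R).
Hypotheses (Adiag : diagonal A F mu) (mu_om : forall f, F f -> om <= mu f).

Definition exp_mult (t : R) : H -> H := mult F (fun f => expR (- (t * mu f))).

Lemma exp_bounded_on t : 0 <= t ->
  bounded_on F (fun f => expR (- (t * mu f))) (expR (- (t * om)) ^+ 2).
Proof.
move=> t0 f Ff; rewrite ler_sqr ?nnegrE ?expR_ge0// ler_expR lerN2.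
by rewrite ler_wpM2l// mu_om.
Qed.

Let exp_bounded_on1 t : 0 <= t -> t <= 1 ->
  bounded_on F (fun f => expR (- (t * mu f))) (expR `|om| ^+ 2).
Proof.
move=> t0 t1 f Ff; apply: le_trans (exp_bounded_on t0 Ff) _.
rewrite ler_sqr ?nnegrE ?expR_ge0// ler_expR -mulrN.
apply: (@le_trans _ _ (t * `|om|)); first by rewrite ler_wpM2l// -normrN ler_norm.
by rewrite ler_piMl.
Qed.

Lemma near_right_lt (d : R) : 0 < d -> \forall h \near (0 : R)^'+, 0 < h /\ h < d.
Proof. by move=> d0; apply/near_right0; exists d. Qed.

Lemma exp_mult_C0 : C0_semigroup exp_mult.
Proof.
split.
- move=> t t0; apply: (mult_bounded FB (exp_bounded_on t0)); exact: sqr_ge0.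
- apply/funext => x; apply: (mult_eq FB (exp_bounded_on (lexx 0))) => f Ff.
  by rewrite mul0r oppr0 expR0 mul1r.
- move=> s t s0 t0; apply/funext => x; have st0 : 0 <= s + t by rewrite addr_ge0.
  apply: (mult_eq FB (exp_bounded_on st0)) => f Ff.
  rewrite /= (inner_mult FB _ (exp_bounded_on s0) Ff).
  rewrite (inner_mult FB _ (exp_bounded_on t0) Ff).
  by rewrite mulrDl opprD expRD rmorphM mulrA.
- move=> x; have bc1 : bounded_on F (fun=> 1) (expR `|om| ^+ 2).
    by move=> f Ff; rewrite expr1n exprn_ege1// -expR0 ler_expR.
  rewrite [X in _ --> X](_ : x = mult F (fun=> 1) x); last first.
    by apply/esym/(mult_eq FB bc1) => f Ff; rewrite mul1r.
  apply: (mult_cvg FB (C := expR `|om| ^+ 2)) => //.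
    by apply: filterS (near_right_lt ltr01) => h [h0 h1]; apply: exp_bounded_on1; exact: ltW.
  move=> f Ff; under eq_fun do rewrite mulrC -mulNr; exact: expR_cvg1.
Qed.

Lemma expRB1_le (u E : R) : expR u <= E -> 1 <= E -> `|expR u - 1| <= `|u| * E.
Proof.
move=> uE E1; have h1 := expR_ge1Dx u; have h2 := expR_ge1Dx (- u).
have h3 : expR u * (1 - u) <= 1.
  by rewrite -[leRHS](expRxMexpNx_1 u) ler_pM2l ?expR_gt0.
have [u0|u0] := leP 0 u.
  have := ler_wpM2l u0 uE; rewrite (ger0_norm u0).
  by rewrite ger0_norm; lra.
have e1 : expR u <= 1 by rewrite -expR0 ler_expR ltW.
rewrite (ltr0_norm u0) ler0_norm; last lra.
have : - u * 1 <= - u * E by rewrite ler_wpM2l// oppr_ge0 ltW.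
by lra.
Qed.

(** If the difference quotient converges, so does each coordinate, and [diagonal] identifies the
    limit. Conversely, a domain vector is written [x = (A - c)^-1 z]; the quotient acts on the fixed
    vector [z] by the symbols [phi h], in which division by [mu - c] compensates the growth in
    [mu]. *)
Lemma generates_exp_mult : generates (opp_graph A) exp_mult.
Proof.
split; first exact: exp_mult_C0.
move=> x g; split=> [gxg|].
  apply/Adiag => f Ff; apply/eqP; rewrite -subr_eq0; apply/eqP.
  rewrite innerNl; apply: (c2_small (C := 2 + 2 * c2 (inner x f))) => e e0.
  have f1 := nsq1 (basis_orthonormal FB) Ff.
  have se0 : 0 < Num.sqrt e by rewrite sqrtr_gt0.
  have /cvgrPdist_lt/(_ _ se0) q := @exp_quotient_cvg R (- mu f).
  move: gxg => /(cvgH _ _).1/(_ _ e0) gg.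
  have [h [[h0 _] [/ltW hg /ltW hq]]] :=
    filter_ex (filterI (near_right_lt ltr01) (filterI gg q)).
  set w := h^-1%:C *: _ in hg.
  have wf : inner w f = ((expR (- mu f * h) - 1) / h)%:C * inner x f.
    rewrite /w innerZl innerBl (inner_mult FB _ (exp_bounded_on (ltW h0)) Ff).
    by rewrite !rmorphM rmorphB/= mulNr [mu f * h]mulrC; ring.
  rewrite (_ : _ - _ = inner (w - g) f +
     ((- mu f - (expR (- mu f * h) - 1) / h))%:C * inner x f); last first.
    by rewrite innerBl wf [in RHS]rmorphB rmorphN; ring.
  rewrite (le_trans (c2D_le _ _))// c2M c2_real.
  have h1 : c2 (inner (w - g) f) <= e.
    by rewrite (le_trans (inner_c2_le _ _))// f1 mulr1.
  have h2 : (- mu f - (expR (- mu f * h) - 1) / h) ^+ 2 <= e.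
    rewrite -(real_normK (num_real _)) -[leRHS](sqr_sqrtr (ltW e0)).
    by rewrite ler_sqr ?nnegrE ?sqrtr_ge0.
  have := ler_wpM2r (c2_ge0 (inner x f)) h2; lra.
move=> xg; rewrite /generator.
have [c com] : exists c, c < om by exists (om - 1); rewrite gtrBl.
have c0 : 0 < om - c by rewrite subr_gt0.
pose z := - g - c%:C *: x.
have kpos f : F f -> 0 < mu f - c.
  by move=> Ff; rewrite subr_gt0 (lt_le_trans com)// mu_om.
have gf f : F f -> inner g f = - (mu f)%:C * inner x f.
  by move=> Ff; have /(Adiag _ _).1/(_ _ Ff) := xg; rewrite innerNl mulNr => <-; rewrite opprK.
have zf f : F f -> inner x f = (mu f - c)^-1%:C * inner z f.
  move=> Ff; rewrite /z innerBl innerNl innerZl gf// mulNr opprK -mulrBl.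
  rewrite -rmorphB mulrA -rmorphM/= mulVf ?mul1r// gt_eqF//.
  exact: kpos.
pose E := expR `|om|; have E1 : 1 <= E by rewrite -expR0 ler_expR.
have E0 : 0 < E by apply: lt_le_trans E1.
pose phi h f := (expR (- mu f * h) - 1) / h * (mu f - c)^-1.
pose psi f := - mu f * (mu f - c)^-1.
pose D := 1 + `|c| / (om - c).
have D0 : 0 <= D by rewrite addr_ge0// divr_ge0// ltW.
have psiD f : F f -> `|psi f| <= D.
  move=> Ff; have k0 := kpos f Ff.
  have -> : psi f = - (1 + c / (mu f - c)).
    by rewrite /psi; field; rewrite gt_eqF.
  rewrite normrN (le_trans (ler_normD _ _))// normr1 lerD2l normrM.
  rewrite ler_wpM2l// gtr0_norm ?invr_gt0// lef_pV2 ?posrE//.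
  by rewrite lerD2r mu_om.
have sqle (a b : R) : `|a| <= b -> a ^+ 2 <= b ^+ 2.
  move=> ab; rewrite -(real_normK (num_real a)) ler_sqr ?nnegrE//.
  exact: le_trans ab.
have psiB : bounded_on F psi ((D * E) ^+ 2).
  move=> f Ff; apply: sqle; rewrite (le_trans (psiD f Ff))//.
  by rewrite -[leLHS]mulr1 ler_wpM2l.
have phiB h : 0 < h -> h < 1 -> bounded_on F (phi h) ((D * E) ^+ 2).
  move=> h0 h1 f Ff; apply: sqle; have k0 := kpos f Ff.
  have uE : expR (- mu f * h) <= E.
    have := exp_bounded_on1 (ltW h0) (ltW h1) Ff.
    by rewrite mulNr mulrC ler_sqr ?nnegrE ?expR_ge0.
  have b := expRB1_le uE E1.
  have -> : phi h f = (expR (- mu f * h) - 1) * (h^-1 * (mu f - c)^-1) by rewrite /phi mulrA.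
  rewrite normrM [X in _ * X]gtr0_norm ?mulr_gt0 ?invr_gt0//.
  apply: (@le_trans _ _ (`|- mu f * h| * E * (h^-1 * (mu f - c)^-1))).
    by rewrite ler_wpM2r// mulr_ge0 ?invr_ge0 ?ltW.
  rewrite normrM (gtr0_norm h0).
  have -> : `|- mu f| * h * E * (h^-1 * (mu f - c)^-1) = `|psi f| * E.
    rewrite /psi normrM [X in _ = _ * X * _]gtr0_norm ?invr_gt0//.
    by field; rewrite !gt_eqF.
  by rewrite ler_wpM2r ?psiD// ltW.
rewrite [X in _ --> X](_ : g = mult F psi z); last first.
  apply/esym/(mult_eq FB psiB) => f Ff.
  by rewrite gf// zf// mulrA -rmorphN -rmorphM.
suff cv : mult F (phi h) z @[h --> 0^'+] --> mult F psi z.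
  apply: cvg_trans cv; apply: near_eq_cvg; near=> h.
  have [h0 h1] : 0 < h /\ h < 1 by near: h; exact: near_right_lt.
  apply: (mult_eq FB (phiB h h0 h1)) => f Ff.
  rewrite innerZl innerBl (inner_mult FB _ (exp_bounded_on (ltW h0)) Ff) zf//.
  rewrite /phi !rmorphM rmorphB/= mulNr [mu f * h]mulrC; ring.
apply: (mult_cvg FB (C := (D * E) ^+ 2)) => //; first exact: sqr_ge0.
  by apply: filterS (near_right_lt ltr01) => h [h0 h1]; exact: phiB.
move=> f Ff; apply: cvgM; [exact: exp_quotient_cvg|exact: cvg_cst].
Unshelve. all: by end_near. Qed.

Lemma generates_sym T : generates (opp_graph A) T -> symmetric_graph (generator T).
Proof.
move=> [_ TA] x f y g /TA xf /TA yg; case: Asa => _ sym _ _ _.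
have := sym _ _ _ _ xf yg; rewrite innerNl innerNr => /oppr_inj.
by rewrite /rip => ->.
Qed.

Lemma generates_dense T : generates (opp_graph A) T -> dense_dom (generator T).
Proof.
move=> [_ TA] x d d0; case: Asa => _ _ _ _ dom; have [y [[f yf] xy]] := dom x d d0.
by exists y; split=> //; exists (- f); apply/TA; rewrite /opp_graph opprK.
Qed.

(** [exp_opp] is picked by choice: [generates_exp_mult] excludes its default value, and
    [semigroup_unique] makes the choice immaterial on [t >= 0]. *)
Lemma exp_oppE t : 0 <= t -> exp_opp A t = exp_mult t.
Proof.
move=> t0; rewrite /exp_opp; case: xgetP => [T _ TA|/(_ exp_mult)]; last first.
  by move=> /(_ generates_exp_mult).
apply: (semigroup_unique _ (generates_sym TA) (generates_dense TA)) => //.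
- by case: TA.
- exact: exp_mult_C0.
- move=> x f; have [_ h1] := TA; have [_ h2] := generates_exp_mult.
  exact: (iff_trans (h1 x f) (iff_sym (h2 x f))).
Qed.

End DiagonalSemigroup.

(** * Hilbert-Schmidt bounds and trace norms *)

Section HilbertSchmidt.
Context {R : realType} {H : hilbertType R}.
Implicit Types (E F : set H) (S X Y P D : H -> H) (C : R) (G : {fset H}).
Local Open Scope complex_scope.

(* The square of the Hilbert-Schmidt norm of [S], computed in [E], is at most [C]. *)
Definition hs_le E S C := forall G, fin_in G E -> \sum_(e <- G) nsq (S e) <= C.

(** Spreads a total error [d] over the terms; the successor keeps the divisor nonzero for an empty
    list. *)
Lemma sum_frac_le (s : seq H) (d : R) : 0 <= d ->
  \sum_(e <- s) d / (size s).+1%:R <= d.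
Proof.
move=> d0; have -> : forall c : R, \sum_(e <- s) c = c * (size s)%:R.
  by move=> c; elim: s => [|e s IH]; rewrite ?big_nil ?mulr0// big_cons IH -natr1; ring.
by rewrite mulrAC ler_pdivrMr ?ltr0n// ler_wpM2l// ler_nat.
Qed.

Lemma hs_le_ge0 E S C : hs_le E S C -> 0 <= C.
Proof. by move=> /(_ fset0); rewrite big_seq_fset0; apply; exact: fin_in0. Qed.

Lemma proj_fin F (s : seq H) (d : R) : orthonormal_basis F -> 0 < d ->
  exists2 G, fin_in G F & forall x, x \in s -> nsq (x - proj G x) <= d.
Proof.
move=> FB d0; have FO := basis_orthonormal FB.
elim: s => [|y s [G GF hG]]; first by exists fset0 => //; exact: fin_in0.
have [G' [G'F hG']] := proj_cvg y FB d0.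
have GU := fin_inU GF G'F; exists (G `|` G')%fset => // x.
rewrite inE => /predU1P[->|/hG xs].
  apply: le_trans hG'; rewrite !(nsqB_proj y FO)// lerD2l lerN2.
  by apply: fsum_le => [e|]; [exact: c2_ge0|exact: fsubsetUr].
apply: le_trans xs; rewrite !(nsqB_proj x FO)// lerD2l lerN2.
by apply: fsum_le => [e|]; [exact: c2_ge0|exact: fsubsetUl].
Qed.

(** Both sides compare with the double sum of [|<S e, f>|^2]: Parseval in [E] for [S' f], Bessel in
    [F] for [S e]. This covers adjoints and changes of basis together. *)
Lemma hs_transfer E F S S' C : orthonormal_basis E -> orthonormal_set F ->
  (forall x y, inner (S x) y = inner x (S' y)) -> hs_le E S C -> hs_le F S' C.
Proof.
move=> EB FO adj hS G GF; have EO := basis_orthonormal EB.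
apply/ler_addgt0Pr => d d0; pose n : R := (size G).+1%:R.
have n0 : 0 < n by rewrite ltr0n.
have [G' G'E hG'] := proj_fin [seq S' f | f <- G] EB (divr_gt0 d0 n0).
apply: (@le_trans _ _ (\sum_(f <- G) (\sum_(e <- G') c2 (inner (S e) f) + d / n))).
  rewrite big_seq [leRHS]big_seq; apply: ler_sum => f fG.
  have := hG' (S' f) (map_f _ fG); rewrite (nsqB_proj _ EO)//.
  under [X in _ -> _ <= X + _]eq_bigr do rewrite adj innerC c2J.
  by rewrite lerBlDr addrC.
rewrite big_split/= exchange_big/=; apply: lerD.
  apply: le_trans (hS G' G'E); apply: ler_sum => e _; exact: (bessel _ FO GF).
by apply: sum_frac_le; exact: ltW.
Qed.

Lemma hs_le_sym E F S C : orthonormal_basis E -> orthonormal_set F ->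
  symmetric_op S -> hs_le E S C -> hs_le F S C.
Proof. by move=> EB FO sS; exact: (hs_transfer EB FO sS). Qed.

Lemma hs_leB E S S' C C' : hs_le E S C -> hs_le E S' C' ->
  hs_le E (fun x => S x - S' x) (2 * C + 2 * C').
Proof.
move=> hS hS' G GE; apply: le_trans (lerD (ler_wpM2l _ (hS G GE)) (ler_wpM2l _ (hS' G GE))) => //.
by rewrite !mulr_sumr -big_split/=; apply: ler_sum => e _; exact: nsqB_le.
Qed.

Lemma hs_leD E S S' C C' : hs_le E S C -> hs_le E S' C' ->
  hs_le E (fun x => S x + S' x) (2 * C + 2 * C').
Proof.
move=> hS hS' G GE; apply: le_trans (lerD (ler_wpM2l _ (hS G GE)) (ler_wpM2l _ (hS' G GE))) => //.
by rewrite !mulr_sumr -big_split/=; apply: ler_sum => e _; exact: nsqD_le.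
Qed.

Lemma hs_le_comp E S S' C (M : R) : 0 <= M -> (forall x, nsq (S' x) <= M * nsq x) ->
  hs_le E S C -> hs_le E (S' \o S) (M * C).
Proof.
move=> M0 hM hS G GE; apply: le_trans (ler_wpM2l M0 (hS G GE)).
by rewrite mulr_sumr; apply: ler_sum => e _; exact: hM.
Qed.

Lemma hs_tail E S C (d : R) : hs_le E S C -> 0 < d -> exists2 G, fin_in G E &
  forall G', fin_in G' E -> (G `<=` G')%fset ->
    \sum_(e <- G' | e \notin G) nsq (S e) <= d.
Proof.
move=> hS d0; pose s G := \sum_(e <- G) nsq (S e).
pose A := [set s G | G in [set G | fin_in G E]].
have supA : has_sup A.
  split; first by exists (s fset0), fset0 => //; exact: fin_in0.
  by exists C => _ [G GE <-]; exact: hS.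
have [_ [G GE <-] hG] := sup_adherent d0 supA; exists G => // G' G'E GG'.
have := fsumID (fun e => nsq (S e)) GG'; rewrite -/(s _) -/(s _).
have : s G' <= sup A by apply: sup_upper_bound => //; exists G'.
by lra.
Qed.

(** Outside a finite set carrying all but [d] of the Hilbert-Schmidt sum, the coordinates
    [<S x, e> = <x, S e>] contribute at most [d |x|^2] by Cauchy-Schwarz. *)
Lemma hs_approx E S C (d : R) : orthonormal_basis E -> symmetric_op S ->
  hs_le E S C -> 0 < d -> exists2 G, fin_in G E &
  forall x, nsq (S x) <= d * nsq x + \sum_(e <- G) c2 (inner x (S e)).
Proof.
move=> EB sS hS d0; have [G GE hG] := hs_tail hS d0; exists G => // x.
apply/ler_addgt0Pr => d' d'0; have [G1 [G1E h1]] := parseval (S x) EB d'0.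
have GU := fin_inU G1E GE.
apply: (le_trans h1); rewrite lerD2r.
apply: (@le_trans _ _ (\sum_(e <- (G1 `|` G)%fset) c2 (inner (S x) e))).
  by apply: fsum_le => [e|]; [exact: c2_ge0|exact: fsubsetUl].
rewrite (fsumID _ (fsubsetUr G1 G)) addrC; apply: lerD; last first.
  by apply: ler_sum => e _; rewrite sS.
apply: (@le_trans _ _ (nsq x * d)); last by rewrite mulrC.
apply: le_trans (ler_wpM2l (nsq_ge0 x) (hG _ GU (fsubsetUr _ _))).
by rewrite mulr_sumr; apply: ler_sum => e _; rewrite sS inner_c2_le.
Qed.

Lemma hs_compact E S C : orthonormal_basis E -> symmetric_op S ->
  hs_le E S C -> compact_op S.
Proof.
move=> EB sS hS d d0; have [G GE hG] := hs_approx EB sS hS d0.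
by exists [seq S e | e <- G] => x; rewrite big_map.
Qed.

Section Abs.
Variables (D P : H -> H) (DP : is_abs_operator D P).

Let Plin : linear P. Proof. by case: DP => [[]]. Qed.

Let Ppos x : 0 <= rip (P x) x.
Proof. by case: DP => _ /(_ x) + _; rewrite lecE => /andP[_]. Qed.

(** The quadratic form of [P] is real; polarization, with reality at [x + i y], makes [P]
    symmetric. *)
Lemma abs_operator_sym : symmetric_op P.
Proof.
have Im0 x : complex.Im (inner (P x) x) = 0.
  by case: DP => _ /(_ x) + _; rewrite lecE => /andP[/eqP].
apply: rip_symmetric_op => // x y; rewrite [RHS]ripC.
have := Im0 (x + 'i%C *: y).
rewrite (linD Plin) (linZ Plin) !innerDl !innerDr !innerZl !innerZr.
have := Im0 x; have := Im0 y; rewrite /rip.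
case: (inner (P x) x) => ? ?; case: (inner (P y) y) => ? ?.
case: (inner (P x) y) => ? ?; case: (inner (P y) x) => ? ? /=.
move=> -> ->; rewrite !(mul0r, mulr0, mul1r, subr0, sub0r, add0r, addr0, oppr0, mulN1r).
by lra.
Qed.

(** [P^2 f = d^2 f], so [w = P f - |d| f] is annihilated by [P + |d|], which is positive definite
    for nonzero [d]. *)
Lemma abs_operator_eigen f (d : R) : symmetric_op D ->
  D f = d%:C *: f -> P f = `|d|%:C *: f.
Proof.
move=> Dsym Df; have Dlin := symmetric_op_linear Dsym.
have PP : P (P f) = (d ^+ 2)%:C *: f.
  apply: inner_eq => z; case: DP => _ _ ->.
  by rewrite -Dsym Df (linZ Dlin) Df scalerA -rmorphM.
have [d0|d0] := eqVneq d 0.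
  rewrite d0 normr0 scale0r; apply: nsq_le0_eq0.
  by rewrite /nsq -(symmetric_rip _ _ abs_operator_sym) PP d0 expr0n scale0r /rip inner0l.
apply/eqP; rewrite -subr_eq0; apply/eqP; set w := _ - _.
have w0 : P w + `|d|%:C *: w = 0.
  rewrite /w (linB Plin) PP (linZ Plin) scalerBr scalerA -rmorphM/=.
  rewrite -normrM -expr2 ger0_norm ?sqr_ge0//.
  by rewrite addrA subrK subrr.
have : rip (P w) w + `|d| * nsq w = 0.
  by rewrite -ripZl -ripDl w0 /rip inner0l.
have a0 : 0 < `|d| by rewrite normr_gt0.
move=> h; apply: nsq_le0_eq0; rewrite -(pmulr_rle0 _ a0); have := Ppos w; lra.
Qed.

(** Each [e] is split into a projection onto finitely many eigenvectors of [D] and a remainder [r].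
    [P] is diagonal on those eigenvectors, so the cross terms vanish, and [<P r, r>] is small
    because [P] is bounded. *)
Lemma abs_operator_sum_le E F (C : R) : orthonormal_set E ->
  orthonormal_basis F -> symmetric_op D ->
  (forall f, F f -> D f = (rip (D f) f)%:C *: f) ->
  (forall G, fin_in G F -> \sum_(f <- G) `|rip (D f) f| <= C) ->
  forall G, fin_in G E -> \sum_(e <- G) rip (P e) e <= C.
Proof.
move=> EO FB Dsym FD hC G GE; have FO := basis_orthonormal FB.
have [M M0 PM] : exists2 M : R, 0 < M & forall x, nsq (P x) <= M * nsq x.
  by apply: bounded_operator_le; case: DP.
have Psym := abs_operator_sym.
apply/ler_addgt0Pr => d d0; pose n : R := (size G).+1%:R * (M + 1).
have n0 : 0 < n by rewrite mulr_gt0// ltr_wpDl// ltW.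
have [G' G'F hG'] := proj_fin G FB (divr_gt0 d0 n0).
have Pproj x f : F f -> inner (P x) f = `|rip (D f) f|%:C * inner x f.
  by move=> Ff; rewrite Psym (abs_operator_eigen Dsym (FD f Ff)) innerZrr.
have split1 e : rip (P e) e = \sum_(f <- G') `|rip (D f) f| * c2 (inner e f) +
    rip (P (e - proj G' e)) (e - proj G' e).
  set r := e - proj G' e.
  have r0 f : f \in G' -> inner r f = 0.
    move=> fG'; have Ff := G'F _ fG'.
    by rewrite innerBl (inner_proj e FO G'F Ff) fG' subrr.
  have -> : rip (P r) r = rip (P r) e.
    rewrite {2}/r ripBr [X in _ - X](_ : _ = 0) ?subr0//.
    rewrite /rip /proj inner_sumr Re_sum big_seq big1// => f fG'.
    by rewrite innerZr Pproj ?r0 ?mulr0//; exact: G'F.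
  rewrite /r (linB Plin) ripBl addrCA [X in _ = _ + X](_ : _ = 0) ?addr0//.
  rewrite (symmetric_rip _ _ Psym) ripC /rip /proj inner_sumr Re_sum -sumrB.
  rewrite big_seq big1// => f fG'; rewrite innerZr Pproj; last exact: G'F.
  by rewrite mulrCA ReZ [_^* * _]mulrC mulcJ /= subrr.
apply: (@le_trans _ _ (\sum_(e <- G)
  (\sum_(f <- G') `|rip (D f) f| * c2 (inner e f) + d / (size G).+1%:R))).
  rewrite big_seq [leRHS]big_seq; apply: ler_sum => e eG; rewrite split1 lerD2l.
  have h1 := hG' e eG; set r := e - _ in h1 *.
  have h2 := rip_le (P r) r; have h3 := PM r.
  have M10 : 0 < M + 1 by rewrite ltr_wpDl// ltW.
  have h4 : (M + 1) * nsq r <= d / (size G).+1%:R.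
    apply: le_trans (ler_wpM2l (ltW M10) h1) _.
    rewrite le_eqVlt; apply/orP; left; apply/eqP; rewrite /n.
    by field; rewrite !gt_eqF// ltr_pwDl// ler0n.
  have h5 := mulr_ge0 (ltW M10) (nsq_ge0 r).
  by move: h4; set q := d / _; lra.
rewrite big_split/= exchange_big/=; apply: lerD.
  apply: le_trans (hC G' G'F); rewrite big_seq [leRHS]big_seq; apply: ler_sum => f fG'.
  rewrite -mulr_sumr -[leRHS]mulr1 ler_wpM2l//.
  rewrite -(nsq1 FO (G'F _ fG')); apply: le_trans (bessel f EO GE).
  by apply: ler_sum => e _; rewrite innerC c2J.
by apply: sum_frac_le; exact: ltW.
Qed.

(** When [<P z, z> <= K |z|^2], positivity of [P] at [x - K^-1 P x] gives [|P x|^2 <= K <P x, x>],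
    and [|D x| = |P x|]. Summation over a basis turns a finite trace norm into a Hilbert-Schmidt
    bound. *)
Lemma abs_operator_hs : exists2 K : R, 0 < K & forall x, nsq (D x) <= K * rip (P x) x.
Proof.
have [M M0 PM] : exists2 M : R, 0 < M & forall x, nsq (P x) <= M * nsq x.
  by apply: bounded_operator_le; case: DP.
have Psym := abs_operator_sym; pose K := (M + 1) / 2.
have K0 : 0 < K by rewrite divr_gt0// ltr_wpDl// ltW.
exists K => // x.
have -> : nsq (D x) = nsq (P x).
  by rewrite /nsq -(symmetric_rip _ _ Psym) /rip; case: DP => _ _ ->.
have := Ppos (x - K^-1%:C *: P x).
rewrite (linB Plin) (linZ Plin) !ripE.
have h1 := rip_le (P (P x)) (P x); have h2 := PM (P x).
have h3 : rip (P (P x)) (P x) <= K * nsq (P x) by rewrite /K; lra.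
have h4 : rip (P (P x)) x = nsq (P x) by rewrite (symmetric_rip _ _ Psym).
rewrite h4 -/(nsq (P x)) => h.
have Ki0 : 0 < K^-1 by rewrite invr_gt0.
have h6 := ler_wpM2l (ltW Ki0) (ler_wpM2l (ltW Ki0) h3).
have h7 : K^-1 * (K * nsq (P x)) = nsq (P x) by rewrite mulKf// gt_eqF.
rewrite h7 in h6.
have h8 : K^-1 * nsq (P x) <= rip (P x) x by rewrite /nsq in h h6 *; lra.
by have := ler_wpM2l (ltW K0) h8; rewrite mulVKf// gt_eqF.
Qed.

End Abs.

End HilbertSchmidt.

(** * Trace norms of differences of squares *)

Section TraceNorm.
Context {R : realType} {H : hilbertType R}.
Implicit Types (E F : set H) (S X Y P D : H -> H) (C : R) (G : {fset H}).
Local Open Scope complex_scope.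

(* The basis in which [pos_trace] computes traces. *)
Definition trace_basis : set H := xget (set0 : set H) [set E | orthonormal_basis E].

Lemma trace_basisP : orthonormal_basis trace_basis.
Proof.
have [||F FB _] := @spectral_basis R H (fun=> 0).
- by move=> x y; rewrite inner0l inner0r.
- move=> e e0; exists [::] => x; rewrite big_nil nsq0 addr0.
  by rewrite mulr_ge0 ?nsq_ge0// ltW.
by rewrite /trace_basis; case: xgetP => [E _ //|/(_ F)].
Qed.

Lemma pos_trace_le P C :
  (forall G, fin_in G trace_basis -> \sum_(e <- G) rip (P e) e <= C) ->
  (pos_trace P <= C%:E)%E.
Proof.
move=> hC; apply: ub_ereal_sup => _ [A [finA AE] <-].
rewrite fsbig_finite// sumEFin lee_fin; apply: hC => e.
by rewrite in_fset_set// inE => /AE.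
Qed.

Lemma pos_trace_ge P G : fin_in G trace_basis ->
  ((\sum_(e <- G) rip (P e) e)%:E <= pos_trace P)%E.
Proof.
move=> GE; apply: esum_ge; exists [set` G].
  by split; [exact: finite_seq|move=> e; exact: GE].
rewrite fsbig_finite//.
by rewrite set_fsetK sumEFin.
Qed.

Lemma pos_trace_fin P : (pos_trace P < +oo)%E ->
  exists C, forall G, fin_in G trace_basis -> \sum_(e <- G) rip (P e) e <= C.
Proof.
move=> fin; exists (fine (pos_trace P)) => G GE.
have := pos_trace_ge P GE; have := pos_trace_ge P (@fin_in0 _ _ trace_basis).
move: fin; case: (pos_trace P) => //= r _ _.
Qed.

Lemma trace_norm_ge0 D : (0 <= trace_norm D)%E.
Proof.
rewrite /trace_norm; apply: esum_ge0 => e _; rewrite lee_fin.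
rewrite /abs_operator; case: xgetP => [P _ [_ /(_ e) + _]|_].
  by rewrite lecE => /andP[].
by rewrite inner0l.
Qed.

(** At a normalized eigenvector [f] of the difference [D], the eigenvalue is
    [Re <(X - Y) f, (X + Y) f>], because [<X f, Y f>] and [<Y f, X f>] have the same real part. The
    weighted inequality [2 |Re <u, v>| <= d^-1 |u|^2 + d |v|^2] is then summed over eigenvectors. *)
Lemma trace_norm_le X Y (a b d Cx Cy : R) : symmetric_op X -> symmetric_op Y ->
  bounded_operator X -> bounded_operator Y ->
  hs_le trace_basis X Cx -> hs_le trace_basis Y Cy ->
  hs_le trace_basis (fun x => X x - Y x) a ->
  hs_le trace_basis (fun x => X x + Y x) b -> 0 < d ->
  (trace_norm (fun x => (X (X x) - Y (Y x))%R) <= ((d^-1 * a + d * b) / 2)%R%:E)%E.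
Proof.
move=> sX sY bX bY hX hY ha hb d0; set D := fun x => _.
have EB := trace_basisP; have EO := basis_orthonormal EB.
have a0 := hs_le_ge0 ha; have b0 := hs_le_ge0 hb.
have sD : symmetric_op D by apply: symmetric_opB => x y; rewrite ?sX ?sY.
have [Mx Mx0 hMx] := bounded_operator_le bX.
have [My My0 hMy] := bounded_operator_le bY.
have hD := hs_leB (hs_le_comp (ltW Mx0) hMx hX) (hs_le_comp (ltW My0) hMy hY).
have [F FB FD] := spectral_basis sD (hs_compact EB sD hD).
have FO := basis_orthonormal FB.
have ssum : symmetric_op (fun x => X x + Y x).
  by move=> x y; rewrite innerDl innerDr sX sY.
have ha' := hs_le_sym EB FO (symmetric_opB sX sY) ha.
have hb' := hs_le_sym EB FO ssum hb.
(* The default branch of [xget] is the zero map, whose trace is below the nonnegative bound. *)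
rewrite /trace_norm /abs_operator; case: xgetP => [P _ DP|_]; last first.
  apply: pos_trace_le => G _; rewrite big1 => [|e _]; last by rewrite /rip inner0l.
  by rewrite divr_ge0// addr_ge0// mulr_ge0// ?invr_ge0 ltW.
apply: pos_trace_le; apply: (abs_operator_sum_le DP EO FB sD FD) => G GF.
apply: (@le_trans _ _ ((d^-1 * (\sum_(e <- G) nsq (X e - Y e)) +
   d * (\sum_(e <- G) nsq (X e + Y e))) / 2)).
  rewrite mulr_sumr mulr_sumr -big_split/= mulr_suml; apply: ler_sum => f _.
  have -> : rip (D f) f = rip (X f - Y f) (X f + Y f).
    rewrite /D ripBl (symmetric_rip (X f) f sX) (symmetric_rip (Y f) f sY).
    by rewrite !ripE (ripC (Y f)); ring.
  set u := X f - Y f; set v := X f + Y f.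
  have h1 := nsq_ge0 (u - d%:C *: v); have h2 := nsq_ge0 (u + d%:C *: v).
  rewrite nsqB nsqZr ripZr in h1; rewrite nsqD nsqZr ripZr in h2.
  have di0 : 0 < d^-1 by rewrite invr_gt0.
  have e1 : d^-1 * (d ^+ 2 * nsq v) = d * nsq v by field; rewrite gt_eqF.
  have e2 : d^-1 * (2 * (d * rip u v)) = 2 * rip u v by field; rewrite gt_eqF.
  have k1 := ler_wpM2l (ltW di0) h1; have k2 := ler_wpM2l (ltW di0) h2.
  rewrite mulr0 in k1 k2.
  by rewrite ler_norml; apply/andP; split; lra.
rewrite ler_pM2r ?invr_gt0//; apply: lerD; rewrite ler_pM2l ?invr_gt0//.
  exact: ha'.
exact: hb'.
Qed.

Lemma trace_class_hs S : symmetric_op S -> (forall x, 0 <= rip (S x) x) ->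
  trace_class S -> exists C, hs_le trace_basis S C.
Proof.
move=> sS posS [bS]; rewrite /trace_norm /abs_operator.
(* A positive [S] is its own absolute value, which excludes the default branch. *)
case: xgetP => [P _ SP|/(_ S)]; last first.
  case; split=> [||x y]; [exact: bS| |exact: sS].
  move=> x; rewrite lecE posS andbT; apply/eqP.
  have := innerC (S x) x; rewrite -sS; case: (inner (S x) x) => p q /= [].
  by move=> h; lra.
move=> /pos_trace_fin[C hC]; have [K K0 hK] := abs_operator_hs SP.
exists (K * C) => G GE; apply: le_trans (ler_wpM2l (ltW K0) (hC G GE)).
by rewrite mulr_sumr; apply: ler_sum => e _; exact: hK.
Qed.

End TraceNorm.

(** * Operators dominating the generator of a Gibbs semigroup *)

Section Domination.
Context {R : realType} {H : hilbertType R}.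
Implicit Types (F : set H) (K : H -> H) (C : R) (G : {fset H}).
Local Open Scope complex_scope.
Local Notation E := (@trace_basis R H).

Definition hs_contraction_semigroup (T : R -> H -> H) : Prop :=
  [/\ forall t, 0 <= t -> symmetric_op (T t),
      forall t x, 0 <= t -> T t x = T (t / 2) (T (t / 2) x),
      forall t x, 0 <= t -> nsq (T t x) <= nsq x &
      forall t, 0 < t -> exists C, hs_le E (T t) C].

(* With [T s = e^{-sB}] and [K = A^-1], this is implied by [B <= A]: for [y = K x],
   [<(1 - T s) y, y> <= s <B y, y> <= s <A y, y>]. *)
Definition dominated (T : R -> H -> H) K := forall s x, 0 < s ->
  nsq (K x) - rip (T s (K x)) (K x) <= s * rip (K x) x.

Variables (T : R -> H -> H) (TS : hs_contraction_semigroup T).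

Let Tsym t : 0 <= t -> symmetric_op (T t). Proof. by case: TS => + _ _ _; apply. Qed.
Let Thalf t x : 0 <= t -> T t x = T (t / 2) (T (t / 2) x).
Proof. by case: TS => _ + _ _; apply. Qed.
Let Tcontr t x : 0 <= t -> nsq (T t x) <= nsq x.
Proof. by case: TS => _ _ + _; apply. Qed.
Let Ths t : 0 < t -> exists C, hs_le E (T t) C.
Proof. by case: TS => _ _ _; apply. Qed.

Lemma hs_semigroup_half t x : 0 <= t -> rip (T t x) x = nsq (T (t / 2) x).
Proof. by move=> t0; rewrite Thalf// symmetric_rip//; apply: Tsym; rewrite divr_ge0. Qed.

(** [(1 - T)^2 <= 1 - T] amounts to [T^2 <= T], which holds since [<T t x, x>] is [|T (t / 2) x|^2]
    and [T (t / 2)] is a contraction. *)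
Lemma hs_semigroup_defect t x : 0 <= t -> nsq (x - T t x) <= nsq x - rip (T t x) x.
Proof.
move=> t0; have t20 : 0 <= t / 2 by rewrite divr_ge0.
have : nsq (T t x) <= rip (T t x) x by rewrite hs_semigroup_half// Thalf// Tcontr.
by rewrite nsqB (ripC x); lra.
Qed.

(** Domination is used at [s = d / 4]. Bounding [<T s K x, K x>] by [(|T s K x|^2 + |K x|^2) / 2]
    lets half of [|K x|^2] be absorbed, and [hs_approx] handles [|T s K x|^2]. *)
Lemma dominated_compact K : symmetric_op K -> (forall x, nsq (K x) <= nsq x) ->
  dominated T K -> compact_op K.
Proof.
move=> sK K1 dK d d0; have d40 : 0 < d / 4 by rewrite divr_gt0.
have d20 : 0 < d / 2 by rewrite divr_gt0.
have [C hC] := Ths d40.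
have [G GE hG] := hs_approx trace_basisP (Tsym (ltW d40)) hC d20.
exists [seq K (T (d / 4) e) | e <- G] => x; rewrite big_map.
have h1 := dK _ x d40; have h2 := rip_le (T (d / 4) (K x)) (K x).
have h3 := hG (K x).
rewrite (eq_bigr (fun e => c2 (inner x (K (T (d / 4) e))))) in h3; last first.
  by move=> e _; rewrite sK.
have h4 := rip_le (K x) x; have h5 := K1 x.
have h6 := ler_wpM2l (ltW d0) h5; have h7 := ler_wpM2l (ltW d0) h4; lra.
Qed.

Section Eigenbasis.
Variables (K : H -> H) (F : set H) (m : H -> R).
Hypotheses (FB : orthonormal_basis F) (dK : dominated T K).
Hypothesis Fm : forall f, F f -> 1 <= m f /\ K f = (m f)^-1%:C *: f.

Let f1 f : F f -> nsq f = 1. Proof. exact: (nsq1 (basis_orthonormal FB)). Qed.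

Lemma dominated_eigen s f : 0 < s -> F f -> 1 - rip (T s f) f <= s * m f.
Proof.
move=> s0 Ff; have [m1 Kf] := Fm Ff; have m0 : 0 < m f by apply: lt_le_trans m1.
have Tlin := symmetric_op_linear (Tsym (ltW s0)).
have := dK f s0; rewrite Kf (linZ Tlin) nsqZr !ripZl ripZr -/(nsq f) (f1 Ff) !mulr1.
move=> h; have m2 : 0 < m f ^+ 2 by rewrite exprn_gt0.
have := ler_wpM2l (ltW m2) h.
have -> : m f ^+ 2 * ((m f)^-1 ^+ 2 - (m f)^-1 * ((m f)^-1 * rip (T s f) f)) =
  1 - rip (T s f) f by field; rewrite gt_eqF.
by have -> : m f ^+ 2 * (s * (m f)^-1) = s * m f by field; rewrite gt_eqF.
Qed.

(* [<T(2s)f, f> >= <T(s)f, f>^2], started from [<T(s)f, f> >= 1 - s m] at small [s]. *)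
Lemma dominated_expR r f : 0 < r -> F f -> expR (- (2 * r * m f)) <= rip (T r f) f.
Proof.
move=> r0 Ff; have [m1 _] := Fm Ff; have m0 : 0 < m f by apply: lt_le_trans m1.
(* For [0 <= y <= 1/2] one has [(1 - y) (1 + 2 y) >= 1], hence [1 - y >= e^{-2y}]. This is the
   origin of the factor 2 in the exponent. *)
have small s : 0 < s -> s * m f <= 2^-1 -> expR (- (2 * s * m f)) <= rip (T s f) f.
  move=> s0 sm; have := dominated_eigen s0 Ff; set y := s * m f in sm *.
  have y0 : 0 < y by rewrite mulr_gt0.
  rewrite -mulrA -/y => h; have := expR_ge1Dx (2 * y).
  have e0 := expR_gt0 (- (2 * y)).
  have : expR (2 * y) * expR (- (2 * y)) = 1 := expRxMexpNx_1 _.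
  by nra.
have dbl s : 0 < s -> expR (- (2 * s * m f)) <= rip (T s f) f ->
    expR (- (2 * (s * 2) * m f)) <= rip (T (s * 2) f) f.
  move=> s0 h; have s20 : 0 <= s * 2 by rewrite mulr_ge0// ltW.
  rewrite hs_semigroup_half// mulfK//.
  have -> : - (2 * (s * 2) * m f) = - (2 * s * m f) + - (2 * s * m f) by ring.
  rewrite expRD; have := rip_c2_le (T s f) f; rewrite (f1 Ff) mulr1.
  apply: le_trans; rewrite -expr2 ler_sqr ?nnegrE ?expR_ge0//.
  exact: le_trans h.
have pw k s : 0 < s -> expR (- (2 * s * m f)) <= rip (T s f) f ->
    expR (- (2 * (s * 2 ^+ k) * m f)) <= rip (T (s * 2 ^+ k) f) f.
  elim: k s => [|k IH] s s0 h; first by rewrite expr0 mulr1.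
  have -> : s * 2 ^+ k.+1 = s * 2 * 2 ^+ k by rewrite exprS mulrA.
  by apply: (IH (s * 2)); [rewrite mulr_gt0|exact: dbl].
(* Enough halvings to bring [r m] below [1/2]. *)
pose k := Num.bound (2 * (r * m f)).
have b0 : 0 <= 2 * (r * m f) by rewrite !mulr_ge0 ?ltW.
have k2 : 0 < 2 ^+ k :> R by rewrite exprn_gt0.
rewrite -(divfK (lt0r_neq0 k2) r); apply: pw; first by rewrite divr_gt0.
apply: small; first by rewrite divr_gt0.
rewrite mulrAC ler_pdivrMr// ler_pdivlMl//.
by rewrite (le_trans (ltW (archi_boundP b0)))// -natrX ler_nat ltnW// ltn_expl.
Qed.

(** [<T r f, f> = |T (r / 2) f|^2], and the Hilbert-Schmidt sum does not depend on the basis. So the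
    bound is the same for all dominated operators. *)
Lemma dominated_expR_sum r C G : 0 < r -> hs_le E (T (r / 2)) C -> fin_in G F ->
  \sum_(f <- G) expR (- (2 * r * m f)) <= C.
Proof.
move=> r0 hC GF; have r20 : 0 <= r / 2 by rewrite divr_ge0// ltW.
have hC' := hs_le_sym trace_basisP (basis_orthonormal FB) (Tsym r20) hC.
apply: le_trans (hC' G GF); rewrite big_seq [leRHS]big_seq.
apply: ler_sum => f fG; rewrite -(hs_semigroup_half f (ltW r0)).
by apply: dominated_expR => //; exact: GF.
Qed.

Variable (c : R).
Let X t := exp_mult F (fun f => m f + c) t.
Let mc f : F f -> c + 1 <= m f + c.
Proof. by move=> /Fm[m1 _]; rewrite addrC lerD2r. Qed.

Let Xf t f : 0 <= t -> F f -> X t f = (expR (- (t * (m f + c))))%:C *: f.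
Proof. by move=> t0 Ff; rewrite /X /exp_mult (mult_basis FB (exp_bounded_on mc t0) Ff). Qed.

Let Xsym t : 0 <= t -> symmetric_op (X t).
Proof. by move=> t0; apply: (mult_sym FB (exp_bounded_on mc t0)); exact: sqr_ge0. Qed.

Let nsqXf t f : 0 <= t -> F f ->
  nsq (X t f) = expR (- (2 * t * c)) * expR (- (2 * t * m f)).
Proof.
by move=> t0 Ff; rewrite Xf// nsqZr (f1 Ff) mulr1 expr2 -!expRD; congr expR; ring.
Qed.

Lemma dominated_hs t C : 0 < t -> hs_le E (T (t / 2)) C ->
  hs_le E (X t) (expR (- (2 * t * c)) * C).
Proof.
move=> t0 hC; apply: (hs_le_sym FB (basis_orthonormal trace_basisP) (Xsym (ltW t0))).
move=> G GF; rewrite big_seq.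
under eq_bigr => f fG do rewrite (nsqXf (ltW t0) (GF _ fG)).
rewrite -big_seq -mulr_sumr ler_wpM2l ?expR_ge0//.
exact: dominated_expR_sum.
Qed.

(** Computed for the adjoint [(1 - T s) X t], where [X t] acts first and by a scalar on
    eigenvectors. The bound [|(1 - T s) f|^2 <= s m] grows with [m]: half of the decay [e^{-2tm}]
    absorbs this through [y e^{-y} <= 1], and the other half is summed at time [t / 2], whence
    [T (t / 2 / 2)]. *)
Lemma dominated_hs_defect t s C : 0 < t -> 0 < s -> hs_le E (T (t / 2 / 2)) C ->
  hs_le E (fun x => X t (x - T s x)) (expR (- (2 * t * c)) * (s / t * C)).
Proof.
move=> t0 s0 hC; have t20 : 0 < t / 2 by rewrite divr_gt0.
apply: (hs_transfer FB (basis_orthonormal trace_basisP)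
  (S := fun x => X t x - T s (X t x))).
  move=> x y; rewrite innerBl (Tsym (ltW s0)) -innerBr (Xsym (ltW t0)).
  by [].
move=> G GF; apply: (@le_trans _ _ (\sum_(f <- G)
    expR (- (2 * t * c)) * (s / t * expR (- (2 * (t / 2) * m f))))).
  rewrite big_seq [leRHS]big_seq; apply: ler_sum => f fG; have Ff := GF _ fG.
  have [m1 _] := Fm Ff; have m0 : 0 < m f by apply: lt_le_trans m1.
  have Tlin := symmetric_op_linear (Tsym (ltW s0)).
  rewrite (Xf (ltW t0) Ff) (linZ Tlin) -scalerBr nsqZr.
  have -> : expR (- (t * (m f + c))) ^+ 2 =
      expR (- (2 * t * c)) * expR (- (2 * t * m f)).
    by rewrite expr2 -!expRD; congr expR; ring.
  rewrite -mulrA ler_wpM2l ?expR_ge0//.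
  have h1 : nsq (f - T s f) <= s * m f.
    by rewrite (le_trans (hs_semigroup_defect f (ltW s0)))// (f1 Ff) dominated_eigen.
  apply: le_trans (ler_wpM2l (expR_ge0 _) h1) _.
  have -> : - (2 * t * m f) = - (2 * (t / 2) * m f) + - (t * m f) by field.
  have -> : s * m f = s / t * (t * m f) by field; rewrite gt_eqF.
  rewrite expRD; set y := t * m f.
  have ye : expR (- y) * y <= 1.
    rewrite -[leRHS](expRxMexpNx_1 y) [leRHS]mulrC ler_wpM2l ?expR_ge0//.
    by rewrite (le_trans _ (expR_ge1Dx y))// lerDr.
  have st0 : 0 <= s / t by rewrite divr_ge0// ltW.
  set e := expR (- (2 * _ * _)).
  by have := ler_wpM2l st0 (ler_wpM2l (expR_ge0 _ : 0 <= e) ye); lra.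
have st0 : 0 <= s / t by rewrite divr_ge0// ltW.
rewrite -!mulr_sumr ler_wpM2l ?expR_ge0// ler_wpM2l//.
exact: dominated_expR_sum.
Qed.

End Eigenbasis.

End Domination.

(** * Strong convergence *)

Section ExpApproximation.
Context {R : realType}.
Implicit Types (x y : R) (n : nat).

Lemma subrX_le (p q : R) n : 0 <= q -> q <= p ->
  p ^+ n.+1 - q ^+ n.+1 <= n.+1%:R * (p - q) * p ^+ n.
Proof.
move=> q0 qp; have p0 : 0 <= p by apply: le_trans qp.
elim: n => [|n IH]; first by rewrite !expr1 expr0; lra.
have h1 : q ^+ n.+1 <= p ^+ n.+1 by rewrite lerXn2r.
have h2 : (p - q) * q ^+ n.+1 <= (p - q) * p ^+ n.+1 by rewrite ler_wpM2l// subr_ge0.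
have h3 := ler_wpM2l p0 IH.
have e1 : p * (n.+1%:R * (p - q) * p ^+ n) = n.+1%:R * (p - q) * p ^+ n.+1.
  by rewrite (exprS p n); ring.
rewrite e1 in h3; rewrite (exprS p n.+1) (exprS q n.+1) -natr1.
set a := p ^+ n.+1 in h1 h2 h3 *; set b := q ^+ n.+1 in h1 h2 h3 *.
by set k := n.+1%:R in h3 *; lra.
Qed.

Lemma bernoulli2 y n : 0 <= y -> 1 + n%:R * y + n%:R * (n%:R - 1) / 2 * y ^+ 2 <= (1 + y) ^+ n.
Proof.
move=> y0; elim: n => [|n IH]; first by rewrite !mul0r expr0; lra.
have y10 : 0 <= 1 + y by rewrite addr_ge0.
rewrite [(1 + y) ^+ n.+1]exprS; apply: le_trans (ler_wpM2l y10 IH); rewrite -natr1.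
have [->|n0] := eqVneq n 0; first by lra.
have n1 : 1 <= n%:R :> R by rewrite ler1n lt0n.
have : 0 <= n%:R * (n%:R - 1) / 2 * y ^+ 3.
  by rewrite !mulr_ge0 ?exprn_ge0// subr_ge0.
by rewrite !exprS expr0; lra.
Qed.

(** The bound is uniform in [x]. With [N = n + 2], [y = x / N] and [p = 1 / (1 + y)], one has
    [p - e^{-y} <= y^2 p]; so the powers differ by at most [N y^2 p^N], and the second-order
    binomial bound for [(1 + y)^N] makes this at most [2 / (N - 1)]. *)
Lemma expR_rational_approx x n : 0 <= x ->
  `|(1 + x / n.+2%:R)^-1 ^+ n.+2 - expR (- x)| <= 2 * harmonic n.
Proof.
move=> x0; pose N : R := n.+2%:R; pose y := x / N.
have N0 : 0 < N by rewrite ltr0n.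
have y0 : 0 <= y by rewrite divr_ge0// ltW.
have y1 : 0 < 1 + y by rewrite ltr_wpDr.
pose p := (1 + y)^-1; pose q := expR (- y).
have p0 : 0 < p by rewrite invr_gt0.
have q0 : 0 < q by exact: expR_gt0.
have py : p * (1 + y) = 1 by rewrite mulVf// gt_eqF.
have qp : q <= p.
  by rewrite /q expRN lef_pV2 ?posrE ?expR_gt0// expR_ge1Dx.
have -> : expR (- x) = q ^+ n.+2.
  by rewrite /q -expRM_natl -/N /y mulrN mulrC divfK// gt_eqF.
rewrite -/N -/y -/p ger0_norm; last by rewrite subr_ge0 lerXn2r// nnegrE ltW.
apply: le_trans (subrX_le n.+1 (ltW q0) qp) _; rewrite -/N.
have pq : p - q <= y ^+ 2 * p.
  by have := expR_ge1Dx (- y); rewrite -/q; nra.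
have P0 : 0 < p ^+ n.+2 by rewrite exprn_gt0.
apply: (@le_trans _ _ (N * y ^+ 2 * p ^+ n.+2)).
  rewrite (exprS p n.+1) mulrA ler_wpM2r ?exprn_ge0 ?(ltW p0)//.
  by rewrite -[leRHS]mulrA ler_wpM2l// ltW.
have N1 : N - 1 = n.+1%:R by rewrite /N -natr1 addrK.
have k0 : 0 < n.+1%:R :> R by rewrite ltr0n.
rewrite /= ler_pdivlMr//.
have : N * (N - 1) / 2 * y ^+ 2 * p ^+ n.+2 <= 1.
  have := ler_wpM2r (ltW P0) (bernoulli2 n.+2 y0).
  rewrite -exprMn (mulrC (1 + y)) py expr1n -/N; apply: le_trans.
  rewrite ler_wpM2r ?(ltW P0)// lerDr addr_ge0// mulr_ge0// ltW//.
rewrite N1; set k := n.+1%:R; set P := p ^+ n.+2; lra.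
Qed.

End ExpApproximation.

(** * Strong convergence of resolvents at real points *)

Section StrongConvergence.
Context {R : realType} {H : hilbertType R}.
Local Open Scope complex_scope.
Implicit Types (x y z : H).

Definition eigenresolvent (c : R) (A : graph H) (F : set H) (m : H -> R) : Prop :=
  [/\ orthonormal_basis F,
      forall f, F f -> 1 <= m f /\ resolvent A c%:C f = (m f)^-1%:C *: f &
      diagonal A F (fun f => m f + c)].

(** Two solutions differ by a vector [d] with [A d = z d], which must vanish for symmetric [A] and
    nonreal [z]. *)
Lemma symmetric_resolvent_eq om (A : graph H) (z : R[i]) p y : sa_below om A ->
  complex.Im z != 0 -> A y (p + z *: y) -> resolvent A z p = y.
Proof.
move=> Asa z0 yA; rewrite /resolvent; case: xgetP => [y' _ /= y'A|/(_ y)//].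
have := graphB Asa y'A yA; rewrite opprD addrACA subrr add0r -scalerBr.
set d := y' - y => dA; apply/eqP; rewrite -subr_eq0 -/d; apply/eqP.
case: Asa => _ sym _ _ _; have := sym _ _ _ _ dA dA.
rewrite innerZl innerZr nsq_inner => h; apply: nsq_le0_eq0.
have : complex.Im (z * (nsq d)%:C) = complex.Im (z^* * (nsq d)%:C) by rewrite h.
move: z0; case: z {y'A yA dA h} => a b /= b0 h.
have /eqP : b * nsq d = 0 by lra.
by rewrite mulf_eq0 (negbTE b0)/= => /eqP ->.
Qed.

(** The symbol [1 / (u - i) = (u + i) / (u^2 + 1)] is split into real and imaginary parts, as [mult]
    takes real symbols. *)
Lemma nonreal_resolvent_ex c (A : graph H) F m (c' : R) p :
  eigenresolvent c A F m -> exists y, A y (p + (c' +i* 1) *: y).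
Proof.
move=> [FB Fm Ad]; pose u f := m f + c - c'.
pose ph1 f := u f / (u f ^+ 2 + 1); pose ph2 f := (u f ^+ 2 + 1)^-1.
have u1 f : 0 < u f ^+ 2 + 1 by rewrite ltr_wpDl ?sqr_ge0.
have b1 : bounded_on F ph1 1.
  move=> f _; rewrite /ph1 exprMn exprVn ler_pdivrMr ?exprn_gt0// mul1r.
  by have := sqr_ge0 (u f); set w := u f ^+ 2; rewrite !expr2 => w0; nra.
have b2 : bounded_on F ph2 1.
  move=> f _; rewrite /ph2 exprVn invf_le1 ?exprn_gt0// exprn_ege1//.
  by rewrite lerDr sqr_ge0.
exists (mult F ph1 p + (0 +i* 1) *: mult F ph2 p).
apply/Ad => f Ff; rewrite !innerDl !innerZl innerDl innerZl.
rewrite (inner_mult FB _ b1 Ff) (inner_mult FB _ b2 Ff).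
rewrite -[m f + c](subrK c') -/(u f) /ph1 /ph2.
case: (inner p f) => a b; have un0 := lt0r_neq0 (u1 f).
apply/eqP; rewrite eq_complex/=; apply/andP; split; apply/eqP; by field.
Qed.

Variables (c : R) (A_ : nat -> graph H) (A : graph H).
Hypotheses (A_sa : forall n, sa_below (c + 1) (A_ n)) (Asa : sa_below (c + 1) A).
Variables (F_ : nat -> set H) (m_ : nat -> H -> R).
Hypothesis A_eig : forall n, eigenresolvent c (A_ n) (F_ n) (m_ n).
Hypothesis Acvg : strong_resolvent_cvg A_ A.

(** The hypothesis speaks of nonreal points. With [y] the expected limit and [p = (A - z) y] for
    [z = c' + i], the vectors [yn = (A_n - z)^-1 p] tend to [y], and [(A_n - c')^-1 x - yn = (A_n -
    c')^-1 (i (y - yn))] tends to 0, as the real resolvents are uniformly bounded. *)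
Lemma real_resolvent_cvg (c' : R) x : c' < c + 1 ->
  resolvent (A_ n) c'%:C x @[n --> \oo] --> resolvent A c'%:C x.
Proof.
move=> cc; pose y := resolvent A c'%:C x; pose z := c' +i* 1.
have z0 : complex.Im z != 0 by rewrite /= oner_eq0.
pose p := x - (0 +i* 1) *: y.
have zE (w : H) : z *: w = c'%:C *: w + (0 +i* 1) *: w.
  by rewrite -scalerDl; congr (_ *: _); rewrite /z; simpc.
have py : p + z *: y = x + c'%:C *: y.
  by rewrite /p zE addrCA subrK addrC.
have yR : resolvent A z p = y.
  by apply: (symmetric_resolvent_eq Asa z0); rewrite py; exact: (resolvent_spec Asa x cc).
have hR : resolvent (A_ n) z p @[n --> \oo] --> y by rewrite -yR; exact: Acvg.
apply/(cvgH_seq _ _).2 => e e0.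
have k0 : 0 < 2 * (c + 1 - c') ^- 2 + 2.
  by rewrite ltr_wpDl// mulr_ge0// invr_ge0 sqr_ge0.
have [N hN] := (cvgH_seq _ _).1 hR _ (divr_gt0 e0 k0); exists N => n Nn.
have := hN n Nn; set yn := resolvent (A_ n) z p => hy.
have [y' y'A] := nonreal_resolvent_ex c' p (A_eig n).
have ynA : A_ n yn (p + z *: yn).
  by rewrite /yn (symmetric_resolvent_eq (A_sa n) z0 y'A).
have vA := resolvent_spec (A_sa n) x cc; set v := resolvent _ _ _ in vA *.
have dA := graphB (A_sa n) vA ynA.
have dE : resolvent (A_ n) c'%:C ((0 +i* 1) *: (y - yn)) = v - yn.
  apply: (resolvent_eq (A_sa n) cc); congr (A_ n _ _): dA.
  rewrite /p zE !scalerBr [RHS]addrC [RHS]addrACA -[x - _ + _]addrA opprD.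
  by rewrite [LHS]addrACA subrr add0r !opprD opprK [LHS]addrA.
have := resolvent_le (A_sa n) ((0 +i* 1) *: (y - yn)) cc.
rewrite dE nsqZ (_ : c2 _ = 1) ?mul1r; last by rewrite /c2 /= expr0n expr1n add0r.
have g0 : 0 < (c + 1 - c') ^+ 2 by rewrite exprn_gt0// subr_gt0.
rewrite -ler_pdivlMl// (nsqBC y) => h1.
apply: le_lt_trans (nsq_tri _ yn _) _.
move: hy; rewrite ltr_pdivlMr// -/y => hy.
by move: h1 hy; set i := _ ^- 2; lra.
Qed.

End StrongConvergence.

(** * Strong convergence of exponentials by rational approximation *)

Section RationalApproximation.
Context {R : realType} {H : hilbertType R}.
Local Open Scope complex_scope.
Implicit Types (x y z : H).

(** This is [(1 + (A - c) / r)^-1], a contraction when [A - c >= 1] and [r > 0]. *)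
Definition scaled_resolvent (c r : R) (A : graph H) x : H :=
  r%:C *: resolvent A (c - r)%:C x.

Section OneOperator.
Variables (c : R) (A : graph H) (F : set H) (m : H -> R).
Hypotheses (Asa : sa_below (c + 1) A) (Aeig : eigenresolvent c A F m).

Let FB : orthonormal_basis F. Proof. by case: Aeig. Qed.
Let m1 f : F f -> 1 <= m f. Proof. by case: Aeig => _ h _ /h[]. Qed.

Let lt_c r : 0 < r -> c - r < c + 1.
Proof. by move=> r0; rewrite ltrBlDr -addrA ltrDl addr_gt0. Qed.

Lemma inner_scaled_resolvent r x f : 0 < r -> F f ->
  inner (scaled_resolvent c r A x) f = (1 + m f / r)^-1%:C * inner x f.
Proof.
move=> r0 Ff; have [_ _ Ad] := Aeig.
have := resolvent_spec Asa x (lt_c r0); rewrite /scaled_resolvent innerZl.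
set y := resolvent _ _ _ => /Ad/(_ f Ff); rewrite innerDl innerZl => h.
have m0 : 0 < m f by apply: lt_le_trans (m1 Ff).
have -> : inner x f = (m f + r)%:C * inner y f.
  move/(canRL (addrK _)) : h => ->; rewrite -mulrBl -rmorphB /=.
  by congr (_%:C * _); ring.
rewrite mulrA -rmorphM /=; congr (_%:C * _).
by field; rewrite !gt_eqF// addr_gt0.
Qed.

Lemma scaled_resolvent_linear r : 0 < r -> linear (scaled_resolvent c r A).
Proof.
move=> r0 k x y; apply: (basis_eq FB) => f Ff.
rewrite inner_scaled_resolvent// [RHS]innerDl [X in _ = X + _]innerZl.
by rewrite !inner_scaled_resolvent// innerDl innerZl; ring.
Qed.

Let rho_ge0 r f : 0 < r -> F f -> 0 < (1 + m f / r)^-1 <= 1.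
Proof.
move=> r0 Ff; have m0 : 0 < m f by apply: lt_le_trans (m1 Ff).
have h : 0 < m f / r by rewrite divr_gt0.
by rewrite invr_gt0 addr_gt0//= invf_le1 ?addr_gt0// lerDl ltW.
Qed.

Lemma scaled_resolvent_le r x : 0 < r -> nsq (scaled_resolvent c r A x) <= nsq x.
Proof.
move=> r0; rewrite -[leRHS]mul1r; apply: (coord_le FB ler01) => f Ff.
rewrite inner_scaled_resolvent// c2M c2_real ler_wpM2r ?c2_ge0//.
by have /andP[h0 h1] := rho_ge0 r0 Ff; rewrite expr_le1// ltW.
Qed.

Lemma exp_iter_resolvent t k x : 0 < t ->
  nsq (exp_mult F (fun f => m f + c) t x -
       (expR (- (t * c)))%:C *: iter k.+2 (scaled_resolvent c (k.+2%:R / t) A) x) <=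
  (expR (- (t * c)) * (2 * harmonic k)) ^+ 2 * nsq x.
Proof.
move=> t0; have r0 : 0 < k.+2%:R / t by rewrite divr_gt0// ltr0n.
have mc f : F f -> c + 1 <= m f + c by move=> /m1 h; rewrite addrC lerD2r.
have iterE n f : F f -> inner (iter n (scaled_resolvent c (k.+2%:R / t) A) x) f =
    ((1 + m f / (k.+2%:R / t))^-1 ^+ n)%:C * inner x f.
  move=> Ff; elim: n => [|n IH]; first by rewrite expr0 mul1r.
  by rewrite iterS inner_scaled_resolvent// IH mulrA -rmorphM exprS.
apply: (coord_le FB (sqr_ge0 _)) => f Ff.
rewrite innerBl innerZl iterE// (inner_mult FB _ (exp_bounded_on mc (ltW t0)) Ff).
rewrite mulrA -rmorphM -mulrBl -rmorphB c2M c2_real ler_wpM2r ?c2_ge0//.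
have -> : - (t * (m f + c)) = - (t * c) + - (t * m f) by ring.
rewrite expRD -mulrBr !exprMn ler_wpM2l ?sqr_ge0// -exprMn.
rewrite -(real_normK (num_real _)) ler_sqr ?nnegrE//; last first.
  by rewrite mulr_ge0// harmonic_ge0.
rewrite distrC.
have m0 : 0 <= t * m f by rewrite mulr_ge0 ?ltW// (lt_le_trans ltr01)// m1.
have := expR_rational_approx k m0.
by rewrite (_ : t * m f / k.+2%:R = m f / (k.+2%:R / t))// invf_div mulrCA mulrA.
Qed.

End OneOperator.

Variables (c : R) (A_ : nat -> graph H) (A : graph H).
Hypotheses (A_sa : forall n, sa_below (c + 1) (A_ n)) (Asa : sa_below (c + 1) A).
Variables (F_ : nat -> set H) (m_ : nat -> H -> R) (F : set H) (m : H -> R).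
Hypothesis A_eig : forall n, eigenresolvent c (A_ n) (F_ n) (m_ n).
Hypothesis Aeig : eigenresolvent c A F m.
Hypothesis Acvg : strong_resolvent_cvg A_ A.

(** Products of strongly convergent contractions converge strongly to the product of the limits. *)
Lemma iter_resolvent_cvg r k x : 0 < r ->
  iter k (scaled_resolvent c r (A_ n)) x @[n --> \oo] -->
  iter k (scaled_resolvent c r A) x.
Proof.
move=> r0; elim: k => [|k IH]; first exact: cvg_cst.
apply/(cvgH_seq _ _).2 => e e0.
set u := iter k (scaled_resolvent c r A) x in IH *.
have cr : c - r < c + 1 by rewrite ltrBlDr -addrA ltrDl addr_gt0.
have h1 := (cvgH_seq _ _).1 IH.
have h2 := (cvgH_seq _ _).1 (@real_resolvent_cvg _ _ _ _ _ A_sa Asa _ _ A_eig Acvg _ u cr).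
have e4 : 0 < e / 4 by rewrite divr_gt0.
have r2 : 0 < r ^+ 2 by rewrite exprn_gt0.
have [N1 hN1] := h1 _ e4; have [N2 hN2] := h2 _ (divr_gt0 e4 r2).
exists (maxn N1 N2) => n; rewrite geq_max => /andP[n1 n2].
rewrite !iterS -/u; set un := iter k _ x in hN1 *.
have := hN1 n n1; have := hN2 n n2; rewrite ltr_pdivlMr// => g2 g1.
apply: le_lt_trans (nsq_tri _ (scaled_resolvent c r (A_ n) u) _) _.
rewrite -(linB (scaled_resolvent_linear (A_sa n) (A_eig n) r0)).
have g3 := scaled_resolvent_le (A_sa n) (A_eig n) (un - u) r0.
have -> : scaled_resolvent c r (A_ n) u - scaled_resolvent c r A u =
  r%:C *: (resolvent (A_ n) (c - r)%:C u - resolvent A (c - r)%:C u).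
  by rewrite scalerBr.
by rewrite [X in _ + 2 * X]nsqZr; lra.
Qed.

Lemma exp_mult_strong_cvg t x : 0 < t ->
  exp_mult (F_ n) (fun f => m_ n f + c) t x @[n --> \oo] -->
  exp_mult F (fun f => m f + c) t x.
Proof.
move=> t0; apply/(cvgH_seq _ _).2 => e e0.
pose q := expR (- (t * c)); have q0 : 0 < q by exact: expR_gt0.
pose d := e / (16 * (nsq x + 1)).
have x1 : 0 < nsq x + 1 by rewrite ltr_wpDl ?nsq_ge0.
have d0 : 0 < d by rewrite divr_gt0// mulr_gt0.
have s0 : 0 < Num.sqrt d / (2 * q) by rewrite divr_gt0 ?sqrtr_gt0// mulr_gt0.
(* [k] is fixed here for all [n] at once; only then is [n] taken large for this one iterate. *)
have [k hk] := harmonic_small s0; have {}hk := hk k (leqnn k).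
have dk : (q * (2 * harmonic k)) ^+ 2 <= d.
  rewrite -[leRHS](sqr_sqrtr (ltW d0)) ler_sqr ?nnegrE ?sqrtr_ge0//; last first.
    by rewrite mulr_ge0 ?(ltW q0)// mulr_ge0// harmonic_ge0.
  have -> : q * (2 * harmonic k) = harmonic k * (2 * q) by ring.
  by move: hk; rewrite ltr_pdivlMr ?mulr_gt0// => /ltW.
have r0 : 0 < k.+2%:R / t by rewrite divr_gt0// ltr0n.
have q2 : 0 < q ^+ 2 by rewrite exprn_gt0.
have e16 : 0 < e / 16 by rewrite divr_gt0.
have [N hN] := (cvgH_seq _ _).1 (@iter_resolvent_cvg _ k.+2 x r0) _ (divr_gt0 e16 q2).
exists N => n Nn; have := hN n Nn.
have := exp_iter_resolvent (A_sa n) (A_eig n) k x t0.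
have := exp_iter_resolvent Asa Aeig k x t0.
set a := iter _ _ _; set b := iter _ _ _; rewrite -/q.
set X := exp_mult _ _ _ _; set Xn := exp_mult _ _ _ _ => h1 h2.
rewrite ltr_pdivlMr// => h3.
have dx : (q * (2 * harmonic k)) ^+ 2 * nsq x <= e / 16.
  apply: (@le_trans _ _ (d * (nsq x + 1))).
    by rewrite ler_pM ?sqr_ge0 ?nsq_ge0// lerDl.
  rewrite le_eqVlt; apply/orP; left; apply/eqP; rewrite /d.
  by field; rewrite gt_eqF.
have h4 : nsq (q%:C *: b - q%:C *: a) < e / 16.
  by rewrite -scalerBr nsqZr mulrC.
have t1 := nsq_tri Xn (q%:C *: b) X; have t2 := nsq_tri (q%:C *: b) (q%:C *: a) X.
rewrite (nsqBC (q%:C *: a)) in t2.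
have {}h1 := le_trans h1 dx; have {}h2 := le_trans h2 dx; lra.
Qed.

End RationalApproximation.

(** * Convergence in trace norm *)

Section TraceConvergence.
Context {R : realType} {H : hilbertType R}.
Local Open Scope complex_scope.
Implicit Types (x y z : H).
Local Notation E := (@trace_basis R H).

(** The difference of the two defects is [Re <(1 - S) (y - z), y> + Re <(1 - S) z, y - z>], and
    [1 - S] has norm at most 2. *)
Lemma quadratic_defect_le (S : H -> H) y z : symmetric_op S ->
  (forall x, nsq (S x) <= nsq x) ->
  nsq y - rip (S y) y <= nsq z - rip (S z) z + 2 * hn (y - z) * (hn y + hn z).
Proof.
move=> sS S1; have Slin := symmetric_op_linear sS.
have S1h x : hn (S x) <= hn x by rewrite hn_le ?hn_ge0// -nsq_hn.
have D2 x : hn (x - S x) <= 2 * hn x.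
  by rewrite (le_trans (hnD _ _))// hnN; have := S1h x; lra.
have -> : nsq y - rip (S y) y = nsq z - rip (S z) z +
    (rip ((y - z) - S (y - z)) y + rip (z - S z) (y - z)).
  rewrite (linB Slin) /nsq !ripE (ripC z y) [rip (S z) y](symmetric_rip _ _ sS).
  by rewrite [rip z (S y)]ripC; ring.
rewrite lerD2l.
have h1 := rip_hn_le ((y - z) - S (y - z)) y.
have h2 := rip_hn_le (z - S z) (y - z).
have h3 := ler_wpM2r (hn_ge0 y) (D2 (y - z)).
have h4 := ler_wpM2r (hn_ge0 (y - z)) (D2 z).
lra.
Qed.

Variables (c : R) (T : R -> H -> H).
Hypothesis TS : hs_contraction_semigroup T.

Let c1 : c < c + 1. Proof. by rewrite ltrDl. Qed.

Lemma resolvent_contraction (A : graph H) x : sa_below (c + 1) A ->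
  nsq (resolvent A c%:C x) <= nsq x.
Proof.
move=> Asa; have := resolvent_le Asa x c1.
by rewrite addrC addKr expr1n mul1r.
Qed.

Lemma dominated_eigenresolvent (A : graph H) : sa_below (c + 1) A ->
  dominated T (resolvent A c%:C) -> exists F m, eigenresolvent c A F m.
Proof.
move=> Asa dK; have sK := resolvent_sym Asa c1.
have [F FB FK] := spectral_basis sK
  (dominated_compact TS sK (fun x => resolvent_contraction x Asa) dK).
have [m hm Ad] := resolvent_diagonal Asa c1 FB FK.
exists F, m; split=> // f /hm[m1 Kf]; split=> //.
by move: m1; rewrite addrC addKr.
Qed.

Variables (A_ : nat -> graph H) (A : graph H).
Hypotheses (A_sa : forall n, sa_below (c + 1) (A_ n)) (Asa : sa_below (c + 1) A).
Hypothesis A_dom : forall n, dominated T (resolvent (A_ n) c%:C).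
Hypothesis Acvg : strong_resolvent_cvg A_ A.

(** No inequality between [a] and [b] is given. [A] obtains domination, and with it a compact
    resolvent and the eigenvalue bounds, only as a limit of the [A_n]. *)
Lemma dominated_limit : dominated T (resolvent A c%:C).
Proof.
have /choice[Fm hFm] : forall n, exists Fm : set H * (H -> R),
    eigenresolvent c (A_ n) Fm.1 Fm.2.
  by move=> n; have [F [m h]] := dominated_eigenresolvent (A_sa n) (A_dom n); exists (F, m).
move=> s x s0; set y := resolvent A _ x.
have := @real_resolvent_cvg _ _ _ _ _ A_sa Asa _ _ hFm Acvg _ x c1.
rewrite -/y => /(cvgH_seq _ _).1 cv.
have [Tsym _ Tc _] := TS.
apply/ler_addgt0Pr => e e0.
have K0 : 0 < (s + 4) * hn x + 1.
  by rewrite ltr_wpDl// mulr_ge0 ?hn_ge0// addr_ge0// ltW.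
have [N hN] := cv _ (exprn_gt0 2 (divr_gt0 e0 K0)).
have := hN N (leqnn N); set z := resolvent _ _ _ => /ltW.
rewrite -hn_le; last by rewrite divr_ge0 ?ltW.
rewrite ler_pdivlMr// => zy.
have h1 := quadratic_defect_le y z (Tsym s (ltW s0)) (fun x => Tc s x (ltW s0)).
have h2 : nsq z - rip (T s z) z <= s * rip z x by exact: A_dom.
have h3 : rip z x <= rip y x + hn (z - y) * hn x.
  by rewrite -lerBlDl -ripBl rip_hn_le.
have hy : hn y <= hn x by rewrite hn_le ?hn_ge0// -nsq_hn resolvent_contraction.
have hz : hn z <= hn x by rewrite hn_le ?hn_ge0// -nsq_hn resolvent_contraction.
rewrite (hnB y) in h1.
have h4 := ler_wpM2l (ltW s0) h3.
have r0 := hn_ge0 (z - y).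
have h5 : hn (z - y) * (hn y + hn z) <= hn (z - y) * (2 * hn x).
  by rewrite ler_wpM2l//; lra.
lra.
Qed.

Lemma hs_convergence (F_ : nat -> set H) m_ F m :
  (forall n, eigenresolvent c (A_ n) (F_ n) (m_ n)) -> eigenresolvent c A F m ->
  forall t e : R, 0 < t -> 0 < e -> exists N, forall n, (N <= n)%N ->
    hs_le E (fun x => exp_mult (F_ n) (fun f => m_ n f + c) t x -
                      exp_mult F (fun f => m f + c) t x) e.
Proof.
move=> A_eig Aeig t e t0 e0.
have [Tsym _ Tc Ths] := TS.
have Adom := dominated_limit.
have t40 : 0 < t / 2 / 2 by rewrite !divr_gt0.
have [C hC] := Ths _ t40.
have C0 := hs_le_ge0 hC.
pose q := expR (- (2 * t * c)); have q0 : 0 < q := expR_gt0 _.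
have mcn n f : F_ n f -> c + 1 <= m_ n f + c.
  by case: (A_eig n) => _ h _ /h[]; rewrite addrC lerD2r.
have mc f : F f -> c + 1 <= m f + c.
  by case: Aeig => _ h _ /h[]; rewrite addrC lerD2r.
pose X n := exp_mult (F_ n) (fun f => m_ n f + c) t.
pose Y := exp_mult F (fun f => m f + c) t.
have FBn n : orthonormal_basis (F_ n) by case: (A_eig n).
have FB : orthonormal_basis F by case: Aeig.
pose b := expR (- (t * (c + 1))) ^+ 2.
have b0 : 0 <= b := sqr_ge0 _.
have Xlin n : linear (X n) := mult_linear (FBn n) (exp_bounded_on (@mcn n) (ltW t0)).
have Ylin : linear Y := mult_linear FB (exp_bounded_on mc (ltW t0)).
have Xle n x : nsq (X n x) <= b * nsq x.
  exact: (mult_le (FBn n) x (exp_bounded_on (@mcn n) (ltW t0)) b0).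
have Yle x : nsq (Y x) <= b * nsq x := mult_le FB x (exp_bounded_on mc (ltW t0)) b0.
(* The defect terms of [X n] and [Y] each enter with factor 4 and together take half of [e]. *)
have [s s0 sC] : exists2 s : R, 0 < s & 8 * (q * (s / t * C)) <= e / 2.
  have D0 : 0 < 16 * q * C + 1 by rewrite ltr_wpDl// !mulr_ge0// ltW.
  exists (t * (e / (16 * q * C + 1))); first by rewrite mulr_gt0 ?divr_gt0.
  have -> : t * (e / (16 * q * C + 1)) / t = e / (16 * q * C + 1).
    by field; rewrite !gt_eqF.
  set w := e / _; have w0 : 0 < w by rewrite divr_gt0.
  have we : w * (16 * q * C + 1) = e by rewrite /w divfK// gt_eqF.
  by rewrite -we; clearbody w; lra.
have hXn n : hs_le E (fun x => X n (x - T s x)) (q * (s / t * C)).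
  case: (A_eig n) => _ Fm _.
  exact: (dominated_hs_defect TS (FBn n) (@A_dom n) Fm c t0 s0 hC).
have hY : hs_le E (fun x => Y (x - T s x)) (q * (s / t * C)).
  case: Aeig => _ Fm _.
  exact: (dominated_hs_defect TS FB Adom Fm c t0 s0 hC).
have [CT hT] := Ths _ s0.
pose d := e / (32 * (b + 1)); have b10 : 0 < b + 1 by rewrite ltr_wpDl.
have d0 : 0 < d by rewrite divr_gt0// mulr_gt0.
(* Off the finite set [G0], the small tail of [T s] is multiplied by a uniform operator bound; on
   [G0], strong convergence at finitely many vectors suffices. *)
have [G0 G0E hG0] := hs_tail hT d0.
have [N hN] : exists N, forall n, (N <= n)%N ->
    \sum_(g <- G0) nsq (X n (T s g) - Y (T s g)) <= e / 8.
  move: (enum_fset G0) => r; have : 0 < e / 8 by rewrite divr_gt0.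
  move: (e / 8) => {hG0}; elim: r => [|g r IH] e' e'0.
    by exists 0%N => n _; rewrite big_nil ltW.
  have e2 : 0 < e' / 2 by rewrite divr_gt0.
  have [N1 hN1] := IH _ e2.
  have [N2 hN2] := (cvgH_seq _ _).1
    (@exp_mult_strong_cvg _ _ _ _ _ A_sa Asa _ _ _ _ A_eig Aeig Acvg _ (T s g) t0) _ e2.
  exists (maxn N1 N2) => n; rewrite geq_max => /andP[/hN1 h1 /hN2 h2].
  by rewrite big_cons; move: h1 h2; rewrite -/(X n) -/Y; lra.
exists N => n Nn G GE; rewrite -/(X n) -/Y.
have Zle x : nsq (X n x - Y x) <= 4 * (b * nsq x).
  by rewrite (le_trans (nsqB_le _ _))//; have := Xle n x; have := Yle x; lra.
have split1 x : nsq (X n x - Y x) <= 4 * nsq (X n (x - T s x)) +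
    4 * nsq (Y (x - T s x)) + 2 * nsq (X n (T s x) - Y (T s x)).
  have -> : X n x - Y x = (X n (x - T s x) - Y (x - T s x)) +
      (X n (T s x) - Y (T s x)).
    by rewrite addrACA -opprD -(linD (Xlin n)) -(linD Ylin) subrK.
  have := nsqD_le (X n (x - T s x) - Y (x - T s x)) (X n (T s x) - Y (T s x)).
  by have := nsqB_le (X n (x - T s x)) (Y (x - T s x)); lra.
apply: (@le_trans _ _ (\sum_(x <- G) (4 * nsq (X n (x - T s x)) +
    4 * nsq (Y (x - T s x)) + 2 * nsq (X n (T s x) - Y (T s x))))).
  by apply: ler_sum => x _; exact: split1.
rewrite !big_split/= -!mulr_sumr.
have g1 := hXn n G GE; have g2 := hY G GE.
have g3 : \sum_(x <- G) nsq (X n (T s x) - Y (T s x)) <= e / 4.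
  apply: (@le_trans _ _ (\sum_(x <- (G `|` G0)%fset) nsq (X n (T s x) - Y (T s x)))).
    by apply: fsum_le => [x|]; [exact: nsq_ge0|exact: fsubsetUl].
  rewrite (fsumID _ (fsubsetUr G G0)).
  have g4 := hN n Nn.
  have g5 := hG0 _ (fin_inU GE G0E) (fsubsetUr G G0).
  have g6 : \sum_(x <- (G `|` G0)%fset | x \notin G0) nsq (X n (T s x) - Y (T s x)) <=
      4 * (b * d).
    apply: (@le_trans _ _ (\sum_(x <- (G `|` G0)%fset | x \notin G0) 4 * (b * nsq (T s x)))).
      by apply: ler_sum => x _; exact: Zle.
    by rewrite -!mulr_sumr ler_wpM2l// ler_wpM2l.
  have g7 : 4 * (b * d) <= e / 8.
    have -> : e / 8 = 4 * ((b + 1) * d) by rewrite /d; field; rewrite gt_eqF.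
    by rewrite ler_wpM2l// ler_wpM2r ?(ltW d0)// lerDl.
  by move: g4 g6; set p1 := \sum_(g <- G0) _; set p2 := \sum_(x <- _ | _) _; lra.
move: g1 g2 g3; set p1 := \sum_(e <- G) nsq (X n _); set p2 := \sum_(e <- G) nsq (Y _).
by set p3 := \sum_(x <- G) nsq (_ - _); lra.
Qed.

Theorem dominated_trace_cvg (t : R) : 0 < t ->
  cvg_trace_class (fun n => exp_opp (A_ n) t) (exp_opp A t).
Proof.
move=> t0; have t20 : 0 < t / 2 by rewrite divr_gt0.
have Adom := dominated_limit; have [_ _ _ Ths] := TS.
have /choice[Fm hFm] : forall n, exists Fm : set H * (H -> R),
    eigenresolvent c (A_ n) Fm.1 Fm.2.
  by move=> n; have [F [m h]] := dominated_eigenresolvent (A_sa n) (A_dom n); exists (F, m).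
have [F [m Aeig]] := dominated_eigenresolvent Asa Adom.
pose X n := exp_mult (Fm n).1 (fun f => (Fm n).2 f + c) (t / 2).
pose Y := exp_mult F (fun f => m f + c) (t / 2).
have t40 : 0 < t / 2 / 2 by rewrite divr_gt0.
have [C hC] := Ths _ t40.
pose Cx := expR (- (2 * (t / 2) * c)) * C.
have main B F' m' : sa_below (c + 1) B -> eigenresolvent c B F' m' ->
    dominated T (resolvent B c%:C) ->
    let Z := exp_mult F' (fun f => m' f + c) (t / 2) in
    [/\ symmetric_op Z, bounded_operator Z, hs_le E Z Cx,
        bounded_operator (exp_opp B t) & forall x, exp_opp B t x = Z (Z x)].
  move=> Bsa [FB' Fm' Bd] Bdom Z.
  have mc f : F' f -> c + 1 <= m' f + c by move=> /Fm'[]; rewrite addrC lerD2r.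
  have bo := exp_bounded_on mc (ltW t20).
  have ZC0 := exp_mult_C0 FB' mc.
  have EB : exp_opp B t = exp_mult F' (fun f => m' f + c) t.
    by rewrite (exp_oppE Bsa FB' Bd mc (ltW t0)).
  split.
  - exact: (mult_sym FB' bo (sqr_ge0 _)).
  - exact: (mult_bounded FB' bo (sqr_ge0 _)).
  - exact: (dominated_hs TS FB' Bdom Fm' c t20 hC).
  - by rewrite EB; case: ZC0 => + _ _ _; apply; exact: ltW.
  - by move=> x; rewrite EB {1}(splitr t); case: ZC0 => _ _ -> //; exact: ltW.
have mX n := main _ _ _ (A_sa n) (hFm n) (@A_dom n).
have mY := main _ _ _ Asa Aeig Adom.
have C0 : 0 <= Cx by have [_ _ h _ _] := mY; exact: hs_le_ge0 h.
have tc B Z : symmetric_op Z -> bounded_operator Z -> hs_le E Z Cx ->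
    bounded_operator B -> (forall x, B x = Z (Z x)) -> trace_class B.
  move=> sZ bZ hZ bB BE; split=> //.
  have s0 : symmetric_op (fun=> 0 : H) by move=> x y; rewrite inner0l inner0r.
  have b0 : bounded_operator (fun=> 0 : H).
    apply: (bounded_operatorP (C := 0)); first exact: symmetric_op_linear.
    by move=> x; rewrite nsq0 mul0r.
  have h0 : hs_le E (fun=> 0 : H) 0 by move=> G _; rewrite big1// => e _; exact: nsq0.
  (* Finiteness comes from the inequality for differences of squares, with second operator 0. *)
  have -> : B = (fun x => Z (Z x) - 0) by apply/funext => x; rewrite subr0.
  apply: le_lt_trans (trace_norm_le sZ s0 bZ b0 hZ h0 (hs_leB hZ h0) (hs_leD hZ h0) ltr01) _.
  exact: ltry.
split.
- by move=> n; have [h1 h2 h3 h4 h5] := mX n; exact: tc h1 h2 h3 h4 h5.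
- by have [h1 h2 h3 h4 h5] := mY; exact: tc h1 h2 h3 h4 h5.
have small e : 0 < e -> exists N, forall n, (N <= n)%N ->
    (trace_norm (exp_opp (A_ n) t \- exp_opp A t)%R <= e%:E)%E.
  (* Squared Hilbert-Schmidt bounds [d e] for the difference and [4 Cx] for the sum, weighted by
     [d], give [(e + 4 d Cx) / 2 <= e]. *)
  move=> e0; pose d := e / (4 * Cx + 1).
  have D0 : 0 < 4 * Cx + 1 by rewrite ltr_wpDl// mulr_ge0.
  have d0 : 0 < d by rewrite divr_gt0.
  have [N hN] := hs_convergence hFm Aeig t20 (mulr_gt0 d0 e0).
  exists N => n /hN hZ.
  have [h1 h2 h3 _ h5] := mX n; have [k1 k2 k3 _ k5] := mY.
  have -> : exp_opp (A_ n) t \- exp_opp A t = (fun x => X n (X n x) - Y (Y x)).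
    by apply/funext => x; rewrite /= h5 k5.
  apply: le_trans (trace_norm_le h1 k1 h2 k2 h3 k3 hZ (hs_leD h3 k3) d0) _.
  rewrite lee_fin mulKf ?gt_eqF//.
  have dC : d * (4 * Cx + 1) = e by rewrite /d divfK// gt_eqF.
  by move: dC; rewrite mulrDr; lra.
apply/fine_cvgP; split.
  have [N hN] := small 1 ltr01; exists N => // n /= /hN h.
  by rewrite ge0_fin_numE ?trace_norm_ge0// (le_lt_trans h)// ltry.
apply/cvgrPdist_le => e e0; have [N hN] := small e e0; exists N => // n /= /hN.
have := trace_norm_ge0 (exp_opp (A_ n) t \- exp_opp A t).
rewrite /=; case: (trace_norm _) => //= r; rewrite !lee_fin => r0 re.
by rewrite sub0r normrN ger0_norm.
Qed.

End TraceConvergence.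

(** * From the form inequality to domination by the semigroup *)

Section FormDomination.
Context {R : realType} {H V : hilbertType R}.
Local Open Scope complex_scope.
Variables (b : sesquilinear_form R V) (j : {linear V -> H}).
Hypotheses (b_ell : j_elliptic j b) (b_sym : symmetric_sesquilinear b).
Variable c : R.
Hypothesis b_c : forall u, c * nsq (j u) <= complex.Re (b u u).
Variable T : R -> H -> H.
Hypotheses (TG : gibbs_semigroup T) (TB : generates (opp_graph (form_operator b j)) T).

Let B := form_operator b j.
Let Bsa : sa_below c B. Proof. exact: form_operator_sa_below. Qed.
Let TC : C0_semigroup T. Proof. by case: TB. Qed.
Let T' := rescale c T.
Let T'C : C0_semigroup T'. Proof. exact: rescale_C0. Qed.

Let genT' x f : B x f -> generator T' x (- f + c%:C *: x).
Proof.
move=> xf; apply: rescale_generator => //; have [_ h] := TB.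
by apply/h; rewrite /opp_graph opprK.
Qed.

Let genT'_inv x f : generator T' x f -> B x (c%:C *: x - f).
Proof.
move=> /(@rescale_generator _ _ (- c))/(_ T'C).
have -> : rescale (- c) T' = T.
  apply/funext => t; apply/funext => x'; rewrite /T' /rescale scalerA -rmorphM/=.
  by rewrite -expRD mulNr addNr expR0 scale1r.
have [_ h] := TB => /h; rewrite /opp_graph opprD rmorphN scaleNr opprK addrC.
by [].
Qed.

Let T'sym : symmetric_graph (generator T').
Proof.
move=> x f y g /genT'_inv xf /genT'_inv yg; case: Bsa => _ sym _ _ _.
have := congr1 (@complex.Re R) (sym _ _ _ _ xf yg).
by rewrite -!/(rip _ _) ripBl ripBr ripZl ripZr; lra.
Qed.

Let T'dense : dense_dom (generator T').
Proof.
move=> x d d0; case: Bsa => _ _ _ _ dom; have [y [[f yf] xy]] := dom x d d0.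
by exists y; split=> //; eexists; exact: genT' yf.
Qed.

Let T'neg x f : generator T' x f -> rip f x <= 0.
Proof.
move=> /genT'_inv xf; case: Bsa => _ _ low _ _; have := low _ _ xf.
by rewrite ripBl ripZl -/(nsq x); lra.
Qed.

Lemma gibbs_hs_contraction : hs_contraction_semigroup (rescale c T).
Proof.
split.
- by move=> t t0; exact: semigroup_sym.
- move=> t x t0; have [_ _ TD _] := T'C.
  by rewrite -/T' {1}(splitr t) TD// divr_ge0.
- by move=> t x t0; exact: semigroup_contraction.
- move=> t t0; have sT := generates_sym Bsa TB; have dT := generates_dense Bsa TB.
  have St := semigroup_sym TC sT dT (ltW t0).
  have Spos x : 0 <= rip (T t x) x.
    by rewrite (semigroup_half TC sT dT)//; [exact: nsq_ge0|exact: ltW].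
  have [_ /(_ t t0) tcT] := TG; have [C hC] := trace_class_hs St Spos tcT.
  exists (expR (c * t) ^+ 2 * C) => G GE.
  apply: le_trans (ler_wpM2l (sqr_ge0 _) (hC G GE)).
  by rewrite mulr_sumr; apply: ler_sum => e _; rewrite /rescale nsqZr.
Qed.

(* First for the regularization of [j w] by the resolvent at [c - nu], which lies in
   the domain of [B]; then [nu] tends to infinity. *)
Lemma form_semigroup_le s w : 0 < s ->
  nsq (j w) - rip (rescale c T s (j w)) (j w) <=
  s * (complex.Re (b w w) - c * nsq (j w)).
Proof.
move=> s0; set x := j w; set Q := _ - c * _.
have Q0 : 0 <= Q by rewrite subr_ge0 b_c.
apply/ler_addgt0Pr => e e0; have hx0 := hn_ge0 x.
have K0 : 0 < 4 * hn x + 2 by lra.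
(* Taking [nu = (Q + 1) / r^2] forces [|x - y| <= r], and for [r <= 1] the error [2 r (2 |x| + r)]
   in the defect is at most [r (4 |x| + 2) <= e]. *)
pose r := Num.min 1 (e / (4 * hn x + 2)).
have r0 : 0 < r by rewrite lt_min ltr01 divr_gt0.
have r1 : r <= 1 by rewrite ge_min lexx.
have re : r * (4 * hn x + 2) <= e by rewrite -ler_pdivlMr// ge_min lexx orbT.
have Q10 : 0 < Q + 1 by rewrite ltr_wpDl.
have r2 : 0 < r ^+ 2 by rewrite exprn_gt0.
have nu0 : 0 < (Q + 1) / r ^+ 2 by rewrite divr_gt0.
have [y [f [yf _ h1]]] := form_ge_resolvent b_ell b_sym b_c w nu0.
rewrite -/x -/Q => h2.
have xy : hn (x - y) <= r.
  rewrite hn_le ?(ltW r0)// -(ler_pM2l nu0) divfK ?gt_eqF//.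
  by move: h2; set k := _ / _; have := nsq_ge0 (x - y); have := ltW Q10; lra.
have := semigroup_generator_ge T'C T'sym T'dense (ltW s0) (genT' yf).
have -> : - rip (- f + c%:C *: y) y = rip (f - c%:C *: y) y.
  by rewrite -ripNl opprD opprK.
have sf : s * rip (f - c%:C *: y) y <= s * Q.
  rewrite ler_pM2l//; apply: le_trans h2; rewrite lerDl.
  by rewrite mulr_ge0 ?nsq_ge0// mulr_ge0// ltW.
have := @quadratic_defect_le _ _ (T' s) x y (semigroup_sym T'C T'sym T'dense (ltW s0))
  (fun z => semigroup_contraction T'C T'sym T'dense T'neg z (ltW s0)).
have hy : hn y <= hn x + r.
  by rewrite -{1}(subKr x y) (le_trans (hnD _ _))// hnN lerD2l.
have hxy : hn (x - y) * (hn x + hn y) <= r * (hn x + (hn x + r)).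
  by rewrite ler_pM ?hn_ge0 ?addr_ge0 ?hn_ge0 ?lerD2l.
have rr : r * r <= r * 1 by rewrite ler_pM2l.
rewrite -/T'; lra.
Qed.

End FormDomination.

Theorem theorem3p5 (R : realType) (H : hilbertType R) (Vn : nat -> hilbertType R)
    (V : hilbertType R) (jn : forall n, {linear (Vn n) -> H})
    (j : {linear V -> H}) (an : forall n, sesquilinear_form R (Vn n))
    (a b : sesquilinear_form R V)
    (sepH : separable_space H)
    (an_elliptic : forall n, j_elliptic (jn n) (an n))
    (an_sym : forall n, symmetric_sesquilinear (an n))
    (a_elliptic : j_elliptic j a) (a_sym : symmetric_sesquilinear a)
    (b_elliptic : j_elliptic j b) (b_sym : symmetric_sesquilinear b)
    (b_le_an : forall n, form_le b j (an n) (jn n))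
    (B_gibbs : exists T : R -> H -> H,
       gibbs_semigroup T /\ generates (opp_graph (form_operator b j)) T)
    (An_cvg : strong_resolvent_cvg (fun n => form_operator (an n) (jn n))
       (form_operator a j)) :
  forall t : R, 0 < t ->
    cvg_trace_class (fun n => exp_opp (form_operator (an n) (jn n)) t)
      (exp_opp (form_operator a j) t).
Proof.
have [oa [ma [ma0 ha]]] := form_ell a_elliptic.
have [ob [mb [mb0 hb]]] := form_ell b_elliptic.
have [T [TG TB]] := B_gibbs.
(* The lower bound of [A] comes from [a] itself, hence the minimum. Subtracting 1 makes [A_n - c]
   and [A - c] at least 1, so that their inverses are contractions. *)
pose c := Num.min oa ob - 1.
have c1 : c + 1 = Num.min oa ob by rewrite subrK.
have a_c u : (c + 1) * nsq (j u) <= complex.Re (a u u).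
  apply: le_trans (ha u); apply: ler_wpDl; first by rewrite mulr_ge0 ?nsq_ge0// ltW.
  by rewrite ler_wpM2r ?nsq_ge0// c1 ge_min lexx.
have b_c u : (c + 1) * nsq (j u) <= complex.Re (b u u).
  apply: le_trans (hb u); apply: ler_wpDl; first by rewrite mulr_ge0 ?nsq_ge0// ltW.
  by rewrite ler_wpM2r ?nsq_ge0// c1 ge_min lexx orbT.
have b_an n u : exists2 w, j w = jn n u & complex.Re (b w w) <= complex.Re (an n u u).
  have [sub le] := b_le_an n; have [w _ wu] := sub _ (imageT (jn n) u).
  by exists w => //; have := le u w (esym wu); rewrite lecE => /andP[].
(* Inherited from [b], hence uniform in [n] whatever the ellipticity constants of [an n] are. *)
have an_c n u : (c + 1) * nsq (jn n u) <= complex.Re (an n u u).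
  by have [w <- h] := b_an n u; exact: le_trans (b_c w) h.
have cc : c < c + 1 by rewrite ltrDl.
have b_c' u : c * nsq (j u) <= complex.Re (b u u).
  by apply: le_trans (b_c u); rewrite ler_wpM2r ?nsq_ge0// ltW.
have An_sa n := form_operator_sa_below (an_elliptic n) (an_sym n) (an_c n).
have A_sa := form_operator_sa_below a_elliptic a_sym a_c.
apply: (dominated_trace_cvg (gibbs_hs_contraction b_elliptic b_sym b_c' TG TB)
  An_sa A_sa _ An_cvg) => n s x s0.
have [u [hu e]] := form_resolvent (an_elliptic n) (an_sym n) (an_c n) x cc.
rewrite (resolvent_eq (An_sa n) cc hu) [rip _ x]ripC -e.
(* The resolvent vector [y] is represented by [u] for [an n] and by [w] for [b]. There [b] is at
   most [an n], and the energy identity [e] has turned [a_n[u] - c |y|^2] into [<x, y>]. *)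
have [w wu bw] := b_an n u; rewrite -wu.
apply: le_trans (form_semigroup_le b_elliptic b_sym b_c' TB w s0) _.
by rewrite ler_pM2l// lerD2r.
Qed.
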